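(* For arbitrary $\nu$ and $\mu$, $$\frac{s_+^{\nu-1}}{\Gamma_{q^2}(\nu)}*\frac{s_+^{\mu-1}}{\Gamma_{q^2}(\mu)}=\frac{s_+^{\nu+\mu-1}}{\Gamma_{q^2}(\nu+\mu)},$$ where $*$ is the $q^2$-convolution of $q^2$-distributions.
   Context: Throughout $0<q<1$. Notation: $(a,q^2)_0=1$, $(a,q^2)_n=\prod_{j=0}^{n-1}(1-aq^{2j})$, $(a,q^2)_\infty=\lim_n(a,q^2)_n$; $e_{q^2}(z)=\sum_{n\ge0}\frac{z^n}{(q^2,q^2)_n}$. For a function $\psi$: $\partial_s\psi(s)=\frac{\psi(s)-\psi(q^2s)}{(1-q^2)s}$, $\Lambda_s\psi(s)=\psi(q^2s)$. $S^{q^2}$ is the space of functions $\psi(s)$ on the lattice $\{\pm q^{2m}:m\in\mathbb Z\}$ with $|s^k\partial_s^l\psi(s)|\le C_{k,l}$ for all $k,l\ge0$ (topology given by the corresponding seminorms; values at $0$ are limits along the lattice); $(S^{q^2})'$ is the space of continuous linear functionals on it ($q^2$-distributions). Gamma function: $\Gamma_{q^2}(\nu)=\frac{(q^2,q^2)_\infty}{(q^{2\nu},q^2)_\infty}(1-q^2)^{1-\nu}$. The distribution $s_+^{\nu-1}$: for $\operatorname{Re}\nu>0$, $\langle s_+^{\nu-1},\psi\rangle=\int_0^\infty s^{\nu-1}\psi(s)\,d_{q^2}s=(1-q^2)\sum_{m\in\mathbb Z}q^{2m\nu}\psi(q^{2m})$; it is continued meromorphically in $\nu$, for $\operatorname{Re}\nu>-n-1$,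 by $$\int_0^1s^{\nu-1}\Bigl[\psi(s)-\sum_{k=0}^n\frac{(1-q^2)^ks^k}{(q^2,q^2)_k}\partial_s^k\psi(0)\Bigr]d_{q^2}s+\int_1^\infty s^{\nu-1}\psi(s)\,d_{q^2}s+\sum_{k=0}^n\frac{(1-q^2)^{k+1}}{(q^2,q^2)_k(1-q^{2(\nu+k)})}\partial_s^k\psi(0),$$ where $\int_0^1f\,d_{q^2}s=(1-q^2)\sum_{m\ge0}q^{2m}f(q^{2m})$ and $\int_1^\infty f\,d_{q^2}s=(1-q^2)\sum_{m<0}q^{2m}f(q^{2m})$. The quotient $s_+^{\nu-1}/\Gamma_{q^2}(\nu)$ is defined for all $\nu$, being extended by continuity in $\nu$ to the poles. Convolution: the $q^2$-shift is $T_\xi=e_{q^2}((1-q^2)\xi\Lambda_s^{-1}\partial_s)$, where $\xi s=q^2s\xi$, $\xi\partial_s=q^{-2}\partial_s\xi$, $\Lambda_s\xi=\xi\Lambda_s$; writing $\xi$ to the left of $s$, $T_\xi\psi(s)=\sum_{k\ge0}\frac{(1-q^2)^k}{(q^2,q^2)_k}\xi^k(\Lambda_s^{-k}\partial_s^k\psi)(s)$, and numerical lattice values of $\xi,s$ are substituted only after this ordering. The $q^2$-convolution of $r,g\in(S^{q^2})'$ is defined by $\langle r*g,\psi\rangle=\langle r(\xi)\times g(s),T_\xi\psi(s)\rangle$ for $\psi\in S^{q^2}$, where the direct product acts by $\langle g(s),\langle r(\xi),\psi(\xi,s)\rangle\rangle=\langle r(\xi),\langle g(s),\psi(\xi,s)\rangle\rangle$.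 (The operation $g\mapsto g*\frac{s_+^{\nu-1}}{\Gamma_{q^2}(\nu)}$ is the paper's $\partial_s^{-\nu}g$, the $q^2$-derivative of order $-\nu$ for $\nu<0$ and the $q^2$-primitive of order $\nu$ for $\nu>0$.) *)

(* Defs.v *)
From Stdlib Require Import Reals ZArith.
From Coquelicot Require Import Coquelicot.
Open Scope C_scope.

(* The point +q^(2m) is (true, m), the point -q^(2m) is (false, m). *)
Definition lattice : Type := bool * Z.

Definition lval (q : R) (x : lattice) : R :=
  ((if fst x then 1 else -1) * powerRZ q (2 * snd x))%R.

(* The lattice point q^(2k) s. *)
Definition lscale (k : Z) (s : lattice) : lattice := (fst s, (snd s + k)%Z).

Definition qLambda (k : Z) (psi : lattice -> C) : lattice -> C :=
  fun s => psi (lscale k s).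

Definition qder (q : R) (psi : lattice -> C) : lattice -> C :=
  fun s => (psi s - qLambda 1 psi s) / RtoC ((1 - q ^ 2) * lval q s).

Definition qder_n (q : R) (l : nat) (psi : lattice -> C) : lattice -> C :=
  Nat.iter l (qder q) psi.

(* Total operators in the style of [RInt]: meaningful when the value exists. *)
Definition Cthe (P : C -> Prop) : C := iota (T := C_R_CompleteNormedModule) P.

Definition Cseries (a : nat -> C) : C := Cthe (fun l => is_series a l).

Definition Clim_seq (a : nat -> C) : C :=
  Cthe (fun l => filterlim a eventually (locally (T := C_UniformSpace) l)).

Definition Clim (f : C -> C) (z : C) : C :=
  Cthe (fun l => filterlim f (locally' (T := C_UniformSpace) z)
                             (locally (T := C_UniformSpace) l)).

(* x^z = exp (z ln x), for x > 0. *)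
Definition Rcpower (x : R) (z : C) : C :=
  (exp (Re z * ln x) * cos (Im z * ln x),
   exp (Re z * ln x) * sin (Im z * ln x))%R.

(* (a, q^2)_n, (a, q^2)_oo; the base is q^2, not q. *)
Fixpoint qpoch (q : R) (a : C) (n : nat) : C :=
  match n with
  | O => 1
  | S m => qpoch q a m * (1 - a * RtoC (q ^ (2 * m)))
  end.

Definition qpoch_inf (q : R) (a : C) : C := Clim_seq (qpoch q a).

Definition q2poch (q : R) (n : nat) : C := qpoch q (RtoC (q ^ 2)) n.

Definition qGamma (q : R) (nu : C) : C :=
  qpoch_inf q (RtoC (q ^ 2)) / qpoch_inf q (Rcpower q (2 * nu))
  * Rcpower (1 - q ^ 2) (1 - nu).

Definition seminorm_le (q : R) (k l : nat) (psi : lattice -> C) (c : R) : Prop :=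
  forall s : lattice, (Cmod (RtoC (lval q s ^ k) * qder_n q l psi s) <= c)%R.

Definition qschwartz (q : R) (psi : lattice -> C) : Prop :=
  forall k l : nat, exists c : R, seminorm_le q k l psi c.

(* Only the values of a functional on S^(q^2) are meaningful. *)
Definition functional : Type := (lattice -> C) -> C.

Definition qlinear (q : R) (r : functional) : Prop :=
  forall (a b : C) (phi psi : lattice -> C),
    qschwartz q phi -> qschwartz q psi ->
    r (fun s => a * phi s + b * psi s) = a * r phi + b * r psi.

Definition qcontinuous (q : R) (r : functional) : Prop :=
  forall psi0 : lattice -> C, qschwartz q psi0 ->
  forall eps : R, (0 < eps)%R ->
  exists (N : nat) (delta : R), (0 < delta)%R /\
    forall psi : lattice -> C, qschwartz q psi ->
      (forall k l : nat, (k <= N)%nat -> (l <= N)%nat ->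
         seminorm_le q k l (fun s => psi s - psi0 s) delta) ->
      (Cmod (r psi - r psi0) < eps)%R.

Definition qdistribution (q : R) (r : functional) : Prop :=
  qlinear q r /\ qcontinuous q r.

(* Limit at 0 along the positive half-lattice, the only one seen by s_+^(nu-1). *)
Definition at_zero (psi : lattice -> C) : C :=
  Clim_seq (fun m => psi (true, Z.of_nat m)).

Definition int_0_1 (q : R) (f : lattice -> C) : C :=
  RtoC (1 - q ^ 2) *
  Cseries (fun m => let s := (true, Z.of_nat m) in RtoC (lval q s) * f s).

Definition int_1_oo (q : R) (f : lattice -> C) : C :=
  RtoC (1 - q ^ 2) *
  Cseries (fun m => let s := (true, (- Z.of_nat (S m))%Z) in RtoC (lval q s) * f s).

Definition int_0_oo (q : R) (f : lattice -> C) : C := int_0_1 q f + int_1_oo q f.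

Definition taylor_coef (q : R) (psi : lattice -> C) (k : nat) : C :=
  RtoC ((1 - q ^ 2) ^ k) / q2poch q k * at_zero (qder_n q k psi).

(* The continuation of s_+^(nu-1) to Re nu > -n-1. *)
Definition s_plus_reg (q : R) (n : nat) (nu : C) : functional := fun psi =>
  int_0_1 q (fun s => Rcpower (lval q s) (nu - 1) *
    (psi s - sum_n (fun k => taylor_coef q psi k * RtoC (lval q s ^ k)) n))
  + int_1_oo q (fun s => Rcpower (lval q s) (nu - 1) * psi s)
  + sum_n (fun k => RtoC (1 - q ^ 2) / (1 - Rcpower q (2 * (nu + RtoC (INR k))))
                    * taylor_coef q psi k) n.

(* [Int_part] is the floor, so for Re nu <= 0 the order n used here is the
   least natural number with Re nu > -n-1; a larger n gives the same value. *)
Definition s_plus (q : R) (nu : C) : functional := fun psi =>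
  if Rlt_dec 0 (Re nu)
  then int_0_oo q (fun s => Rcpower (lval q s) (nu - 1) * psi s)
  else s_plus_reg q (Z.to_nat (Int_part (- Re nu))) nu psi.

(* s_+^(nu-1) / Gamma(nu). The poles are the zeros of (q^(2 nu), q^2)_oo. *)
Definition s_plus_over_Gamma (q : R) (nu : C) : functional := fun psi =>
  if Ceq_dec (qpoch_inf q (Rcpower q (2 * nu))) 0
  then Clim (fun z => s_plus q z psi / qGamma q z) nu
  else s_plus q nu psi / qGamma q nu.

(* The k-th term of T_xi psi (s), with xi ordered to the left of s. *)
Definition qshift_term (q : R) (psi : lattice -> C) (xi s : lattice) (k : nat) : C :=
  RtoC ((1 - q ^ 2) ^ k) / q2poch q k * RtoC (lval q xi ^ k)
  * qLambda (- Z.of_nat k) (qder_n q k psi) s.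

(* r does not vanish on the half-lattice of sign sg. *)
Definition charges (q : R) (r : functional) (sg : bool) : Prop :=
  exists psi : lattice -> C, qschwartz q psi /\
    (forall s, fst s <> sg -> psi s = 0) /\ r psi <> 0.

(* <r, phi> = v. When xi s < 0, T_xi psi (s) grows faster than any power of
   xi, so xi |-> T_xi psi (s) is not in S^(q^2). As usual for distributions
   with restricted support, phi only has to agree with a test function where
   r lives. No interpolation across 0 is needed: the seminorms treat the two
   half-lattices separately, so cutting a test function to one of them yields
   a test function. If r charges both signs, this says phi is in S^(q^2) and
   r phi = v. *)
Definition is_qpairing (q : R) (r : functional) (phi : lattice -> C) (v : C) : Prop :=
  exists chi : lattice -> C, qschwartz q chi /\
    (forall s, charges q r (fst s) -> chi s = phi s) /\ r chi = v.

(* <r(xi) x g(s), F(xi, s)> = v: both iterated pairings exist and equal v. *)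
Definition is_direct_product (q : R) (r g : functional)
    (F : lattice -> lattice -> C) (v : C) : Prop :=
  (exists Phi : lattice -> C,
     (forall s, charges q g (fst s) -> is_qpairing q r (fun xi => F xi s) (Phi s)) /\
     is_qpairing q g Phi v) /\
  (exists Psi : lattice -> C,
     (forall xi, charges q r (fst xi) -> is_qpairing q g (fun s => F xi s) (Psi xi)) /\
     is_qpairing q r Psi v).

(* h = r * g in (S^(q^2))'. *)
Definition is_qconvolution (q : R) (r g h : functional) : Prop :=
  qdistribution q r /\ qdistribution q g /\ qdistribution q h /\
  forall psi : lattice -> C, qschwartz q psi ->
  exists T : lattice -> lattice -> C,
    (forall xi s, is_series (qshift_term q psi xi s) (T xi s)) /\
    is_direct_product q r g T (h psi).

(* Main.v *)
Require Import Defs.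
From Stdlib Require Import Reals ZArith Lra Lia FunctionalExtensionality.
From Coquelicot Require Import Coquelicot.
Open Scope C_scope.

(** Put [p = q ^ 2] and [x = p ^ nu], and write [f m] for the value of a test
    function at [p ^ m]. For [|x| < 1] the functional
    [s_+ ^ (nu - 1) / Gamma nu] is
    [(1 - p)^nu (x; p)_oo / (p; p)_oo * sum_m x^m f m], so up to the factor
    [(1 - p)^nu] it depends on [nu] through [x] only.

    Summation by parts replaces [f] by its lattice derivative and [x] by [x p]
    ([moment_dq]). It produces a factor [1 - 1 / x], which is absorbed by
    [(x; p)_oo], so that no pole remains. After [N] steps one gets a formula
    [frac N x f] that makes sense for [|x p^N| < 1] and does not depend on [N]
    ([frac_indep]). It agrees with the continuation by subtraction of a Taylor
    polynomial, because that one satisfies the same summation by parts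
    ([reg_dq], [reg_frac]), and also at the poles, because it is continuous in
    [x] ([tends_frac]) and the poles are isolated ([poles_isolated]).

    The q-shift has an explicit kernel. Expanding the iterated derivatives and
    summing Euler's series for [(z; p)_oo] gives, for [xi = p^a] and [s = p^b],
    the value [sum_c K (a - c) (b - c) f c] over [c <= min a b], where
    [K i j = p^(i j) (p; p)_oo / ((p; p)_i (p; p)_j)] ([qshift_kernel]). This
    kernel is symmetric, so the two iterated pairings are instances of one
    statement. It only sees [f] at points to the right of both [xi] and [s], so
    the q-shift is rapidly decreasing in each variable ([qshift_decreasing]).
    Its derivative is again a q-shift ([dq_qshift]), and therefore the same
    holds for all derivatives.

    For [|x|, |y| < 1] the theorem is now the evaluation of a double sum. By
    Euler's identity, the sum over [a] of [x^a] times the kernel is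
    [x^c (x; p)_(b-c) / (p; p)_(b-c)] times [(p; p)_oo / (x; p)_oo]
    ([partial_moment_explicit]). The sum over [b] of [y^b] times this is then
    evaluated by the q-binomial theorem as [(x y)^c] times a ratio of infinite
    products that turns the normalizations for [x] and [y] into the one for
    [x y] ([moment_partial_moment]). Arbitrary [x] and [y] are reduced to this
    case by [N] summations by parts in both variables ([frac_partial_frac]).

    On the negative half-lattice, which these functionals do not charge
    ([charges_positive]), only the convergence of the q-shift series is asserted
    ([shift_term_summable]). *)

(** * Limits of complex-valued functions along a filter *)

(** An explicit form of convergence to a complex limit, in which majorants are
    easier to use than in terms of neighbourhoods in the product topology of [C]. *)
Definition tends {T : Type} (F : (T -> Prop) -> Prop) (u : T -> C) (l : C) : Prop :=
  forall eps : R, (0 < eps)%R -> F (fun t => (Cmod (u t - l) < eps)%R).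

Lemma tends_iff {T : Type} (F : (T -> Prop) -> Prop) {FF : Filter F} (u : T -> C) (l : C) :
  tends F u l <-> filterlim u F (locally (T := C_UniformSpace) l).
Proof.
  split.
  - intros H. apply filterlim_locally. intros eps.
    generalize (H eps (cond_pos eps)). apply filter_imp. intros t Ht.
    apply C_NormedModule_mixin_compat1. exact Ht.
  - intros H eps Heps.
    assert (H2 : (0 < eps / sqrt 2)%R).
    { apply Rdiv_lt_0_compat; [exact Heps | apply sqrt_lt_R0; lra]. }
    generalize (proj1 (filterlim_locally u l) H (mkposreal _ H2)).
    apply filter_imp. intros t Ht.
    apply C_NormedModule_mixin_compat2 in Ht. simpl in Ht.
    replace (sqrt 2 * (eps / sqrt 2))%R with eps in Ht; [exact Ht|].
    field. apply Rgt_not_eq, sqrt_lt_R0; lra.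
Qed.

Section Limits.
Context {T : Type} (F : (T -> Prop) -> Prop) {FF : Filter F}.

Lemma tends_const (c : C) : tends F (fun _ => c) c.
Proof.
  intros eps H. apply filter_forall. intros _.
  replace (c - c) with (RtoC 0) by ring. rewrite Cmod_0. exact H.
Qed.

Lemma tends_ext_loc (u v : T -> C) (l : C) :
  F (fun t => u t = v t) -> tends F u l -> tends F v l.
Proof.
  intros E H eps Heps. generalize (filter_and _ _ E (H eps Heps)).
  apply filter_imp. intros t [-> Ht]. exact Ht.
Qed.

Lemma tends_ext (u v : T -> C) (l : C) :
  (forall t, u t = v t) -> tends F u l -> tends F v l.
Proof. intros E. apply tends_ext_loc, filter_forall, E. Qed.

Lemma tends_plus (u v : T -> C) (l m : C) :
  tends F u l -> tends F v m -> tends F (fun t => u t + v t) (l + m).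
Proof.
  intros Hu Hv eps Heps.
  assert (H2 : (0 < eps / 2)%R) by lra.
  generalize (filter_and _ _ (Hu _ H2) (Hv _ H2)).
  apply filter_imp. intros t [H1 H3].
  replace (u t + v t - (l + m)) with ((u t - l) + (v t - m)) by ring.
  eapply Rle_lt_trans; [apply Cmod_triangle | lra].
Qed.

Lemma tends_bounded (u : T -> C) (l : C) :
  tends F u l -> F (fun t => (Cmod (u t) <= Cmod l + 1)%R).
Proof.
  intros Hu. generalize (Hu 1%R Rlt_0_1). apply filter_imp. intros t Ht.
  replace (u t) with (l + (u t - l)) by ring.
  eapply Rle_trans; [apply Cmod_triangle | lra].
Qed.

Lemma tends_mult (u v : T -> C) (l m : C) :
  tends F u l -> tends F v m -> tends F (fun t => u t * v t) (l * m).
Proof.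
  intros Hu Hv eps Heps.
  set (A := (Cmod l + 1 + Cmod m + 1)%R).
  assert (HA : (0 < A)%R)
    by (unfold A; generalize (Cmod_ge_0 l) (Cmod_ge_0 m); lra).
  assert (H2 : (0 < eps / (2 * A))%R) by (apply Rdiv_lt_0_compat; lra).
  generalize (filter_and _ _ (tends_bounded _ _ Hu)
                         (filter_and _ _ (Hu _ H2) (Hv _ H2))).
  apply filter_imp. intros t [H0 [H1 H3]].
  replace (u t * v t - l * m) with (u t * (v t - m) + m * (u t - l)) by ring.
  eapply Rle_lt_trans; [apply Cmod_triangle|]. rewrite !Cmod_mult.
  assert (Cmod (u t) * Cmod (v t - m) <= A * Cmod (v t - m))%R.
  { apply Rmult_le_compat_r; [apply Cmod_ge_0|].
    unfold A. generalize (Cmod_ge_0 m). lra. }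
  assert (Cmod m * Cmod (u t - l) <= A * Cmod (u t - l))%R.
  { apply Rmult_le_compat_r; [apply Cmod_ge_0|].
    unfold A. generalize (Cmod_ge_0 l). lra. }
  assert (A * (Cmod (v t - m) + Cmod (u t - l)) < A * (2 * (eps / (2 * A))))%R.
  { apply Rmult_lt_compat_l; lra. }
  replace (A * (2 * (eps / (2 * A))))%R with eps in H5 by (field; lra).
  lra.
Qed.

Lemma tends_pow (u : T -> C) (l : C) (n : nat) :
  tends F u l -> tends F (fun t => u t ^ n) (l ^ n).
Proof.
  intros H. induction n as [|n IH]; simpl; [apply tends_const|now apply tends_mult].
Qed.

Lemma tends_opp (u : T -> C) (l : C) : tends F u l -> tends F (fun t => - u t) (- l).
Proof.
  intros H. apply (tends_ext (fun t => - (1) * u t)); [intros; ring|].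
  replace (- l) with (- (1) * l) by ring. apply tends_mult; [apply tends_const|exact H].
Qed.

Lemma tends_minus (u v : T -> C) (l m : C) :
  tends F u l -> tends F v m -> tends F (fun t => u t - v t) (l - m).
Proof. intros. apply tends_plus; [|apply tends_opp]; assumption. Qed.

(** This turns an identity [u t * v t = l] into a limit of [u] without first
    knowing that [u] is bounded: near [v = 1] the product controls [u]. *)
Lemma tends_div_one (u v : T -> C) (l : C) :
  tends F (fun t => u t * v t) l -> tends F v 1 -> tends F u l.
Proof.
  intros Huv Hv.
  assert (B : F (fun t => (Cmod (u t) <= 2 * (Cmod l + 1))%R)).
  { assert (H2 : (0 < / 2)%R) by lra.
    generalize (filter_and _ _ (tends_bounded _ _ Huv) (Hv _ H2)).
    apply filter_imp. intros t [H1 H3]. rewrite Cmod_mult in H1.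
    assert (/ 2 <= Cmod (v t))%R.
    { assert (Cmod 1 <= Cmod (v t) + Cmod (v t - 1))%R.
      { replace (RtoC 1) with (v t + - (v t - 1)) at 1 by ring.
        rewrite <- (Cmod_opp (v t - 1)). apply Cmod_triangle. }
      rewrite Cmod_1 in H. lra. }
    generalize (Cmod_ge_0 (u t)). nra. }
  intros eps Heps.
  set (A := (2 * (Cmod l + 1))%R) in *.
  assert (HA : (0 < A)%R) by (unfold A; generalize (Cmod_ge_0 l); lra).
  assert (H2 : (0 < eps / (2 * A))%R) by (apply Rdiv_lt_0_compat; lra).
  assert (H4 : (0 < eps / 2)%R) by lra.
  generalize (filter_and _ _ B (filter_and _ _ (Huv _ H4) (Hv _ H2))).
  apply filter_imp. intros t [H0 [H1 H3]].
  replace (u t - l) with ((u t * v t - l) + u t * (1 - v t)) by ring.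
  eapply Rle_lt_trans; [apply Cmod_triangle|]. rewrite Cmod_mult.
  replace (Cmod (1 - v t)) with (Cmod (v t - 1))
    by (rewrite <- Cmod_opp; f_equal; ring).
  assert (Cmod (u t) * Cmod (v t - 1) <= A * (eps / (2 * A)))%R.
  { apply Rmult_le_compat; try apply Cmod_ge_0; lra. }
  replace (A * (eps / (2 * A)))%R with (eps / 2)%R in H by (field; lra).
  lra.
Qed.

Lemma tends_le (u : T -> C) (l : C) (c : R) {PF : ProperFilter' F} :
  tends F u l -> (forall t, Cmod (u t) <= c)%R -> (Cmod l <= c)%R.
Proof.
  intros H B. apply Rnot_lt_le. intros Hl.
  assert (E : F (fun _ => False)).
  { assert (H2 : (0 < Cmod l - c)%R) by lra.
    generalize (H _ H2). apply filter_imp. intros t Ht.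
    generalize (B t) (Cmod_triangle (u t) (- (u t - l))).
    replace (u t + - (u t - l)) with l by ring. rewrite Cmod_opp. lra. }
  now apply filter_not_empty in E.
Qed.

Lemma tends_unique (u : T -> C) (l m : C) {PF : ProperFilter' F} :
  tends F u l -> tends F u m -> l = m.
Proof.
  intros Hl Hm. 
  generalize (tends_minus _ _ _ _ Hl Hm). intros H.
  apply (fun H => tends_le _ _ 0%R H) in H.
  - replace l with (m + (l - m)) by ring.
    rewrite (Cmod_eq_0 (l - m)); [ring|]. generalize (Cmod_ge_0 (l - m)). lra.
  - intros t. replace (u t - u t) with (RtoC 0) by ring. rewrite Cmod_0. lra.
Qed.

End Limits.

Lemma Cthe_unique (Q : C -> Prop) (x : C) :
  Q x -> (forall y, Q y -> y = x) -> Cthe Q = x.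
Proof. intros H U. now apply (iota_unique (V := C_R_CompleteNormedModule)). Qed.

Lemma Clim_seq_tends (u : nat -> C) (l : C) : tends eventually u l -> Clim_seq u = l.
Proof.
  intros H. apply Cthe_unique.
  - now apply (tends_iff eventually).
  - intros y Hy. apply (tends_iff eventually) in Hy.
    exact (tends_unique eventually u _ _ Hy H).
Qed.

(** * Finite and infinite sums of complex numbers *)

(** Unlike [sum_n], this sums the [n] terms [u 0, ..., u (n - 1)] and can be empty. *)
Fixpoint csum (u : nat -> C) (n : nat) : C :=
  match n with O => 0 | S m => csum u m + u m end.

Lemma csum_sum_n (u : nat -> C) (n : nat) : sum_n u n = csum u (S n).
Proof.
  induction n as [|n IH].
  - rewrite sum_O. simpl. ring.
  - rewrite sum_Sn, IH. reflexivity.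
Qed.

Lemma csum_ext (u v : nat -> C) (n : nat) :
  (forall i, (i < n)%nat -> u i = v i) -> csum u n = csum v n.
Proof.
  induction n as [|n IH]; intros H; [reflexivity|].
  simpl. rewrite IH by (intros; apply H; lia). now rewrite H by lia.
Qed.

Lemma csum_plus (u v : nat -> C) (n : nat) :
  csum (fun i => u i + v i) n = csum u n + csum v n.
Proof. induction n as [|n IH]; simpl; [ring|]. rewrite IH. ring. Qed.

Lemma csum_scal (c : C) (u : nat -> C) (n : nat) :
  csum (fun i => c * u i) n = c * csum u n.
Proof. induction n as [|n IH]; simpl; [ring|]. rewrite IH. ring. Qed.

Lemma csum_first (u : nat -> C) (n : nat) :
  csum u (S n) = u O + csum (fun i => u (S i)) n.
Proof. induction n as [|n IH]; simpl in *; [ring|]. rewrite IH. ring. Qed.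

Lemma csum_app (u : nat -> C) (n m : nat) :
  csum u (n + m) = csum u n + csum (fun i => u (n + i)%nat) m.
Proof.
  induction m as [|m IH].
  - rewrite Nat.add_0_r. simpl. ring.
  - rewrite Nat.add_succ_r. simpl. rewrite IH. ring.
Qed.

Lemma csum_zero (u : nat -> C) (n : nat) :
  (forall i, (i < n)%nat -> u i = 0) -> csum u n = 0.
Proof.
  intros H. rewrite (csum_ext u (fun i => 0 * 0)) by (intros; rewrite H by auto; ring).
  rewrite csum_scal. ring.
Qed.

Lemma csum_minus (u v : nat -> C) (n : nat) :
  csum (fun i => u i - v i) n = csum u n - csum v n.
Proof. induction n as [|n IH]; simpl; [ring|]. rewrite IH. ring. Qed.

Lemma csum_le (u : nat -> C) (b : nat -> R) (n : nat) :
  (forall i, Cmod (u i) <= b i)%R -> (Cmod (csum u n) <= sum_f_R0 b n - b n)%R.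
Proof.
  intros H. induction n as [|n IH]; simpl.
  - rewrite Cmod_0. lra.
  - eapply Rle_trans; [apply Cmod_triangle|]. generalize (H n). lra.
Qed.

Lemma tends_csum {T : Type} (F : (T -> Prop) -> Prop) {FF : Filter F}
  (a : T -> nat -> C) (l : nat -> C) (n : nat) :
  (forall i, tends F (fun t => a t i) (l i)) ->
  tends F (fun t => csum (a t) n) (csum l n).
Proof.
  intros H. induction n as [|n IH]; simpl.
  - now apply tends_const.
  - now apply tends_plus.
Qed.

Lemma is_series_tends (u : nat -> C) (l : C) :
  is_series u l <-> tends eventually (csum u) l.
Proof.
  unfold is_series. split; intros H.
  - intros eps He. change (filterlim (sum_n u) eventually (locally (T := C_UniformSpace) l)) in H.
    rewrite <- (tends_iff eventually) in H.
    destruct (H eps He) as [N HN]. exists (S N). intros n Hn.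
    destruct n as [|n]; [lia|]. rewrite <- csum_sum_n. apply HN. lia.
  - change (filterlim (sum_n u) eventually (locally (T := C_UniformSpace) l)).
    rewrite <- (tends_iff eventually). intros eps He.
    destruct (H eps He) as [N HN]. exists N. intros n Hn.
    rewrite csum_sum_n. apply HN. lia.
Qed.

Definition summable (u : nat -> C) : Prop := ex_series (fun n => Cmod (u n)).

Lemma is_series_Cseries (u : nat -> C) (l : C) : is_series u l -> Cseries u = l.
Proof.
  intros H. apply Cthe_unique; [exact H|]. intros y Hy.
  rewrite is_series_tends in H, Hy. exact (tends_unique eventually (csum u) _ _ Hy H).
Qed.

Lemma summable_is_series (u : nat -> C) : summable u -> is_series u (Cseries u).
Proof.
  intros H.
  destruct (ex_series_le (K := C_AbsRing) (V := C_CompleteNormedModule) u (fun n => Cmod (u n))) as [l Hl].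
  - intros n. apply Rle_refl.
  - exact H.
  - assert (Hl' : is_series (V := C_NormedModule) u l) by exact Hl.
    now rewrite (is_series_Cseries u l Hl').
Qed.

Lemma summable_tends (u : nat -> C) : summable u -> tends eventually (csum u) (Cseries u).
Proof. intros H. now apply is_series_tends, summable_is_series. Qed.

Lemma Cseries_eq (u : nat -> C) (l : C) : tends eventually (csum u) l -> Cseries u = l.
Proof. intros H. now apply is_series_Cseries, is_series_tends. Qed.

Lemma Cseries_ext (u v : nat -> C) : (forall n, u n = v n) -> Cseries u = Cseries v.
Proof.
  intros H. unfold Cseries. f_equal.
  replace v with u; [reflexivity|].
  apply FunctionalExtensionality.functional_extensionality. exact H.
Qed.

Lemma summable_le (u : nat -> C) (b : nat -> R) :
  (forall n, Cmod (u n) <= b n)%R -> ex_series b -> summable u.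
Proof.
  intros H Hb. apply (ex_series_le (K := R_AbsRing) (V := R_CompleteNormedModule) _ b); [|exact Hb].
  intros n. simpl. unfold norm; simpl. unfold abs; simpl.
  rewrite Rabs_pos_eq; [apply H | apply Cmod_ge_0].
Qed.

Lemma summable_ext (u v : nat -> C) : (forall n, u n = v n) -> summable u -> summable v.
Proof. intros H. apply ex_series_ext. intros n. now rewrite H. Qed.

Lemma summable_scal (c : C) (u : nat -> C) : summable u -> summable (fun n => c * u n).
Proof.
  intros H. apply (summable_le _ (fun n => Cmod c * Cmod (u n))%R).
  - intros n. rewrite Cmod_mult. lra.
  - apply (ex_series_scal (Cmod c) (fun n => Cmod (u n))). exact H.
Qed.

Lemma summable_plus (u v : nat -> C) :
  summable u -> summable v -> summable (fun n => u n + v n).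
Proof.
  intros Hu Hv. apply (summable_le _ (fun n => Cmod (u n) + Cmod (v n))%R).
  - intros n. apply Cmod_triangle.
  - apply (ex_series_plus (fun n => Cmod (u n)) (fun n => Cmod (v n))); assumption.
Qed.

Lemma summable_minus (u v : nat -> C) :
  summable u -> summable v -> summable (fun n => u n - v n).
Proof.
  intros Hu Hv. apply (summable_ext (fun n => u n + - (1) * v n)); [intros; ring|].
  apply summable_plus; [exact Hu | now apply summable_scal].
Qed.

Lemma summable_shift (u : nat -> C) (N : nat) :
  summable u <-> summable (fun n => u (N + n)%nat).
Proof. apply (ex_series_incr_n (fun n => Cmod (u n)) N). Qed.

Lemma Cseries_scal (c : C) (u : nat -> C) :
  summable u -> Cseries (fun n => c * u n) = c * Cseries u.
Proof.
  intros H. apply Cseries_eq.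
  apply (tends_ext eventually (fun n => c * csum u n)).
  - intros n. now rewrite csum_scal.
  - apply tends_mult; [apply eventually_filter|now apply (tends_const eventually)|].
    now apply summable_tends.
Qed.

Lemma Cseries_plus (u v : nat -> C) :
  summable u -> summable v -> Cseries (fun n => u n + v n) = Cseries u + Cseries v.
Proof.
  intros Hu Hv. apply Cseries_eq.
  apply (tends_ext eventually (fun n => csum u n + csum v n)).
  - intros n. now rewrite csum_plus.
  - apply tends_plus; [apply eventually_filter| |]; now apply summable_tends.
Qed.

Lemma Cseries_minus (u v : nat -> C) :
  summable u -> summable v -> Cseries (fun n => u n - v n) = Cseries u - Cseries v.
Proof.
  intros Hu Hv. rewrite (Cseries_ext _ (fun n => u n + - (1) * v n)) by (intros; ring).
  rewrite Cseries_plus, Cseries_scal; [ring|exact Hv|exact Hu|now apply summable_scal].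
Qed.

Lemma Cseries_split (u : nat -> C) (N : nat) :
  summable u -> Cseries u = csum u N + Cseries (fun n => u (N + n)%nat).
Proof.
  intros H. apply Cseries_eq.
  assert (H' := summable_tends _ (proj1 (summable_shift u N) H)).
  intros eps He.
  destruct (H' eps He) as [M HM]. exists (N + M)%nat. intros n Hn.
  replace n with (N + (n - N))%nat by lia. rewrite csum_app.
  replace (_ - _) with (csum (fun i => u (N + i)%nat) (n - N)
                        - Cseries (fun n => u (N + n)%nat)) by ring.
  apply HM. lia.
Qed.

Lemma Cseries_first (u : nat -> C) :
  summable u -> Cseries u = u O + Cseries (fun n => u (S n)).
Proof. intros H. rewrite (Cseries_split u 1 H). simpl. ring. Qed.

Lemma Cmod_Cseries_le (u : nat -> C) (b : nat -> R) :
  (forall n, Cmod (u n) <= b n)%R -> ex_series b -> (Cmod (Cseries u) <= Series b)%R.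
Proof.
  intros H Hb.
  refine (tends_le eventually (csum u) _ _ _ _).
  - apply summable_tends, (summable_le u b); assumption.
  - intros n. eapply Rle_trans; [apply csum_le, H|].
    assert (P : forall k, (0 <= b k)%R)
      by (intros k; eapply Rle_trans; [apply Cmod_ge_0 | apply H]).
    assert (sum_f_R0 b n <= Series b)%R.
    { rewrite (Series_incr_n b (S n)) by (try lia; assumption).
      simpl Init.Nat.pred.
      assert (0 <= Series (fun k => b (S n + k)%nat))%R; [|lra].
      rewrite <- (is_series_unique (fun _ => 0%R) 0%R).
      - apply Series_le.
        + intros k. split; [lra|apply P].
        + now apply (ex_series_incr_n b (S n)).
      - apply filterlim_ext with (fun _ : nat => 0%R).
        + intros k. rewrite sum_n_const. ring.
        + apply filterlim_const. }
    generalize (P n). lra.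
Qed.

Lemma Cseries_0 (u : nat -> C) : (forall n, u n = 0) -> Cseries u = 0.
Proof.
  intros H. apply Cseries_eq. apply (tends_ext eventually (fun _ => 0)).
  - intros n. symmetry. apply csum_zero. intros; apply H.
  - apply tends_const. apply eventually_filter.
Qed.

(** The tail of the majorant is uniformly small, and on the remaining finitely
    many terms a pointwise limit is uniform. *)
Lemma tannery {T : Type} (F : (T -> Prop) -> Prop) {FF : Filter F}
  (a : T -> nat -> C) (l : nat -> C) (b : nat -> R) :
  (forall i, tends F (fun t => a t i) (l i)) ->
  F (fun t => forall i, Cmod (a t i) <= b i)%R ->
  (forall i, Cmod (l i) <= b i)%R ->
  ex_series b ->
  tends F (fun t => Cseries (a t)) (Cseries l).
Proof.
  intros Hlim Ha Hl Hb eps Heps.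
  assert (HN : exists N, (Series (fun k => b (N + k)%nat) < eps / 4)%R).
  { destruct (proj1 (filterlim_locally (U := R_UniformSpace) _ _) (Series_correct _ Hb) (mkposreal (eps / 4) ltac:(lra)))
      as [N HN].
    exists (S N). specialize (HN N (Nat.le_refl N)).
    rewrite (Series_incr_n b (S N)) in HN by (try lia; assumption).
    simpl Init.Nat.pred in HN. rewrite sum_n_Reals in HN.
    change (Rabs (sum_f_R0 b N - (sum_f_R0 b N + Series (fun k => b (S N + k)%nat))) < eps / 4)%R in HN.
    apply Rabs_lt_between in HN. lra. }
  destruct HN as [N HN].
  assert (HbN : ex_series (fun k => b (N + k)%nat)) by now apply ex_series_incr_n.
  assert (H2 : (0 < eps / 2)%R) by lra.
  generalize (filter_and _ _ Ha (tends_csum F a l N Hlim _ H2)).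
  apply filter_imp. intros t [Hat Ht].
  rewrite (Cseries_split (a t) N), (Cseries_split l N)
    by (apply (summable_le _ b); assumption).
  replace (_ - _) with ((csum (a t) N - csum l N)
    + (Cseries (fun n => a t (N + n)%nat) + - Cseries (fun n => l (N + n)%nat))) by ring.
  eapply Rle_lt_trans; [apply Cmod_triangle|].
  assert (A : (Cmod (Cseries (fun n => a t (N + n)%nat)) <= Series (fun k => b (N + k)%nat))%R).
  { apply Cmod_Cseries_le; [intros n; apply Hat | exact HbN]. }
  assert (L : (Cmod (Cseries (fun n => l (N + n)%nat)) <= Series (fun k => b (N + k)%nat))%R).
  { apply Cmod_Cseries_le; [intros n; apply Hl | exact HbN]. }
  generalize (Cmod_triangle (Cseries (fun n => a t (N + n)%nat)) (- Cseries (fun n => l (N + n)%nat))).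
  rewrite Cmod_opp. lra.
Qed.

Lemma summable_term_le (u : nat -> C) (n : nat) :
  summable u -> (Cmod (u n) <= Series (fun k => Cmod (u k)))%R.
Proof.
  intros H.
  rewrite (Series_incr_n _ (S n)) by (try lia; exact H). simpl Init.Nat.pred.
  assert (0 <= Series (fun k => Cmod (u (S n + k)%nat)))%R.
  { eapply Rle_trans; [apply Cmod_ge_0|].
    apply (Cmod_Cseries_le (fun k => u (S n + k)%nat)); [intros; apply Rle_refl|].
    now apply (ex_series_incr_n (fun k => Cmod (u k)) (S n)). }
  assert (P : (0 <= sum_f_R0 (fun k => Cmod (u k)) n - Cmod (u n))%R).
  { eapply Rle_trans; [apply Cmod_ge_0|]. apply (csum_le u). intros; apply Rle_refl. }
  lra.
Qed.

Lemma Cseries_csum (u : nat -> nat -> C) (n : nat) :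
  (forall j, summable (fun i => u i j)) ->
  Cseries (fun i => csum (u i) n) = csum (fun j => Cseries (fun i => u i j)) n.
Proof.
  intros H.
  assert (S : forall n, summable (fun i => csum (u i) n)).
  { induction n0 as [|m IH]; simpl.
    - apply (summable_ext (fun i => 0 * u i O)); [intros; ring|]. now apply summable_scal.
    - now apply summable_plus. }
  induction n as [|n IH]; simpl.
  - now apply Cseries_0.
  - rewrite Cseries_plus by auto. now rewrite IH.
Qed.

(** Fubini for an absolutely summable double series: Tannery's theorem applied
    to the partial sums of the inner series. *)
Lemma fubini (u : nat -> nat -> C) (b : nat -> R) :
  (forall i, summable (u i)) ->
  (forall i, Series (fun j => Cmod (u i j)) <= b i)%R ->
  ex_series b ->
  is_series (fun j => Cseries (fun i => u i j)) (Cseries (fun i => Cseries (u i))).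
Proof.
  intros Hu Hb Eb. apply is_series_tends.
  apply (tends_ext eventually (fun n => Cseries (fun i => csum (u i) n))).
  - intros n. apply Cseries_csum. intros j. apply (summable_le _ b); [|exact Eb].
    intros i. eapply Rle_trans; [exact (summable_term_le (u i) j (Hu i))|apply Hb].
  - apply (tannery eventually _ _ b).
    + intros i. now apply summable_tends.
    + apply filter_forall. intros n i. eapply Rle_trans; [|apply Hb].
      eapply Rle_trans; [apply csum_le; intros; apply Rle_refl|].
      assert (0 <= Series (fun k => Cmod (u i (S n + k)%nat)))%R.
      { eapply Rle_trans; [apply Cmod_ge_0|].
        apply (Cmod_Cseries_le (fun k => u i (S n + k)%nat)); [intros; apply Rle_refl|].
        apply (ex_series_incr_n (fun k => Cmod (u i k)) (S n)), Hu. }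
      rewrite (Series_incr_n _ (S n)) by (try lia; apply Hu). simpl Init.Nat.pred.
      generalize (Cmod_ge_0 (u i n)). lra.
    + intros i. eapply Rle_trans; [|apply Hb].
      apply Cmod_Cseries_le; [intros; apply Rle_refl|apply Hu].
    + exact Eb.
Qed.

(** The family [u i (k - i)], extended by zero to [k < i], turns summation
    along antidiagonals into an instance of Fubini. *)
Lemma antidiagonal_sum (u : nat -> nat -> C) (b : nat -> R) :
  (forall i, summable (u i)) ->
  (forall i, Series (fun j => Cmod (u i j)) <= b i)%R ->
  ex_series b ->
  is_series (fun k => csum (fun i => u i (k - i)%nat) (S k))
            (Cseries (fun i => Cseries (u i))).
Proof.
  intros Hu Hb Eb.
  set (v := fun i k => if (i <=? k)%nat then u i (k - i)%nat else 0).
  assert (Vlt : forall i k, (k < i)%nat -> v i k = 0).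
  { intros i k H. unfold v. now rewrite (proj2 (Nat.leb_gt i k) H). }
  assert (Vge : forall i j, v i (i + j)%nat = u i j).
  { intros i j. unfold v. rewrite (proj2 (Nat.leb_le i (i + j))) by lia.
    f_equal. lia. }
  assert (Sv : forall i, summable (v i)).
  { intros i. apply (summable_shift _ i). apply (summable_ext (u i)); [|apply Hu].
    intros j. symmetry. apply Vge. }
  assert (Ev : forall i, Cseries (v i) = Cseries (u i)).
  { intros i. rewrite (Cseries_split _ i) by apply Sv.
    rewrite csum_zero by (intros; apply Vlt; assumption).
    rewrite Cplus_0_l. apply Cseries_ext, Vge. }
  assert (Av : forall i, Series (fun k => Cmod (v i k)) = Series (fun j => Cmod (u i j))).
  { intros i. destruct i as [|i].
    - apply Series_ext. intros j. f_equal. apply (Vge O).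
    - rewrite (Series_incr_n _ (S i)) by (try lia; apply Sv).
      rewrite (Series_ext (fun k => Cmod (v (S i) (S i + k)%nat)) (fun j => Cmod (u (S i) j)))
        by (intros; now rewrite Vge).
      rewrite <- (sum_n_Reals (fun k => Cmod (v (S i) k))).
      rewrite (sum_n_ext_loc _ (fun _ => 0%R)).
      + rewrite sum_n_const. ring.
      + intros k Hk. rewrite Vlt, Cmod_0; [reflexivity|]. simpl in Hk. lia. }
  rewrite (Cseries_ext (fun i => Cseries (u i)) (fun i => Cseries (v i)))
    by (intros; now rewrite Ev).
  apply (is_series_ext (fun k => Cseries (fun i => v i k))).
  - intros k. rewrite (Cseries_split _ (S k)).
    + rewrite (Cseries_0 (fun n => v (S k + n)%nat k)) by (intros; apply Vlt; lia).
      rewrite (csum_ext (fun i => v i k) (fun i => u i (k - i)%nat)).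
      * apply Cplus_0_r.
      * intros i Hi. unfold v. now rewrite (proj2 (Nat.leb_le i k)) by lia.
    + apply (summable_le _ b); [|exact Eb]. intros i. eapply Rle_trans; [|apply Hb].
      rewrite <- Av. exact (summable_term_le (v i) k (Sv i)).
  - apply (fubini v b Sv); [|exact Eb]. intros i. now rewrite Av.
Qed.

Lemma Cseries_RtoC (b : nat -> R) : ex_series (fun n => Rabs (b n)) ->
  Cseries (fun n => RtoC (b n)) = RtoC (Series b).
Proof.
  intros H. apply Cseries_eq. intros eps He.
  assert (H' : ex_series b) by now apply ex_series_Rabs.
  destruct (proj1 (filterlim_locally (U := R_UniformSpace) _ _) (Series_correct _ H') (mkposreal eps He))
    as [N HN].
  exists (S N). intros n Hn. destruct n as [|n]; [lia|].
  specialize (HN n ltac:(lia)).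
  change (Rabs (sum_n b n - Series b) < eps)%R in HN.
  replace (csum (fun n => RtoC (b n)) (S n)) with (RtoC (sum_n b n)).
  - now rewrite <- RtoC_minus, Cmod_R.
  - rewrite <- csum_sum_n. clear. induction n as [|n IH].
    + now rewrite !sum_O.
    + rewrite !sum_Sn, <- IH. apply RtoC_plus.
Qed.

Lemma summable_ratio (u : nat -> C) (r : R) (N : nat) :
  (0 <= r < 1)%R ->
  (forall n, (N <= n)%nat -> Cmod (u (S n)) <= r * Cmod (u n))%R ->
  summable u.
Proof.
  intros Hr H. apply (summable_shift u N).
  apply (summable_le _ (fun n => Cmod (u N) * r ^ n)%R).
  - induction n as [|n IH].
    + rewrite Nat.add_0_r. simpl. lra.
    + rewrite Nat.add_succ_r. eapply Rle_trans; [apply H; lia|].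
      simpl. replace (Cmod (u N) * (r * r ^ n))%R with (r * (Cmod (u N) * r ^ n))%R by ring.
      apply Rmult_le_compat_l; [lra|exact IH].
  - apply (ex_series_scal (Cmod (u N)) (fun n => (r ^ n)%R)).
    apply ex_series_geom. rewrite Rabs_pos_eq; lra.
Qed.

Lemma geom_small (p c eps : R) : (0 < p < 1)%R -> (0 < eps)%R ->
  exists N, forall n, (N <= n)%nat -> (c * p ^ n < eps)%R.
Proof.
  intros Hp He.
  destruct (pow_lt_1_zero p ltac:(rewrite Rabs_pos_eq; lra) (eps / (Rabs c + 1))%R) as [N HN].
  { apply Rdiv_lt_0_compat; [lra|]. generalize (Rabs_pos c); lra. }
  exists N. intros n Hn. specialize (HN n Hn).
  assert (Hpn : (0 < p ^ n)%R) by (apply pow_lt; lra).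
  rewrite Rabs_pos_eq in HN by lra.
  assert (Hc : (0 < Rabs c + 1)%R) by (generalize (Rabs_pos c); lra).
  apply (Rmult_lt_compat_l _ _ _ Hc) in HN.
  replace ((Rabs c + 1) * (eps / (Rabs c + 1)))%R with eps in HN by (field; lra).
  generalize (Rle_abs c). nra.
Qed.

Lemma RtoC_neq (x y : R) : x <> y -> RtoC x <> RtoC y.
Proof. intros H E. apply H. now apply RtoC_inj. Qed.

Lemma Cmod_RtoC_pos (r : R) : (0 <= r)%R -> Cmod r = r.
Proof. intros H. now rewrite Cmod_R, Rabs_pos_eq. Qed.

Lemma C1_sub_neq0 (z : C) : z <> 1 -> 1 - z <> 0.
Proof. intros H E. apply H. replace z with (1 - (1 - z)) by ring. rewrite E. ring. Qed.

Lemma Cmod_lt_1_neq (z : C) : (Cmod z < 1)%R -> z <> 1.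
Proof. intros H E. rewrite E, Cmod_1 in H. lra. Qed.


Lemma summable_RtoC (b : nat -> R) :
  (forall n, 0 <= b n)%R -> summable (fun n => RtoC (b n)) -> ex_series b.
Proof.
  intros H. apply ex_series_ext. intros n. now apply Cmod_RtoC_pos.
Qed.

Lemma tends_inv {T : Type} (F : (T -> Prop) -> Prop) {FF : Filter F} (u : T -> C) (l : C) :
  l <> 0 -> tends F u l -> tends F (fun t => / u t) (/ l).
Proof.
  intros Hl Hu.
  assert (Hn : F (fun t => u t <> 0)).
  { generalize (Hu (Cmod l) (proj1 (Cmod_gt_0 l) Hl)). apply filter_imp.
    intros t Ht E. rewrite E in Ht.
    replace (0 - l) with (- l) in Ht by ring. rewrite Cmod_opp in Ht. lra. }
  apply (tends_div_one F _ (fun t => u t * / l)).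
  - apply (tends_ext_loc F (fun _ => / l)); [|now apply tends_const].
    revert Hn. apply filter_imp. intros t Ht. field. now split.
  - replace (RtoC 1) with (l * / l) by now field.
    apply tends_mult; [exact FF|exact Hu|now apply tends_const].
Qed.

(** * Integer powers and sums over the integers *)

Definition zpow (x : C) (m : Z) : C := x ^ Z.to_nat m * (/ x) ^ Z.to_nat (- m).

Lemma zpow_nat (x : C) (n : nat) : zpow x (Z.of_nat n) = x ^ n.
Proof.
  unfold zpow. rewrite Nat2Z.id. replace (Z.to_nat (- Z.of_nat n)) with O by lia.
  simpl. ring.
Qed.

Lemma zpow_opp_nat (x : C) (n : nat) : zpow x (- Z.of_nat n) = (/ x) ^ n.
Proof.
  unfold zpow. rewrite Z.opp_involutive, Nat2Z.id.
  replace (Z.to_nat (- Z.of_nat n)) with O by lia. simpl. ring.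
Qed.

Lemma zpow_0 (x : C) : zpow x 0 = 1.
Proof. apply (zpow_nat x 0). Qed.

Lemma zpow_1 (x : C) : zpow x 1 = x.
Proof. change 1%Z with (Z.of_nat 1). rewrite zpow_nat. simpl. ring. Qed.

Lemma Cpow_inv_cancel (x : C) (n : nat) : x <> 0 -> x ^ n * (/ x) ^ n = 1.
Proof. intros H. rewrite <- Cpow_mult_l, Cinv_r by exact H. apply Cpow_1_l. Qed.

Lemma zpow_sub_nat (x : C) (a b : nat) : x <> 0 ->
  zpow x (Z.of_nat a - Z.of_nat b) = x ^ a * (/ x) ^ b.
Proof.
  intros Hx. destruct (Nat.le_ge_cases b a) as [H|H].
  - replace (Z.of_nat a - Z.of_nat b)%Z with (Z.of_nat (a - b)) by lia.
    rewrite zpow_nat. replace a with (b + (a - b))%nat at 2 by lia.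
    rewrite Cpow_add_r.
    transitivity (x ^ (a - b) * (x ^ b * (/ x) ^ b)); [|ring].
    rewrite Cpow_inv_cancel by exact Hx. ring.
  - replace (Z.of_nat a - Z.of_nat b)%Z with (- Z.of_nat (b - a))%Z by lia.
    rewrite zpow_opp_nat. replace b with (a + (b - a))%nat at 2 by lia.
    rewrite Cpow_add_r.
    transitivity ((/ x) ^ (b - a) * (x ^ a * (/ x) ^ a)); [|ring].
    rewrite Cpow_inv_cancel by exact Hx. ring.
Qed.

Lemma zpow_add (x : C) (m k : Z) : x <> 0 -> zpow x (m + k) = zpow x m * zpow x k.
Proof.
  intros Hx.
  replace (m + k)%Z with (Z.of_nat (Z.to_nat m + Z.to_nat k)
                          - Z.of_nat (Z.to_nat (- m) + Z.to_nat (- k)))%Z by lia.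
  rewrite zpow_sub_nat, !Cpow_add_r by exact Hx. unfold zpow. ring.
Qed.

Lemma Cinv_neq0 (x : C) : x <> 0 -> / x <> 0.
Proof.
  intros Hx E. apply C1_nz. rewrite <- (Cinv_r x Hx), E. ring.
Qed.

Lemma zpow_neq0 (x : C) (m : Z) : x <> 0 -> zpow x m <> 0.
Proof.
  intros Hx. unfold zpow. apply Cmult_neq_0; apply Cpow_nz; [exact Hx|].
  now apply Cinv_neq0.
Qed.

Lemma Cinv_mult (x y : C) : x <> 0 -> y <> 0 -> / (x * y) = / x * / y.
Proof. intros. field. now split. Qed.

Lemma zpow_mult_base (x y : C) (m : Z) : x <> 0 -> y <> 0 ->
  zpow (x * y) m = zpow x m * zpow y m.
Proof.
  intros Hx Hy. unfold zpow. rewrite Cinv_mult, !Cpow_mult_l by assumption. ring.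
Qed.

Lemma zpow_opp (x : C) (m : Z) : x <> 0 -> zpow x (- m) = / zpow x m.
Proof.
  intros Hx. assert (H := zpow_add x m (- m) Hx).
  rewrite Z.add_opp_diag_r, zpow_0 in H.
  replace (zpow x (- m)) with ((zpow x m * zpow x (- m)) / zpow x m).
  - rewrite <- H. field. now apply zpow_neq0.
  - field. now apply zpow_neq0.
Qed.

Lemma zpow_sub (x : C) (m k : Z) : x <> 0 -> zpow x (m - k) = zpow x m / zpow x k.
Proof. intros Hx. unfold Z.sub. now rewrite zpow_add, zpow_opp. Qed.

(** The split at [0] is that of the q-integral into its parts over [0, 1] and
    [1, oo]. *)
Definition zsum (u : Z -> C) : C :=
  Cseries (fun n => u (Z.of_nat n)) + Cseries (fun n => u (- Z.of_nat (S n))%Z).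

Definition zsummable (u : Z -> C) : Prop :=
  summable (fun n => u (Z.of_nat n)) /\ summable (fun n => u (- Z.of_nat (S n))%Z).

Lemma zsum_ext (u v : Z -> C) : (forall m, u m = v m) -> zsum u = zsum v.
Proof. intros H. unfold zsum. f_equal; apply Cseries_ext; intros; apply H. Qed.

Lemma zsummable_ext (u v : Z -> C) : (forall m, u m = v m) -> zsummable u -> zsummable v.
Proof.
  intros H [A B]. split.
  - apply (summable_ext (fun n => u (Z.of_nat n))); [intros; apply H|exact A].
  - apply (summable_ext (fun n => u (- Z.of_nat (S n))%Z)); [intros; apply H|exact B].
Qed.

Lemma zsummable_scal (c : C) (u : Z -> C) : zsummable u -> zsummable (fun m => c * u m).
Proof.
  intros [A B]. split; [exact (summable_scal c _ A)|exact (summable_scal c _ B)].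
Qed.

Lemma zsum_scal (c : C) (u : Z -> C) :
  zsummable u -> zsum (fun m => c * u m) = c * zsum u.
Proof.
  intros [A B]. unfold zsum.
  rewrite (Cseries_scal c (fun n => u (Z.of_nat n)) A).
  rewrite (Cseries_scal c (fun n => u (- Z.of_nat (S n))%Z) B). ring.
Qed.

Lemma zsum_plus (u v : Z -> C) :
  zsummable u -> zsummable v -> zsum (fun m => u m + v m) = zsum u + zsum v.
Proof.
  intros [A B] [A' B']. unfold zsum.
  rewrite (Cseries_plus _ _ A A'), (Cseries_plus _ _ B B'). ring.
Qed.

Lemma zsum_minus (u v : Z -> C) :
  zsummable u -> zsummable v -> zsum (fun m => u m - v m) = zsum u - zsum v.
Proof.
  intros [A B] [A' B']. unfold zsum.
  rewrite (Cseries_minus _ _ A A'), (Cseries_minus _ _ B B'). ring.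
Qed.

Lemma zsummable_succ (u : Z -> C) : zsummable u <-> zsummable (fun m => u (m + 1)%Z).
Proof.
  unfold zsummable.
  rewrite (summable_shift (fun n => u (Z.of_nat n)) 1).
  rewrite (summable_shift (fun n => u (- Z.of_nat (S n) + 1)%Z) 1).
  split; intros [A B]; split.
  - revert A. apply summable_ext. intros n. f_equal. lia.
  - revert B. apply summable_ext. intros n. f_equal. lia.
  - revert A. apply summable_ext. intros n. f_equal. lia.
  - revert B. apply summable_ext. intros n. f_equal. lia.
Qed.

Lemma zsum_succ (u : Z -> C) : zsummable u -> zsum (fun m => u (m + 1)%Z) = zsum u.
Proof.
  intros Hu. destruct (proj1 (zsummable_succ u) Hu) as [_ B']. destruct Hu as [A B].
  unfold zsum. rewrite (Cseries_first _ A), (Cseries_first _ B').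
  rewrite (Cseries_ext (fun n => u (Z.of_nat n + 1)%Z) (fun n => u (Z.of_nat (S n))))
    by (intros; f_equal; lia).
  rewrite (Cseries_ext (fun n => u (- Z.of_nat (S (S n)) + 1)%Z) (fun n => u (- Z.of_nat (S n))%Z))
    by (intros; f_equal; lia).
  replace (- Z.of_nat 1 + 1)%Z with (Z.of_nat 0) by lia. ring.
Qed.

Lemma zsum_shift (k : Z) (u : Z -> C) :
  zsummable u ->
  zsummable (fun m => u (m + k)%Z) /\ zsum (fun m => u (m + k)%Z) = zsum u.
Proof.
  revert u. induction k as [|k IH|k IH] using Z.peano_ind; intros u Hu.
  - split; [revert Hu; apply zsummable_ext|apply zsum_ext];
      intros; f_equal; lia.
  - destruct (IH _ (proj1 (zsummable_succ u) Hu)) as [A B]. split.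
    + revert A. apply zsummable_ext. intros; f_equal; lia.
    + rewrite <- (zsum_succ u Hu), <- B. apply zsum_ext. intros; f_equal; lia.
  - set (v := fun m => u (m - 1)%Z).
    assert (E : forall m, u m = v (m + 1)%Z) by (intros; unfold v; f_equal; lia).
    assert (Hv : zsummable v)
      by (apply zsummable_succ; revert Hu; now apply zsummable_ext).
    destruct (IH v Hv) as [A B]. split.
    + revert A. apply zsummable_ext. intros; unfold v; f_equal; lia.
    + rewrite (zsum_ext u _ E), (zsum_succ v Hv), <- B.
      apply zsum_ext. intros; unfold v; f_equal; lia.
Qed.

Definition zabs (u : Z -> C) : R :=
  (Series (fun n => Cmod (u (Z.of_nat n))) + Series (fun n => Cmod (u (- Z.of_nat (S n))%Z)))%R.

Lemma zabs_ext (u v : Z -> C) : (forall m, u m = v m) -> zabs u = zabs v.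
Proof. intros H. unfold zabs. f_equal; apply Series_ext; intros; now rewrite H. Qed.

Lemma zabs_scal (c : C) (u : Z -> C) : zabs (fun m => c * u m) = (Cmod c * zabs u)%R.
Proof.
  unfold zabs. rewrite Rmult_plus_distr_l, <- !Series_scal_l.
  f_equal; apply Series_ext; intros; apply Cmod_mult.
Qed.

(** The two half-sums of [zabs] are not shift-invariant separately; their total
    is, since it is itself a sum over the integers. *)
Lemma zabs_shift (k : Z) (u : Z -> C) :
  zsummable u -> zabs (fun m => u (m + k)%Z) = zabs u.
Proof.
  assert (A : forall u : Z -> C, zsummable u -> zsummable (fun m => RtoC (Cmod (u m)))).
  { intros w [A B]. split.
    - apply (summable_le _ (fun n => Cmod (w (Z.of_nat n)))); [|exact A].
      intros n. rewrite Cmod_R, Rabs_pos_eq; [apply Rle_refl|apply Cmod_ge_0].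
    - apply (summable_le _ (fun n => Cmod (w (- Z.of_nat (S n))%Z))); [|exact B].
      intros n. rewrite Cmod_R, Rabs_pos_eq; [apply Rle_refl|apply Cmod_ge_0]. }
  assert (E : forall u : Z -> C, zsummable u -> zsum (fun m => RtoC (Cmod (u m))) = zabs u).
  { intros w [B D]. unfold zsum, zabs. rewrite RtoC_plus.
    rewrite (Cseries_RtoC (fun n => Cmod (w (Z.of_nat n)))).
    - rewrite (Cseries_RtoC (fun n => Cmod (w (- Z.of_nat (S n))%Z))); [reflexivity|].
      revert D. apply ex_series_ext. intros n. symmetry. apply Rabs_pos_eq, Cmod_ge_0.
    - revert B. apply ex_series_ext. intros n. symmetry. apply Rabs_pos_eq, Cmod_ge_0. }
  intros Hu. apply RtoC_inj. rewrite <- E by now apply zsum_shift.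
  rewrite <- E by exact Hu. apply (zsum_shift k (fun m => RtoC (Cmod (u m)))), A, Hu.
Qed.

Lemma Series_Cmod_ge0 (u : nat -> C) : summable u -> (0 <= Series (fun n => Cmod (u n)))%R.
Proof.
  intros H. eapply Rle_trans; [apply Cmod_ge_0|].
  apply (Cmod_Cseries_le u); [intros; apply Rle_refl|exact H].
Qed.

Lemma Cmod_zsum_le (u : Z -> C) : zsummable u -> (Cmod (zsum u) <= zabs u)%R.
Proof.
  intros [A B]. unfold zsum, zabs. eapply Rle_trans; [apply Cmod_triangle|].
  apply Rplus_le_compat; apply Cmod_Cseries_le; try (intros; apply Rle_refl); assumption.
Qed.

Lemma zabs_term_le (u : Z -> C) (m : Z) : zsummable u -> (Cmod (u m) <= zabs u)%R.
Proof.
  intros [A B]. unfold zabs.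
  generalize (Series_Cmod_ge0 _ A) (Series_Cmod_ge0 _ B).
  destruct (Z.lt_ge_cases m 0) as [H|H].
  - generalize (summable_term_le _ (Z.to_nat (- m - 1)) B).
    replace (- Z.of_nat (S (Z.to_nat (- m - 1))))%Z with m by lia. lra.
  - generalize (summable_term_le _ (Z.to_nat m) A).
    replace (Z.of_nat (Z.to_nat m)) with m by lia. lra.
Qed.

Lemma zfubini (u : nat -> Z -> C) (b : nat -> R) :
  (forall i, zsummable (u i)) -> (forall i, zabs (u i) <= b i)%R -> ex_series b ->
  zsum (fun a => Cseries (fun i => u i a)) = Cseries (fun i => zsum (u i)).
Proof.
  intros Hu Hb Eb.
  assert (B1 : forall i, (Series (fun n => Cmod (u i (Z.of_nat n))) <= b i)%R).
  { intros i. generalize (Hb i) (Series_Cmod_ge0 _ (proj2 (Hu i))). unfold zabs. lra. }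
  assert (B2 : forall i, (Series (fun n => Cmod (u i (- Z.of_nat (S n))%Z)) <= b i)%R).
  { intros i. generalize (Hb i) (Series_Cmod_ge0 _ (proj1 (Hu i))). unfold zabs. lra. }
  unfold zsum.
  assert (A1 : forall i, (Cmod (Cseries (fun n => u i (Z.of_nat n))) <= b i)%R).
  { intros i. eapply Rle_trans; [|apply B1].
    apply Cmod_Cseries_le; [intros; apply Rle_refl|apply Hu]. }
  assert (A2 : forall i, (Cmod (Cseries (fun n => u i (- Z.of_nat (S n))%Z)) <= b i)%R).
  { intros i. eapply Rle_trans; [|apply B2].
    apply Cmod_Cseries_le; [intros; apply Rle_refl|apply Hu]. }
  rewrite Cseries_plus by (apply (summable_le _ b); assumption).
  f_equal; apply is_series_Cseries, (fubini _ b); try assumption; intros i; apply Hu.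
Qed.

Lemma zsummable_down (u : Z -> C) (b : Z) :
  zsummable u -> summable (fun i => u (b - Z.of_nat i)%Z).
Proof.
  intros H. destruct (zsum_shift b u H) as [[_ A] _].
  apply (summable_shift _ 1). revert A. apply summable_ext.
  intros n. f_equal. lia.
Qed.


Section Base.
Context (p : R) (hp : (0 < p < 1)%R).
Local Notation P := (RtoC p).

(** * The infinite product [(a; p)_oo] and the q-binomial theorem *)

Fixpoint poch (a : C) (n : nat) : C :=
  match n with O => 1 | S m => poch a m * (1 - a * P ^ m) end.

Definition poch_inf (a : C) : C := Clim_seq (poch a).

(** This is [p ^ (n (n - 1) / 2)], without a division of exponents. *)
Fixpoint gauss (n : nat) : C :=
  match n with O => 1 | S m => gauss m * P ^ m end.

Lemma Cmod_Ppow (n : nat) : Cmod (P ^ n) = (p ^ n)%R.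
Proof. rewrite Cmod_pow, Cmod_RtoC_pos; [reflexivity|lra]. Qed.

Lemma P_neq0 : P <> 0.
Proof. apply RtoC_neq. lra. Qed.

Lemma ppow_le_1 (n : nat) : (0 < p ^ n <= 1)%R.
Proof.
  split; [apply pow_lt; lra|]. rewrite <- (pow1 n). apply pow_incr. lra.
Qed.

Lemma one_sub_Ppow (n : nat) : 1 - P ^ S n <> 0.
Proof.
  apply C1_sub_neq0, Cmod_lt_1_neq. rewrite Cmod_Ppow. simpl.
  generalize (ppow_le_1 n). nra.
Qed.

Lemma Cmod_one_sub_Ppow (n : nat) : (1 - p <= Cmod (1 - P ^ S n) <= 1)%R.
Proof.
  rewrite <- RtoC_pow, <- RtoC_minus, Cmod_RtoC_pos; simpl;
    generalize (ppow_le_1 n); nra.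
Qed.

Lemma poch_S (n : nat) : poch P (S n) = poch P n * (1 - P ^ S n).
Proof. reflexivity. Qed.

Lemma poch_P_neq0 (n : nat) : poch P n <> 0.
Proof.
  induction n as [|n IH]; [apply C1_nz|].
  rewrite poch_S. apply Cmult_neq_0; [exact IH|apply one_sub_Ppow].
Qed.

Lemma tends_Ppow : tends eventually (fun n => P ^ n) 0.
Proof.
  intros eps He. destruct (geom_small p 1 eps hp He) as [N HN].
  exists N. intros n Hn. replace (P ^ n - 0) with (P ^ n) by ring.
  rewrite Cmod_Ppow. specialize (HN n Hn). lra.
Qed.

(** Continuity at [0] along [p ^ n y], which closes every argument that iterates
    a functional equation relating [G z] to [G (p z)]. *)
Lemma power_series_at_0 (c : nat -> C) (y : C) :
  summable (fun i => c i * y ^ i) ->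
  tends eventually (fun n => Cseries (fun i => c i * (P ^ n * y) ^ i)) (c O).
Proof.
  intros H.
  set (l := fun i : nat => match i with O => c O | S _ => 0 end).
  replace (c O) with (Cseries l).
  2: { rewrite Cseries_first.
       - rewrite (Cseries_0 (fun n => l (S n))) by reflexivity. simpl. ring.
       - apply (summable_shift l 1). apply (summable_ext (fun n => 0 * (c n * y ^ n))).
         + intros n. simpl. ring.
         + now apply summable_scal. }
  apply (tannery eventually _ _ (fun i => Cmod (c i * y ^ i))).
  - intros [|i].
    + apply (tends_ext eventually (fun _ => c O)); [intros; simpl; ring|].
      apply tends_const, eventually_filter.
    + apply (tends_ext eventually (fun n => P ^ n * (c (S i) * y ^ S i * (P ^ n) ^ i))).
      { intros n. rewrite Cpow_mult_l, (Cpow_S (P ^ n)). ring. }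
      simpl l. replace (RtoC 0) with (0 * (c (S i) * y ^ S i * 0 ^ i)) by ring.
      apply tends_mult; [apply eventually_filter|apply tends_Ppow|].
      apply tends_mult; [apply eventually_filter|apply tends_const, eventually_filter|].
      apply tends_pow; [apply eventually_filter|apply tends_Ppow].
  - apply filter_forall. intros n i.
    rewrite Cpow_mult_l, !Cmod_mult, (Cmod_pow (P ^ n)), Cmod_Ppow.
    assert (0 <= (p ^ n) ^ i <= 1)%R.
    { generalize (ppow_le_1 n). intros [A B]. split; [apply pow_le; lra|].
      rewrite <- (pow1 i). apply pow_incr. lra. }
    assert (0 <= Cmod (c i) * Cmod (y ^ i))%R
      by (apply Rmult_le_pos; apply Cmod_ge_0).
    nra.
  - intros [|i]; simpl.
    + apply Req_le. f_equal. ring.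
    + rewrite Cmod_0. apply Cmod_ge_0.
  - exact H.
Qed.

Definition euler_coef (j : nat) : C := (- (1)) ^ j * gauss j / poch P j.

Lemma euler_coef_S (j : nat) :
  (1 - P ^ S j) * euler_coef (S j) = - P ^ j * euler_coef j.
Proof.
  unfold euler_coef. rewrite poch_S, (Cpow_S (- (1))). simpl gauss.
  field. split; [apply poch_P_neq0|apply one_sub_Ppow].
Qed.

Lemma euler_summable (z : C) : summable (fun j => euler_coef j * z ^ j).
Proof.
  destruct (geom_small p (Cmod z / (1 - p)) (/ 2) hp) as [N HN]; [lra|].
  apply (summable_ratio _ (/ 2) N); [lra|]. intros n Hn. specialize (HN n Hn).
  replace (euler_coef (S n)) with (- P ^ n * euler_coef n / (1 - P ^ S n)).
  2: { rewrite <- euler_coef_S. field. apply one_sub_Ppow. }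
  rewrite (Cpow_S z).
  replace (- P ^ n * euler_coef n / (1 - P ^ S n) * (z * z ^ n))
    with (- (P ^ n * z / (1 - P ^ S n)) * (euler_coef n * z ^ n))
    by (field; apply one_sub_Ppow).
  rewrite Cmod_mult, Cmod_opp. apply Rmult_le_compat_r; [apply Cmod_ge_0|].
  rewrite Cmod_div by apply one_sub_Ppow. rewrite Cmod_mult, Cmod_Ppow.
  eapply Rle_trans; [|apply Rlt_le, HN].
  replace (Cmod z / (1 - p) * p ^ n)%R with ((p ^ n * Cmod z) / (1 - p))%R by (field; lra).
  apply Rmult_le_compat_l.
  - apply Rmult_le_pos; [apply Rlt_le, ppow_le_1|apply Cmod_ge_0].
  - apply Rinv_le_contravar; [lra|apply Cmod_one_sub_Ppow].
Qed.

(** The functional equation of the infinite product, from the recursion of the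
    coefficients. *)
Lemma euler_step (z : C) :
  Cseries (fun j => euler_coef j * z ^ j)
  = (1 - z) * Cseries (fun j => euler_coef j * (P * z) ^ j).
Proof.
  set (G := Cseries (fun j => euler_coef j * (P * z) ^ j)).
  assert (E : Cseries (fun j => euler_coef j * z ^ j) - G = - z * G).
  { unfold G. rewrite <- Cseries_minus by apply euler_summable.
    rewrite Cseries_first
      by (apply summable_minus; apply euler_summable).
    rewrite <- Cseries_scal by apply euler_summable.
    replace (euler_coef 0 * z ^ 0 - euler_coef 0 * (P * z) ^ 0) with (RtoC 0)
      by (simpl; ring).
    rewrite Cplus_0_l. apply Cseries_ext. intros j.
    rewrite (Cpow_mult_l P z (S j)).
    transitivity (((1 - P ^ S j) * euler_coef (S j)) * z ^ S j); [ring|].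
    rewrite euler_coef_S, Cpow_mult_l, (Cpow_S z). ring. }
  replace (Cseries (fun j => euler_coef j * z ^ j)) with ((Cseries (fun j => euler_coef j * z ^ j) - G) + G) by ring.
  rewrite E. ring.
Qed.

Lemma poch_mul_step (a : C) (G : C -> C) :
  (forall z, G z = (1 - z) * G (P * z)) ->
  forall n, G a = poch a n * G (P ^ n * a).
Proof.
  intros H n. induction n as [|n IH].
  - simpl. rewrite !Cmult_1_l. reflexivity.
  - rewrite IH, H. simpl poch. rewrite Cpow_S.
    replace (P * P ^ n * a) with (P * (P ^ n * a)) by ring. ring.
Qed.

(** The series [G] satisfies [G z = (1 - z) G (p z)], hence
    [G a = poch a n * G (p ^ n a)], and [G] is continuous at [0] with
    [G 0 = 1]. *)
Lemma poch_tends_euler (a : C) :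
  tends eventually (poch a) (Cseries (fun j => euler_coef j * a ^ j)).
Proof.
  set (G := fun z => Cseries (fun j => euler_coef j * z ^ j)).
  apply (tends_div_one eventually _ (fun n => G (P ^ n * a))).
  - apply (tends_ext eventually (fun _ => G a)).
    + intros n. apply poch_mul_step, euler_step.
    + apply tends_const, eventually_filter.
  - replace (RtoC 1) with (euler_coef 0).
    + apply power_series_at_0, euler_summable.
    + unfold euler_coef. simpl. field.
Qed.

Lemma poch_inf_euler (a : C) :
  poch_inf a = Cseries (fun j => euler_coef j * a ^ j).
Proof. apply Clim_seq_tends, poch_tends_euler. Qed.

Lemma poch_tends (a : C) : tends eventually (poch a) (poch_inf a).
Proof. rewrite poch_inf_euler. apply poch_tends_euler. Qed.

Lemma poch_inf_split (a : C) (n : nat) :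
  poch_inf a = poch a n * poch_inf (a * P ^ n).
Proof.
  rewrite (Cmult_comm a), !poch_inf_euler.
  apply (poch_mul_step a (fun z => Cseries (fun j => euler_coef j * z ^ j))), euler_step.
Qed.

Lemma poch_inf_0 : poch_inf 0 = 1.
Proof.
  apply Clim_seq_tends, (tends_ext eventually (fun _ => 1)).
  - induction t as [|n IH]; [reflexivity|]. simpl. rewrite <- IH. ring.
  - apply tends_const, eventually_filter.
Qed.

Lemma Cmod_poch_P_le (n m : nat) : (Cmod (poch (P ^ S n) m) <= 1)%R.
Proof.
  induction m as [|m IH].
  - simpl. rewrite Cmod_1. lra.
  - change (poch (P ^ S n) (S m)) with (poch (P ^ S n) m * (1 - P ^ S n * P ^ m)).
    rewrite Cmod_mult, <- Cpow_add_r.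
    change (S n + m)%nat with (S (n + m)).
    destruct (Cmod_one_sub_Ppow (n + m)) as [_ B].
    apply (Rle_trans _ (1 * 1)%R); [|lra].
    apply Rmult_le_compat; try apply Cmod_ge_0; assumption.
Qed.

Definition qbinom_coef (x : C) (i : nat) : C := poch x i / poch P i.

Lemma qbinom_coef_S (x : C) (i : nat) :
  (1 - P ^ S i) * qbinom_coef x (S i) = (1 - x * P ^ i) * qbinom_coef x i.
Proof.
  unfold qbinom_coef. rewrite poch_S. simpl (poch x (S i)).
  field. split; [apply poch_P_neq0|apply one_sub_Ppow].
Qed.

Lemma qbinom_summable (x y : C) :
  (Cmod y < 1)%R -> summable (fun i => qbinom_coef x i * y ^ i).
Proof.
  intros Hy.
  (* any [r] strictly between [|y|] and [1] bounds the ratio from some point on *)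
  set (r := ((1 + Cmod y) / 2)%R).
  assert (Hr : (Cmod y < r < 1)%R) by (unfold r; lra).
  generalize (Cmod_ge_0 y). intros Hy0.
  destruct (geom_small p (Cmod y * Cmod x + r) (r - Cmod y) hp) as [N HN]; [lra|].
  apply (summable_ratio _ r N); [lra|]. intros n Hn. specialize (HN n Hn).
  replace (qbinom_coef x (S n)) with ((1 - x * P ^ n) * qbinom_coef x n / (1 - P ^ S n)).
  2: { rewrite <- qbinom_coef_S. field. apply one_sub_Ppow. }
  rewrite (Cpow_S y).
  replace ((1 - x * P ^ n) * qbinom_coef x n / (1 - P ^ S n) * (y * y ^ n))
    with ((y * (1 - x * P ^ n) / (1 - P ^ S n)) * (qbinom_coef x n * y ^ n))
    by (field; apply one_sub_Ppow).
  rewrite Cmod_mult. apply Rmult_le_compat_r; [apply Cmod_ge_0|].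
  rewrite Cmod_div by apply one_sub_Ppow. rewrite Cmod_mult.
  assert (A : (Cmod (1 - x * P ^ n) <= 1 + Cmod x * p ^ n)%R).
  { unfold Cminus. eapply Rle_trans; [apply Cmod_triangle|].
    rewrite Cmod_1, Cmod_opp, Cmod_mult, Cmod_Ppow. lra. }
  assert (B : (1 - p ^ n <= Cmod (1 - P ^ S n))%R).
  { rewrite <- RtoC_pow, <- RtoC_minus, Cmod_RtoC_pos; simpl;
    generalize (ppow_le_1 n); nra. }
  assert (D : (0 < Cmod (1 - P ^ S n))%R) by (apply Cmod_gt_0, one_sub_Ppow).
  apply (Rmult_le_reg_r (Cmod (1 - P ^ S n))); [exact D|].
  unfold Rdiv. rewrite Rmult_assoc, Rinv_l, Rmult_1_r by lra.
  generalize (Cmod_ge_0 x). nra.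
Qed.

(** The q-binomial theorem; the series [F y] satisfies
    [(1 - y) F y = (1 - x y) F (p y)]. *)
Lemma qbinomial (x y : C) :
  (Cmod y < 1)%R ->
  poch_inf y * Cseries (fun i => qbinom_coef x i * y ^ i) = poch_inf (x * y).
Proof.
  intros Hy.
  set (F := fun z => Cseries (fun i => qbinom_coef x i * z ^ i)).
  assert (Hs : forall n, (Cmod (P ^ n * y) < 1)%R).
  { intros n. rewrite Cmod_mult, Cmod_Ppow.
    generalize (ppow_le_1 n) (Cmod_ge_0 y). nra. }
  assert (E : forall z, (Cmod z < 1)%R -> (1 - z) * F z = (1 - x * z) * F (P * z)).
  { intros z Hz. unfold F.
    assert (S1 := qbinom_summable x z Hz).
    assert (S2 : summable (fun i => qbinom_coef x i * (P * z) ^ i)).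
    { apply qbinom_summable. rewrite Cmod_mult, Cmod_RtoC_pos by lra.
      generalize (Cmod_ge_0 z). nra. }
    assert (E : Cseries (fun i => qbinom_coef x i * z ^ i)
                - Cseries (fun i => qbinom_coef x i * (P * z) ^ i)
              = z * (Cseries (fun i => qbinom_coef x i * z ^ i)
                - x * Cseries (fun i => qbinom_coef x i * (P * z) ^ i))).
    { rewrite <- (Cseries_scal x) by exact S2.
      rewrite <- !Cseries_minus by (try apply summable_scal; assumption).
      rewrite <- Cseries_scal
        by (apply summable_minus; [|apply summable_scal]; assumption).
      rewrite Cseries_first by (apply summable_minus; assumption).
      replace (qbinom_coef x 0 * z ^ 0 - qbinom_coef x 0 * (P * z) ^ 0) with (RtoC 0)
        by (simpl; ring).
      rewrite Cplus_0_l. apply Cseries_ext. intros i.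
      transitivity (((1 - P ^ S i) * qbinom_coef x (S i)) * z ^ S i).
      - rewrite Cpow_mult_l. ring.
      - rewrite qbinom_coef_S, Cpow_mult_l, (Cpow_S z). ring. }
    set (A := Cseries (fun i => qbinom_coef x i * z ^ i)) in *.
    set (B := Cseries (fun i => qbinom_coef x i * (P * z) ^ i)) in *.
    replace ((1 - z) * A) with ((A - B) + B - z * A) by ring. rewrite E. ring. }
  assert (I : forall n, poch y n * F y = poch (x * y) n * F (P ^ n * y)).
  { induction n as [|n IH].
    - simpl. now rewrite !Cmult_1_l.
    - simpl poch. replace (poch y n * (1 - y * P ^ n) * F y)
        with ((1 - y * P ^ n) * (poch y n * F y)) by ring.
      rewrite IH.
      replace ((1 - y * P ^ n) * (poch (x * y) n * F (P ^ n * y)))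
        with (poch (x * y) n * ((1 - P ^ n * y) * F (P ^ n * y))) by ring.
      rewrite E by apply Hs. rewrite Cpow_S.
      replace (P * P ^ n * y) with (P * (P ^ n * y)) by ring. ring. }
  refine (tends_unique eventually (fun n => poch y n * F y) _ _ _ _).
  - apply tends_mult; [apply eventually_filter|apply poch_tends|].
    apply tends_const, eventually_filter.
  - apply (tends_ext eventually (fun n => poch (x * y) n * F (P ^ n * y))).
    + intros n. now rewrite I.
    + replace (poch_inf (x * y)) with (poch_inf (x * y) * qbinom_coef x 0).
      * apply tends_mult; [apply eventually_filter|apply poch_tends|].
        now apply power_series_at_0, qbinom_summable.
      * unfold qbinom_coef. simpl. field.
Qed.

(** The q-binomial theorem with [x = 0] exhibits the inverse of the product as a
    convergent series. *)
Lemma poch_inf_neq0 (y : C) : (Cmod y < 1)%R -> poch_inf y <> 0.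
Proof.
  intros Hy E. apply C1_nz. rewrite <- poch_inf_0.
  replace (RtoC 0) with (0 * y) at 1 by ring.
  rewrite <- (qbinomial 0 y Hy), E. ring.
Qed.

Lemma poch_inf_P_neq0 : poch_inf P <> 0.
Proof. apply poch_inf_neq0. rewrite Cmod_RtoC_pos; lra. Qed.

(** The remaining factors [1 - p ^ k] of the infinite product are at most [1];
    this bounds all the denominators [(p; p)_n] from below. *)
Lemma Cmod_poch_P_ge (n : nat) : (Cmod (poch_inf P) <= Cmod (poch P n))%R.
Proof.
  rewrite (poch_inf_split P n), Cmod_mult.
  assert (Cmod (poch_inf (P * P ^ n)) <= 1)%R.
  { refine (tends_le eventually (poch (P * P ^ n)) _ _ (poch_tends _) _).
    intros m. apply (Cmod_poch_P_le n m). }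
  generalize (Cmod_ge_0 (poch P n)). nra.
Qed.

(** Beyond finitely many factors the product is that of an argument of modulus
    less than [1], which does not vanish. *)
Lemma poch_inf_eq0 (a : C) : poch_inf a = 0 -> exists k, a * P ^ k = 1.
Proof.
  intros H.
  destruct (geom_small p (Cmod a) 1 hp Rlt_0_1) as [N HN].
  rewrite (poch_inf_split a N) in H.
  assert (H0 : poch a N = 0).
  { destruct (Ceq_dec (poch a N) 0) as [E|E]; [exact E|].
    exfalso. apply (Cmult_neq_0 _ _ E) in H; [exact H|]. apply poch_inf_neq0.
    rewrite Cmod_mult, Cmod_Ppow. apply HN. lia. }
  clear H HN. induction N as [|N IH].
  - simpl in H0. now apply C1_nz in H0.
  - simpl in H0. destruct (Ceq_dec (a * P ^ N) 1) as [E|E].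
    + now exists N.
    + apply IH. destruct (Ceq_dec (poch a N) 0) as [E'|E']; [exact E'|].
      exfalso. revert H0. apply Cmult_neq_0; [exact E'|now apply C1_sub_neq0].
Qed.

(** Continuity of the product is read off Euler's series. *)
Lemma tends_poch_inf {T : Type} (F : (T -> Prop) -> Prop) {FF : Filter F}
  (u : T -> C) (l : C) :
  tends F u l -> tends F (fun t => poch_inf (u t)) (poch_inf l).
Proof.
  intros Hu. set (r := (Cmod l + 1)%R).
  assert (Hr : (0 <= r)%R) by (unfold r; generalize (Cmod_ge_0 l); lra).
  assert (B : forall (z : C) i, (Cmod z <= r)%R ->
            (Cmod (euler_coef i * z ^ i) <= Cmod (euler_coef i * r ^ i))%R).
  { intros z i Hz. rewrite !Cmod_mult, !Cmod_pow, (Cmod_RtoC_pos r Hr).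
    apply Rmult_le_compat_l; [apply Cmod_ge_0|]. apply pow_incr.
    split; [apply Cmod_ge_0|exact Hz]. }
  rewrite poch_inf_euler.
  apply (tends_ext F (fun t => Cseries (fun j => euler_coef j * u t ^ j))).
  { intros t. now rewrite poch_inf_euler. }
  apply (tannery F (fun t j => euler_coef j * u t ^ j)
                   (fun j => euler_coef j * l ^ j)
                   (fun i => Cmod (euler_coef i * r ^ i))).
  - intros i. apply tends_mult; [exact FF|now apply tends_const|].
    now apply tends_pow.
  - generalize (tends_bounded F u l Hu). apply filter_imp. intros t Ht i. now apply B.
  - intros i. apply B. unfold r. lra.
  - apply euler_summable.
Qed.

(** * Rapidly decreasing functions on the lattice [p ^ m] *)

Lemma Cmod_invP : Cmod (/ P) = (/ p)%R.
Proof. rewrite Cmod_inv, Cmod_RtoC_pos by (try apply P_neq0; lra). reflexivity. Qed.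

Definition decreasing (f : Z -> C) : Prop :=
  forall k : nat, exists c : R, forall m, (Cmod (zpow P m ^ k * f m) <= c)%R.

(** The lattice derivative [(1 - p) d/ds] in the coordinate [s = p ^ m]. *)
Definition dq (f : Z -> C) : Z -> C := fun m => (f m - f (m + 1)%Z) / zpow P m.

Definition dqn (l : nat) (f : Z -> C) : Z -> C := Nat.iter l dq f.

Definition schwartz (f : Z -> C) : Prop := forall l, decreasing (dqn l f).

Lemma dqn_S (l : nat) (f : Z -> C) : dqn (S l) f = dqn l (dq f).
Proof. unfold dqn. now rewrite Nat.iter_succ_r. Qed.

Lemma dqn_add (l k : nat) (f : Z -> C) : dqn (l + k) f = dqn l (dqn k f).
Proof. unfold dqn. now rewrite Nat.iter_add. Qed.

Lemma schwartz_dq (f : Z -> C) : schwartz f -> schwartz (dq f).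
Proof. intros H l. rewrite <- dqn_S. apply H. Qed.

Lemma schwartz_dqn (l : nat) (f : Z -> C) : schwartz f -> schwartz (dqn l f).
Proof. intros H k. rewrite <- dqn_add. apply H. Qed.

Lemma schwartz_decreasing (f : Z -> C) : schwartz f -> decreasing f.
Proof. intros H. exact (H O). Qed.

Lemma dq_ext (f g : Z -> C) : (forall m, f m = g m) -> forall m, dq f m = dq g m.
Proof. intros H m. unfold dq. now rewrite !H. Qed.

Lemma dqn_ext (l : nat) (f g : Z -> C) :
  (forall m, f m = g m) -> forall m, dqn l f m = dqn l g m.
Proof.
  intros H. induction l as [|l IH]; [exact H|]. intros m. simpl. now apply dq_ext.
Qed.

Lemma schwartz_ext (f g : Z -> C) : (forall m, f m = g m) -> schwartz f -> schwartz g.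
Proof.
  intros H Hf l k. destruct (Hf l k) as [c Hc]. exists c. intros m.
  now rewrite <- (dqn_ext l f g H).
Qed.

Lemma dqn_lincomb (a b : C) (f g : Z -> C) (l : nat) (m : Z) :
  dqn l (fun m => a * f m + b * g m) m = a * dqn l f m + b * dqn l g m.
Proof.
  revert m. induction l as [|l IH]; intros m; [reflexivity|].
  simpl. unfold dq at 1. fold (dqn l (fun m => a * f m + b * g m)). rewrite !IH.
  unfold dq. fold (dqn l f) (dqn l g). field. apply zpow_neq0, P_neq0.
Qed.

Lemma dqn_scal (a : C) (f : Z -> C) (l : nat) (m : Z) :
  dqn l (fun m => a * f m) m = a * dqn l f m.
Proof.
  rewrite (dqn_ext l _ (fun m => a * f m + 0 * f m)) by (intros; ring).
  rewrite dqn_lincomb. ring.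
Qed.

Lemma dqn_dilation (f : Z -> C) (k : Z) (l : nat) (m : Z) :
  dqn l (fun m => f (m + k)%Z) m = zpow P k ^ l * dqn l f (m + k)%Z.
Proof.
  assert (HP := P_neq0).
  revert m. induction l as [|l IH]; intros m; [simpl; ring|].
  simpl. unfold dq at 1. fold (dqn l (fun m => f (m + k)%Z)). rewrite !IH.
  unfold dq. fold (dqn l f). rewrite (zpow_add P m k HP).
  replace (m + k + 1)%Z with (m + 1 + k)%Z by lia.
  field. split; apply zpow_neq0; exact HP.
Qed.

Lemma schwartz_lincomb (a b : C) (f g : Z -> C) :
  schwartz f -> schwartz g -> schwartz (fun m => a * f m + b * g m).
Proof.
  intros Hf Hg l k. destruct (Hf l k) as [c Hc]. destruct (Hg l k) as [d Hd].
  exists (Cmod a * c + Cmod b * d)%R. intros m. rewrite dqn_lincomb.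
  replace (zpow P m ^ k * (a * dqn l f m + b * dqn l g m))
    with (a * (zpow P m ^ k * dqn l f m) + b * (zpow P m ^ k * dqn l g m)) by ring.
  eapply Rle_trans; [apply Cmod_triangle|]. rewrite (Cmod_mult a), (Cmod_mult b).
  apply Rplus_le_compat; apply Rmult_le_compat_l; try apply Cmod_ge_0; auto.
Qed.

Lemma schwartz_scal (a : C) (f : Z -> C) : schwartz f -> schwartz (fun m => a * f m).
Proof.
  intros H. apply (schwartz_ext (fun m => a * f m + 0 * f m)); [intros; ring|].
  now apply schwartz_lincomb.
Qed.

Lemma schwartz_dilation (f : Z -> C) (k : Z) :
  schwartz f -> schwartz (fun m => f (m + k)%Z).
Proof.
  intros H l j. destruct (H l j) as [c Hc].
  assert (HP := P_neq0).
  exists (Cmod (zpow P k ^ l / zpow P k ^ j) * c)%R. intros m.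
  rewrite dqn_dilation.
  replace (zpow P m ^ j * (zpow P k ^ l * dqn l f (m + k)%Z))
    with (zpow P k ^ l / zpow P k ^ j * (zpow P (m + k) ^ j * dqn l f (m + k)%Z)).
  - rewrite Cmod_mult. apply Rmult_le_compat_l; [apply Cmod_ge_0|apply Hc].
  - rewrite (zpow_add P m k HP), Cpow_mult_l. field. now apply Cpow_nz, zpow_neq0.
Qed.

(** * The functional [f |-> sum_m x ^ m f m] *)

Definition moment (x : C) (f : Z -> C) : C := zsum (fun m => zpow x m * f m).

(** Near [s = 0] the factor [x ^ m] gives the decay; at infinity it grows, and
    the order [k] of decrease is chosen so that [p ^ k] beats [1 / r1]. The
    majorant depends on [x] only through [r1] and [r2], which Tannery's theorem
    needs for continuity in [x]. *)
Lemma moment_majorant (r1 r2 : R) :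
  (0 < r1)%R -> exists k : nat, forall x f c,
  (r1 <= Cmod x <= r2)%R ->
  (forall m, Cmod (f m) <= c)%R ->
  (forall m, Cmod (zpow P m ^ k * f m) <= c)%R ->
  forall n : nat,
    (Cmod (zpow x (Z.of_nat n) * f (Z.of_nat n)) <= c * r2 ^ n)%R /\
    (Cmod (zpow x (- Z.of_nat (S n)) * f (- Z.of_nat (S n))%Z) <= c * p ^ n)%R.
Proof.
  intros Hr1. destruct (geom_small p 1 (p * r1) hp) as [k Hk].
  { apply Rmult_lt_0_compat; lra. }
  specialize (Hk k (Nat.le_refl k)). rewrite Rmult_1_l in Hk.
  exists k. intros x f c Hx H0 H1 n.
  assert (Hc : (0 <= c)%R) by (eapply Rle_trans; [apply Cmod_ge_0|apply (H0 0%Z)]).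
  assert (Hx0 : x <> 0) by (apply Cmod_gt_0; lra).
  split.
  - rewrite Cmod_mult, zpow_nat, Cmod_pow, Rmult_comm.
    apply Rmult_le_compat; [apply Cmod_ge_0|apply pow_le, Cmod_ge_0|apply H0|].
    apply pow_incr. split; [apply Cmod_ge_0|apply Hx].
  - specialize (H1 (- Z.of_nat (S n))%Z).
    set (y := f (- Z.of_nat (S n))%Z) in *.
    rewrite Cmod_mult, Cmod_pow, zpow_opp_nat, Cmod_pow, Cmod_invP in H1.
    rewrite Cmod_mult, zpow_opp_nat, Cmod_pow, Cmod_inv by exact Hx0.
    (* |y| <= c (p^k)^(n+1) and |x|^-(n+1) <= r1^-(n+1) *)
    assert (Hpk : (0 < p ^ k)%R) by (apply pow_lt; lra).
    assert (Y : (Cmod y <= c * (p ^ k) ^ S n)%R).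
    { assert (E : ((p ^ k) ^ S n * ((/ p) ^ S n) ^ k = 1)%R).
      { rewrite <- !pow_mult, (Nat.mul_comm k (S n)), <- Rpow_mult_distr, Rinv_r by lra.
        apply pow1. }
      replace (Cmod y) with ((p ^ k) ^ S n * (((/ p) ^ S n) ^ k * Cmod y))%R
        by (rewrite <- Rmult_assoc, E; ring).
      rewrite Rmult_comm. apply Rmult_le_compat_r; [apply pow_le; lra|exact H1]. }
    assert (X : ((/ Cmod x) ^ S n <= (/ r1) ^ S n)%R).
    { apply pow_incr. split.
      - apply Rlt_le, Rinv_0_lt_compat. lra.
      - apply Rinv_le_contravar; lra. }
    eapply Rle_trans.
    { apply Rmult_le_compat; [| |exact X|exact Y].
      - apply pow_le, Rlt_le, Rinv_0_lt_compat. lra.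
      - apply Cmod_ge_0. }
    replace ((/ r1) ^ S n * (c * (p ^ k) ^ S n))%R with (c * (/ r1 * p ^ k) ^ S n)%R
      by (rewrite Rpow_mult_distr; ring).
    apply Rmult_le_compat_l; [exact Hc|].
    apply (Rle_trans _ (p ^ S n)%R).
    + apply pow_incr. split.
      * apply Rmult_le_pos; [apply Rlt_le, Rinv_0_lt_compat|]; lra.
      * apply (Rmult_le_reg_l r1); [exact Hr1|].
        rewrite <- Rmult_assoc, Rinv_r by lra. lra.
    + simpl. assert (0 < p ^ n)%R by (apply pow_lt; lra). nra.
Qed.

Lemma decreasing_two_bounds (f : Z -> C) (k : nat) : decreasing f ->
  exists c, (forall m, Cmod (f m) <= c)%R /\ (forall m, Cmod (zpow P m ^ k * f m) <= c)%R.
Proof.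
  intros H. destruct (H O) as [c Hc]. destruct (H k) as [d Hd].
  exists (Rmax c d). split; intros m.
  - eapply Rle_trans; [|apply Rmax_l]. specialize (Hc m). simpl in Hc.
    now rewrite Cmult_1_l in Hc.
  - eapply Rle_trans; [apply Hd|apply Rmax_r].
Qed.

Lemma ex_series_scal_geom (c r : R) : (0 <= r < 1)%R -> ex_series (fun n => (c * r ^ n)%R).
Proof.
  intros H. apply (ex_series_scal c (fun n => (r ^ n)%R)), ex_series_geom.
  rewrite Rabs_pos_eq; lra.
Qed.

Lemma moment_summable (x : C) (f : Z -> C) :
  (0 < Cmod x < 1)%R -> decreasing f -> zsummable (fun m => zpow x m * f m).
Proof.
  intros Hx Hf. destruct (moment_majorant (Cmod x) (Cmod x)) as [k Hk]; [lra|].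
  destruct (decreasing_two_bounds f k Hf) as [c [H0 H1]].
  specialize (Hk x f c ltac:(lra) H0 H1). split.
  - apply (summable_le _ (fun n => c * Cmod x ^ n)%R); [apply Hk|].
    apply ex_series_scal_geom. lra.
  - apply (summable_le _ (fun n => c * p ^ n)%R); [apply Hk|].
    apply ex_series_scal_geom. lra.
Qed.

Lemma Series_scal_geom (c r : R) : (0 <= r < 1)%R ->
  Series (fun n => (c * r ^ n)%R) = (c / (1 - r))%R.
Proof.
  intros H. rewrite Series_scal_l. unfold Rdiv. f_equal.
  apply is_series_unique, is_series_geom. rewrite Rabs_pos_eq; lra.
Qed.

(** Both the continuity of the distributions and the decrease of moments of
    two-variable functions rest on this explicit bound. *)
Lemma moment_le (x : C) : (0 < Cmod x < 1)%R ->
  exists (k : nat) (K : R), (0 <= K)%R /\ forall f c,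
  (forall m, Cmod (f m) <= c)%R -> (forall m, Cmod (zpow P m ^ k * f m) <= c)%R ->
  (Cmod (moment x f) <= K * c)%R.
Proof.
  intros Hx. destruct (moment_majorant (Cmod x) (Cmod x)) as [k Hk]; [lra|].
  exists k, (/ (1 - Cmod x) + / (1 - p))%R. split.
  - apply Rplus_le_le_0_compat; apply Rlt_le, Rinv_0_lt_compat; lra.
  - intros f c H0 H1. specialize (Hk x f c ltac:(lra) H0 H1).
    unfold moment, zsum. eapply Rle_trans; [apply Cmod_triangle|].
    replace ((/ (1 - Cmod x) + / (1 - p)) * c)%R
      with (c / (1 - Cmod x) + c / (1 - p))%R by (unfold Rdiv; ring).
    rewrite <- !Series_scal_geom by lra.
    apply Rplus_le_compat; apply Cmod_Cseries_le;
      try (intros n; apply Hk); apply ex_series_scal_geom; lra.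
Qed.

Lemma moment_ext (x : C) (f g : Z -> C) : (forall m, f m = g m) -> moment x f = moment x g.
Proof. intros H. apply zsum_ext. intros m. now rewrite H. Qed.

Lemma moment_lincomb (x a b : C) (f g : Z -> C) :
  (0 < Cmod x < 1)%R -> decreasing f -> decreasing g ->
  moment x (fun m => a * f m + b * g m) = a * moment x f + b * moment x g.
Proof.
  intros Hx Hf Hg. unfold moment.
  assert (A := moment_summable x f Hx Hf). assert (B := moment_summable x g Hx Hg).
  rewrite <- (zsum_scal a _ A), <- (zsum_scal b _ B).
  rewrite <- (zsum_plus _ _ (zsummable_scal a _ A) (zsummable_scal b _ B)).
  apply zsum_ext. intros m. ring.
Qed.

Lemma moment_scal (x a : C) (f : Z -> C) : (0 < Cmod x < 1)%R -> decreasing f ->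
  moment x (fun m => a * f m) = a * moment x f.
Proof.
  intros Hx Hf. rewrite (moment_ext x _ (fun m => a * f m + 0 * f m)) by (intros; ring).
  rewrite moment_lincomb by assumption. ring.
Qed.

Lemma moment_dilation (x : C) (f : Z -> C) (k : Z) :
  (0 < Cmod x < 1)%R -> decreasing f ->
  moment x (fun m => f (m + k)%Z) = zpow x (- k) * moment x f.
Proof.
  intros Hx Hf. assert (Hx0 : x <> 0) by (apply Cmod_gt_0; lra).
  assert (A := moment_summable x f Hx Hf).
  destruct (zsum_shift k _ A) as [B E]. unfold moment. rewrite <- E.
  rewrite <- (zsum_scal _ _ B). apply zsum_ext. intros m.
  rewrite (zpow_add x m k Hx0), (zpow_opp x k Hx0). field. now apply zpow_neq0.
Qed.

(** Summation by parts: [zpow (x p) m * dq f m = x ^ m (f m - f (m + 1))]. Read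
    from right to left, it continues the moment from [|x| < 1] to
    [|x p| < 1]. *)
Lemma moment_dq (x : C) (f : Z -> C) :
  (0 < Cmod x < 1)%R -> decreasing f ->
  moment (x * P) (dq f) = (1 - / x) * moment x f.
Proof.
  intros Hx Hf. assert (Hx0 : x <> 0) by (apply Cmod_gt_0; lra).
  assert (HP := P_neq0).
  assert (A := moment_summable x f Hx Hf).
  assert (B : zsummable (fun m => zpow x m * f (m + 1)%Z)).
  { destruct (zsum_shift 1 _ A) as [B _]. generalize (zsummable_scal (/ x) _ B).
    apply zsummable_ext. intros m. rewrite (zpow_add x m 1 Hx0), zpow_1. now field. }
  transitivity (zsum (fun m => zpow x m * f m - zpow x m * f (m + 1)%Z)).
  - apply zsum_ext. intros m. rewrite zpow_mult_base by assumption. unfold dq.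
    field. now apply zpow_neq0.
  - rewrite (zsum_minus _ _ A B).
    change (moment x f - moment x (fun m => f (m + 1)%Z) = (1 - / x) * moment x f).
    rewrite moment_dilation by assumption.
    rewrite (zpow_opp x 1 Hx0), zpow_1. ring.
Qed.

Lemma tends_moment {T : Type} (F : (T -> Prop) -> Prop) {FF : Filter F}
  (u : T -> C) (x : C) (f : Z -> C) :
  (0 < Cmod x < 1)%R -> decreasing f -> tends F u x ->
  tends F (fun t => moment (u t) f) (moment x f).
Proof.
  intros Hx Hf Hu. assert (Hx0 : x <> 0) by (apply Cmod_gt_0; lra).
  set (r1 := (Cmod x / 2)%R). set (r2 := ((1 + Cmod x) / 2)%R).
  destruct (moment_majorant r1 r2) as [k Hk]; [unfold r1; lra|].
  destruct (decreasing_two_bounds f k Hf) as [c [H0 H1]].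
  assert (Hd : (0 < Rmin (Cmod x - r1) (r2 - Cmod x))%R)
    by (apply Rmin_case; unfold r1, r2; lra).
  assert (HF : F (fun t => (r1 <= Cmod (u t) <= r2)%R)).
  { generalize (Hu _ Hd). apply filter_imp. intros t Ht.
    generalize (Cmod_triangle x (u t - x)). replace (x + (u t - x)) with (u t) by ring.
    generalize (Cmod_triangle (u t) (- (u t - x))).
    replace (u t + - (u t - x)) with x by ring. rewrite Cmod_opp.
    generalize (Rmin_l (Cmod x - r1) (r2 - Cmod x)) (Rmin_r (Cmod x - r1) (r2 - Cmod x)).
    lra. }
  assert (Hx2 : (r1 <= Cmod x <= r2)%R) by (unfold r1, r2; lra).
  unfold moment, zsum. apply tends_plus; [exact FF| |].
  - apply (tannery F (fun t n => zpow (u t) (Z.of_nat n) * f (Z.of_nat n))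
             (fun n => zpow x (Z.of_nat n) * f (Z.of_nat n)) (fun n => c * r2 ^ n)%R).
    + intros i. apply tends_mult; [exact FF| |now apply tends_const].
      apply (tends_ext F (fun t => u t ^ i)); [intros; now rewrite zpow_nat|].
      rewrite zpow_nat. now apply tends_pow.
    + revert HF. apply filter_imp. intros t Ht i. now apply Hk.
    + intros i. now apply Hk.
    + apply ex_series_scal_geom. unfold r2. lra.
  - apply (tannery F (fun t n => zpow (u t) (- Z.of_nat (S n)) * f (- Z.of_nat (S n))%Z)
             (fun n => zpow x (- Z.of_nat (S n)) * f (- Z.of_nat (S n))%Z) (fun n => c * p ^ n)%R).
    + intros i. apply tends_mult; [exact FF| |now apply tends_const].
      apply (tends_ext F (fun t => (/ u t) ^ S i)); [intros; now rewrite zpow_opp_nat|].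
      rewrite zpow_opp_nat. now apply tends_pow, tends_inv.
    + revert HF. apply filter_imp. intros t Ht i. now apply Hk.
    + intros i. now apply Hk.
    + apply ex_series_scal_geom. lra.
Qed.

(** * The normalized functional, continued to all [x <> 0] *)

(** For [|x| < 1] and [N = 0] this is the moment of [f] times
    [(x; p)_oo / (p; p)_oo]; [N] summations by parts extend it to
    [|x p ^ N| < 1]. *)
Definition frac (N : nat) (x : C) (f : Z -> C) : C :=
  (- x) ^ N * gauss N * (poch_inf (x * P ^ N) / poch_inf P)
  * moment (x * P ^ N) (dqn N f).

Lemma Cmod_xP (x : C) (N : nat) : x <> 0 -> (0 < Cmod (x * P ^ N))%R.
Proof. intros H. apply Cmod_gt_0, Cmult_neq_0; [exact H|apply Cpow_nz, P_neq0]. Qed.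

(** The factor [1 - 1 / x] of [moment_dq] recombines with [(x p; p)_oo] to
    [(x; p)_oo]. *)
Lemma frac_S (N : nat) (x : C) (f : Z -> C) :
  x <> 0 -> (Cmod (x * P ^ N) < 1)%R -> schwartz f ->
  frac (S N) x f = frac N x f.
Proof.
  intros Hx HN Hf. unfold frac. set (y := x * P ^ N) in *.
  assert (Hy : y <> 0) by (apply Cmod_gt_0; now apply Cmod_xP).
  replace (x * P ^ S N) with (y * P) by (unfold y; simpl; ring).
  change (dqn (S N) f) with (dq (dqn N f)).
  rewrite moment_dq by (try apply Hf; generalize (Cmod_xP x N Hx); fold y; lra).
  rewrite (poch_inf_split y 1).
  replace (y * P ^ 1) with (y * P) by (simpl; ring).
  rewrite (Cpow_S (- x)). simpl gauss. simpl poch.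
  transitivity ((- x) ^ N * gauss N * (poch_inf (y * P) / poch_inf P)
    * (- (x * P ^ N) * (1 - / y)) * moment y (dqn N f)); [unfold Cdiv; ring|].
  fold y. replace (- y * (1 - / y)) with (1 - y) by (field; exact Hy).
  unfold Cdiv. ring.
Qed.

Lemma frac_indep (N M : nat) (x : C) (f : Z -> C) :
  x <> 0 -> (Cmod (x * P ^ N) < 1)%R -> (Cmod (x * P ^ M) < 1)%R -> schwartz f ->
  frac N x f = frac M x f.
Proof.
  intros Hx. assert (W : forall N k, (Cmod (x * P ^ N) < 1)%R -> schwartz f ->
                     frac (k + N) x f = frac N x f).
  { intros n k Hn Hf. induction k as [|k IH]; [reflexivity|].
    simpl Nat.add. rewrite frac_S; [exact IH|exact Hx| |exact Hf].
    rewrite Cpow_add_r. replace (x * (P ^ k * P ^ n)) with (P ^ k * (x * P ^ n)) by ring.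
    rewrite Cmod_mult, Cmod_Ppow.
    generalize (ppow_le_1 k) (Cmod_ge_0 (x * P ^ n)). nra. }
  intros HN HM Hf. destruct (Nat.le_ge_cases N M) as [H|H].
  - replace M with ((M - N) + N)%nat by lia. symmetry. now apply W.
  - replace N with ((N - M) + M)%nat by lia. now apply W.
Qed.

(** * The q-shift *)

Definition bounded (f : Z -> C) : Prop := exists c : R, forall m, (Cmod (f m) <= c)%R.

Lemma decreasing_bounded (f : Z -> C) : decreasing f -> bounded f.
Proof.
  intros H. destruct (H O) as [c Hc]. exists c. intros m.
  specialize (Hc m). simpl in Hc. now rewrite Cmult_1_l in Hc.
Qed.

(** The [k]-th term of the q-shift at [s = p ^ b], with [z] in the place of [xi]. *)
Definition shift_term (z : C) (f : Z -> C) (b : Z) (k : nat) : C :=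
  z ^ k / poch P k * dqn k f (b - Z.of_nat k)%Z.

(** The norm of the [k]-th derivative: each step at worst adds the values at two
    neighbouring points, whose weights [p ^ (k m)] differ by [p ^ k]. *)
Fixpoint dqn_norm (k : nat) : R :=
  match k with O => 1%R | S j => (dqn_norm j * (1 + (/ p) ^ j))%R end.

Lemma dqn_norm_pos (k : nat) : (0 < dqn_norm k)%R.
Proof.
  induction k as [|k IH]; simpl; [lra|]. apply Rmult_lt_0_compat; [exact IH|].
  assert (0 < (/ p) ^ k)%R by (apply pow_lt, Rinv_0_lt_compat; lra). lra.
Qed.

Lemma dqn_le (f : Z -> C) (c : R) (k : nat) (m : Z) :
  (forall m, Cmod (f m) <= c)%R ->
  (Cmod (zpow P m ^ k * dqn k f m) <= c * dqn_norm k)%R.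
Proof.
  intros Hf. assert (HP := P_neq0). revert m. induction k as [|k IH]; intros m.
  - simpl. rewrite Cmult_1_l, Rmult_1_r. apply Hf.
  - change (dqn (S k) f m) with ((dqn k f m - dqn k f (m + 1)%Z) / zpow P m).
    rewrite Cpow_S.
    replace (zpow P m * zpow P m ^ k * ((dqn k f m - dqn k f (m + 1)%Z) / zpow P m))
      with (zpow P m ^ k * dqn k f m
            + - ((/ P) ^ k * (zpow P (m + 1) ^ k * dqn k f (m + 1)%Z))).
    + eapply Rle_trans; [apply Cmod_triangle|].
      rewrite Cmod_opp, (Cmod_mult ((/ P) ^ k)), Cmod_pow, Cmod_invP.
      simpl dqn_norm.
      assert (0 < (/ p) ^ k)%R by (apply pow_lt, Rinv_0_lt_compat; lra).
      generalize (IH m) (IH (m + 1)%Z). nra.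
    + rewrite (zpow_add P m 1 HP), zpow_1, Cpow_mult_l.
      transitivity (zpow P m ^ k * (dqn k f m - ((P ^ k * (/ P) ^ k) * dqn k f (m + 1)%Z)));
        [ring|].
      rewrite Cpow_inv_cancel by exact HP. field. now apply zpow_neq0.
Qed.

(** Evaluation at [p ^ -k s] gains a factor [p ^ (k ^ 2)], which beats both
    the growth of [z ^ k] and the norm of the [k]-th derivative. *)
Lemma shift_term_summable (z : C) (f : Z -> C) (b : Z) :
  bounded f -> summable (shift_term z f b).
Proof.
  intros [c Hc]. assert (HP := P_neq0).
  set (Y := Cmod (z * zpow P (- b))).
  assert (HY : (0 <= Y)%R) by apply Cmod_ge_0.
  assert (Hc0 : (0 <= c)%R) by (eapply Rle_trans; [apply Cmod_ge_0|apply (Hc 0%Z)]).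
  set (B := fun k : nat => (dqn_norm k * p ^ (k * k) * Y ^ k)%R).
  assert (HB : forall k, (0 <= B k)%R).
  { intros k. unfold B. apply Rmult_le_pos; [apply Rmult_le_pos|].
    - apply Rlt_le, dqn_norm_pos.
    - apply pow_le; lra.
    - now apply pow_le. }
  assert (EB : ex_series B).
  { apply summable_RtoC; [exact HB|].
    destruct (geom_small p (2 * Y) (/ 2) hp) as [N HN]; [lra|].
    apply (summable_ratio _ (/ 2) N); [lra|]. intros n Hn. specialize (HN n Hn).
    rewrite !Cmod_RtoC_pos by apply HB.
    assert (E : B (S n) = ((1 + (/ p) ^ n) * p ^ n * (p * p ^ n) * Y * B n)%R).
    { unfold B. simpl dqn_norm.
      replace (S n * S n)%nat with (n + (1 + n) + n * n)%nat by lia.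
      rewrite !pow_add. simpl. ring. }
    rewrite E. apply Rmult_le_compat_r; [apply HB|].
    assert (I : ((/ p) ^ n * p ^ n = 1)%R)
      by (rewrite <- Rpow_mult_distr, Rinv_l by lra; apply pow1).
    rewrite Rmult_plus_distr_r, I.
    assert (0 < p ^ n <= 1)%R by apply ppow_le_1.
    apply (Rle_trans _ (2 * Y * p ^ n)%R); [|lra].
    replace (2 * Y * p ^ n)%R with (2 * (1 * p ^ n) * Y)%R by ring.
    apply Rmult_le_compat_r; [exact HY|].
    apply Rmult_le_compat; nra. }
  apply (summable_le _ (fun k => c / Cmod (poch_inf P) * B k)%R).
  2: { apply (ex_series_scal (c / Cmod (poch_inf P))%R B EB). }
  intros k. unfold shift_term.
  assert (D := dqn_le f c k (b - Z.of_nat k) Hc).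
  assert (Hpi : (0 < Cmod (poch_inf P))%R) by (apply Cmod_gt_0, poch_inf_P_neq0).
  replace (z ^ k / poch P k * dqn k f (b - Z.of_nat k)%Z)
    with (/ poch P k * (P ^ (k * k) * (z * zpow P (- b)) ^ k
             * (zpow P (b - Z.of_nat k) ^ k * dqn k f (b - Z.of_nat k)%Z))).
  - rewrite Cmod_mult, Cmod_inv by (apply poch_P_neq0).
    rewrite Cmod_mult, (Cmod_mult (P ^ (k * k))), Cmod_Ppow, (Cmod_pow (z * _)).
    fold Y.
    assert (I : (/ Cmod (poch P k) <= / Cmod (poch_inf P))%R)
      by (apply Rinv_le_contravar; [exact Hpi|apply Cmod_poch_P_ge]).
    unfold B.
    replace (c / Cmod (poch_inf P) * (dqn_norm k * p ^ (k * k) * Y ^ k))%R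
      with (/ Cmod (poch_inf P) * ((p ^ (k * k) * Y ^ k) * (c * dqn_norm k)))%R
      by (unfold Rdiv; ring).
    assert (Q : (0 <= p ^ (k * k) * Y ^ k)%R)
      by (apply Rmult_le_pos; apply pow_le; lra).
    apply Rmult_le_compat; [| |exact I|].
    + apply Rlt_le, Rinv_0_lt_compat, Cmod_gt_0, poch_P_neq0.
    + apply Rmult_le_pos; [exact Q|apply Cmod_ge_0].
    + apply Rmult_le_compat_l; [exact Q|exact D].
  - unfold Z.sub. rewrite (zpow_add P b _ HP), zpow_opp_nat, (zpow_opp P b HP).
    rewrite !Cpow_mult_l, <- (Cpow_mult_r (/ P)).
    assert (I := Cpow_inv_cancel P (k * k) HP).
    assert (J := Cpow_inv_cancel (zpow P b) k (zpow_neq0 P b HP)).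
    transitivity (z ^ k / poch P k * dqn k f (b + - Z.of_nat k)%Z
      * (P ^ (k * k) * (/ P) ^ (k * k)) * (zpow P b ^ k * (/ zpow P b) ^ k)).
    + unfold Cdiv. ring.
    + rewrite I, J. ring.
Qed.

(** [xi = p ^ a] and [s = p ^ b]. *)
Definition qshift (f : Z -> C) (a b : Z) : C := Cseries (shift_term (zpow P a) f b).

(** Termwise: [d/ds] commutes with the dilation [p ^ -k] up to [p ^ -k], which
    turns [xi ^ k] into [(xi / p) ^ k]. *)
Lemma dq_qshift (f : Z -> C) (a b : Z) :
  bounded f -> bounded (dq f) ->
  dq (qshift f a) b = qshift (dq f) (a - 1) b.
Proof.
  intros Hf Hdf. assert (HP := P_neq0).
  unfold dq at 1, qshift.
  rewrite <- Cseries_minus by now apply shift_term_summable.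
  unfold Cdiv. rewrite Cmult_comm, <- Cseries_scal.
  2: { apply summable_minus; now apply shift_term_summable. }
  apply Cseries_ext. intros k. unfold shift_term.
  rewrite <- (dqn_S k f). 
  change (dqn (S k) f (b - Z.of_nat k)%Z)
    with ((dqn k f (b - Z.of_nat k)%Z - dqn k f (b - Z.of_nat k + 1)%Z) / zpow P (b - Z.of_nat k)).
  replace (b + 1 - Z.of_nat k)%Z with (b - Z.of_nat k + 1)%Z by lia.
  rewrite (zpow_sub P a 1 HP), (zpow_sub P b (Z.of_nat k) HP), zpow_1, zpow_nat.
  change (zpow P a / P) with (zpow P a * / P). rewrite Cpow_mult_l, Cpow_inv by exact HP.
  field. repeat split; try apply poch_P_neq0; try now apply zpow_neq0.
  now apply Cpow_nz.
Qed.

(** * The kernel of the q-shift *)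

(** With [z = xi / s], the q-shift of [f] is the double sum of
    [alpha i j * z ^ (i + j) * f (b - i)], where [i + j] is the order of the
    derivative. *)
Definition alpha (i j : nat) : C :=
  (- (1)) ^ j * P ^ (i * i) * P ^ (i * j) * gauss j * P ^ j / (poch P i * poch P j).

Lemma alpha_Sl (i j : nat) :
  (1 - P ^ S i) * P ^ j * alpha (S i) j = P ^ S (i + j) * P ^ (i + j) * alpha i j.
Proof.
  unfold alpha. rewrite poch_S.
  replace (S i * S i)%nat with (i * i + i + S i)%nat by lia.
  replace (S i * j)%nat with (i * j + j)%nat by lia.
  rewrite !Cpow_add_r, !(Cpow_S P), Cpow_add_r.
  field. repeat split; try apply poch_P_neq0.
  rewrite <- Cpow_S. apply one_sub_Ppow.
Qed.

Lemma alpha_Sr (i j : nat) :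
  (1 - P ^ S j) * alpha i (S j) = - P ^ S (i + j) * alpha i j.
Proof.
  unfold alpha. rewrite poch_S. simpl gauss.
  replace (i * S j)%nat with (i * j + i)%nat by lia.
  rewrite !(Cpow_S P), !Cpow_add_r, (Cpow_S (- (1))).
  field. repeat split; try apply poch_P_neq0.
  rewrite <- Cpow_S. apply one_sub_Ppow.
Qed.

(** The iterated derivative is expanded by the q-binomial formula; the
    induction step is Pascal's rule, in the form
    [1 - p ^ (i + j) = (1 - p ^ i) p ^ j + (1 - p ^ j)]. *)
Lemma dqn_expand (f : Z -> C) (k : nat) (b : Z) :
  zpow P b ^ k * dqn k f (b - Z.of_nat k)%Z
  = poch P k * csum (fun i => alpha i (k - i) * f (b - Z.of_nat i)%Z) (S k).
Proof.
  assert (HP := P_neq0). revert b. induction k as [|k IH]; intros b.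
  - unfold alpha. simpl. field.
  - change (dqn (S k) f (b - Z.of_nat (S k))%Z)
      with ((dqn k f (b - Z.of_nat (S k))%Z - dqn k f (b - Z.of_nat (S k) + 1)%Z)
            / zpow P (b - Z.of_nat (S k))).
    replace (b - Z.of_nat (S k) + 1)%Z with (b - Z.of_nat k)%Z by lia.
    transitivity (P ^ S k * (P ^ k * (zpow P (b - 1) ^ k * dqn k f (b - 1 - Z.of_nat k)%Z)
                             - zpow P b ^ k * dqn k f (b - Z.of_nat k)%Z)).
    { replace (b - 1 - Z.of_nat k)%Z with (b - Z.of_nat (S k))%Z by lia.
      replace (zpow P (b - Z.of_nat (S k))) with (zpow P b * (/ P) ^ S k).
      2: { unfold Z.sub. now rewrite (zpow_add P b _ HP), zpow_opp_nat. }
      replace (zpow P (b - 1)) with (zpow P b * / P).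
      2: { unfold Z.sub. now rewrite (zpow_add P b _ HP), (zpow_opp P 1 HP), zpow_1. }
      rewrite Cpow_mult_l, !Cpow_inv, !Cpow_S by exact HP.
      field. repeat split; try (apply Cpow_nz); try exact HP. now apply zpow_neq0. }
    rewrite (IH (b - 1)%Z), (IH b), poch_S.
    set (S1 := csum (fun i => alpha i (k - i) * f (b - 1 - Z.of_nat i)%Z) (S k)).
    set (S2 := csum (fun i => alpha i (k - i) * f (b - Z.of_nat i)%Z) (S k)).
    transitivity (poch P k * (P ^ S k * P ^ k * S1 - P ^ S k * S2)); [ring|].
    rewrite <- (Cmult_assoc (poch P k) (1 - P ^ S k)). f_equal. rewrite <- csum_scal.
    rewrite (csum_ext _ (fun i => (1 - P ^ i) * P ^ (S k - i) * alpha i (S k - i) * f (b - Z.of_nat i)%Z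
                             + (1 - P ^ (S k - i)) * alpha i (S k - i) * f (b - Z.of_nat i)%Z)).
    2: { intros i Hi.
         replace (P ^ S k) with (P ^ i * P ^ (S k - i))
           by (rewrite <- Cpow_add_r; f_equal; lia). ring. }
    rewrite csum_plus. unfold Cminus at 1. f_equal.
    + rewrite csum_first. simpl (P ^ 0). unfold S1. rewrite <- csum_scal.
      replace ((1 - 1) * P ^ (S k - 0) * alpha 0 (S k - 0) * f (b - Z.of_nat 0)%Z)
        with (RtoC 0) by ring.
      rewrite Cplus_0_l. apply csum_ext. intros i Hi.
      replace (S k - S i)%nat with (k - i)%nat by lia.
      rewrite alpha_Sl. replace (i + (k - i))%nat with k by lia.
      replace (b - Z.of_nat (S i))%Z with (b - 1 - Z.of_nat i)%Z by lia. ring.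
    + change (- (P ^ S k * S2) =
        csum (fun i => (1 - P ^ (S k - i)) * alpha i (S k - i) * f (b - Z.of_nat i)%Z) (S k)
        + (1 - P ^ (S k - S k)) * alpha (S k) (S k - S k) * f (b - Z.of_nat (S k))%Z).
      replace (S k - S k)%nat with O by lia. simpl (P ^ 0).
      transitivity (- P ^ S k * S2); [ring|].
      unfold S2. rewrite <- csum_scal.
      rewrite (csum_ext _ (fun i => (1 - P ^ (S k - i)) * alpha i (S k - i) * f (b - Z.of_nat i)%Z)).
      { ring. }
      intros i Hi. replace (S k - i)%nat with (S (k - i)) by lia.
      rewrite alpha_Sr. replace (i + (k - i))%nat with k by lia. ring.
Qed.

(** [kap i j] is the weight of [f c] in the q-shift at [xi = p ^ a], [s = p ^ b]
    with [i = b - c] and [j = a - c]. *)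
Definition kap (i j : nat) : C := P ^ (i * j) * poch_inf P / (poch P i * poch P j).

(** The formula [p ^ (i j) (p ^ (j + 1); p)_oo / (p; p)_i] for [kap i j] makes
    sense for every integer [j] and vanishes for [j < 0]. *)
Definition kapz (i : nat) (j : Z) : C := if (j <? 0)%Z then 0 else kap i (Z.to_nat j).

Lemma kapz_nat (i j : nat) : kapz i (Z.of_nat j) = kap i j.
Proof.
  unfold kapz. rewrite Nat2Z.id.
  replace (Z.of_nat j <? 0)%Z with false by (symmetry; apply Z.ltb_ge; lia). reflexivity.
Qed.

Lemma kapz_neg (i : nat) (j : Z) : (j < 0)%Z -> kapz i j = 0.
Proof. intros H. unfold kapz. now rewrite (proj2 (Z.ltb_lt j 0) H). Qed.

Lemma kap_sym (i j : nat) : kap i j = kap j i.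
Proof.
  unfold kap. now rewrite (Nat.mul_comm i j), (Cmult_comm (poch P i)).
Qed.

Lemma kapz_series (i : nat) (n : Z) :
  zpow P n ^ i * P ^ (i * i) / poch P i * poch_inf (zpow P n * P ^ S i)
  = kapz i (Z.of_nat i + n).
Proof.
  assert (HP := P_neq0).
  assert (E : zpow P n * P ^ i = zpow P (Z.of_nat i + n)).
  { now rewrite (zpow_add P _ n HP), zpow_nat, Cmult_comm. }
  replace (zpow P n * P ^ S i) with (zpow P (Z.of_nat i + n) * P)
    by (rewrite <- E; simpl; ring).
  rewrite (Cpow_mult_r P i i), <- Cpow_mult_l, E.
  destruct (Z.lt_ge_cases (Z.of_nat i + n) 0) as [H|H].
  - rewrite kapz_neg by exact H.
    (* the product contains the factor [1 - p ^ (j + 1) p ^ -(j + 1)] *)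
    set (m := Z.to_nat (- (Z.of_nat i + n + 1))).
    replace (Z.of_nat i + n)%Z with (- Z.of_nat (S m))%Z by lia.
    rewrite zpow_opp_nat, (poch_inf_split _ (S m)).
    replace (poch ((/ P) ^ S m * P) (S m)) with (RtoC 0); [ring|].
    simpl poch.
    replace (/ P * (/ P) ^ m * P * P ^ m) with ((P ^ m * (/ P) ^ m) * (/ P * P)) by ring.
    rewrite Cpow_inv_cancel, Cinv_l by exact HP. ring.
  - set (j := Z.to_nat (Z.of_nat i + n)).
    replace (Z.of_nat i + n)%Z with (Z.of_nat j) by lia.
    rewrite kapz_nat, zpow_nat. unfold kap.
    rewrite (poch_inf_split P j), <- Cpow_mult_r, (Nat.mul_comm j i).
    rewrite (Cmult_comm P (P ^ j)).
    field. split; apply poch_P_neq0.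
Qed.

(** The sum over the order [j] of the derivative is Euler's series for an
    infinite product. *)
Lemma qshift_kernel (f : Z -> C) (a b : Z) :
  bounded f ->
  qshift f a b = Cseries (fun i => kapz i (Z.of_nat i + (a - b)) * f (b - Z.of_nat i)%Z).
Proof.
  intros [c Hc]. assert (HP := P_neq0).
  set (y := zpow P (a - b)).
  set (h := fun i : nat => y ^ i * P ^ (i * i) / poch P i * f (b - Z.of_nat i)%Z).
  set (u := fun i j : nat => h i * (euler_coef j * (y * P ^ S i) ^ j)).
  assert (Su : forall i, summable (u i)).
  { intros i. apply summable_scal, euler_summable. }
  set (E := Series (fun j => Cmod (euler_coef j * y ^ j))).
  apply is_series_Cseries.
  apply (is_series_ext (fun k => csum (fun i => u i (k - i)%nat) (S k))).
  - intros k. unfold shift_term.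
    match goal with |- ?l = ?r => change (@eq C l r) end.
    transitivity (y ^ k * (csum (fun i => alpha i (k - i) * f (b - Z.of_nat i)%Z) (S k))).
    + rewrite <- csum_scal. apply csum_ext. intros i Hi.
      unfold u, h, euler_coef, alpha.
      replace (y ^ k) with (y ^ i * y ^ (k - i)) by (rewrite <- Cpow_add_r; f_equal; lia).
      rewrite Cpow_mult_l, <- Cpow_mult_r.
      replace (S i * (k - i))%nat with (i * (k - i) + (k - i))%nat by lia.
      rewrite Cpow_add_r. field. split; apply poch_P_neq0.
    + replace (zpow P a) with (y * zpow P b)
        by (unfold y; rewrite <- (zpow_add P _ _ HP); f_equal; lia).
      rewrite Cpow_mult_l.
      transitivity (y ^ k / poch P k * (zpow P b ^ k * dqn k f (b - Z.of_nat k)%Z)).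
      * rewrite dqn_expand. field. apply poch_P_neq0.
      * unfold Cdiv. ring.
  - replace (Cseries (fun i => kapz i (Z.of_nat i + (a - b)) * f (b - Z.of_nat i)%Z))
      with (Cseries (fun i => Cseries (u i))).
    2: { apply Cseries_ext. intros i. unfold u.
         rewrite Cseries_scal by apply euler_summable.
         rewrite <- poch_inf_euler, <- kapz_series. unfold h, y, Cdiv. ring. }
    apply (antidiagonal_sum u (fun i => Cmod (h i) * E)%R Su).
    + intros i. unfold u.
      rewrite (Series_ext _ (fun j => Cmod (h i) * Cmod (euler_coef j * (y * P ^ S i) ^ j))%R)
        by (intros; apply Cmod_mult).
      rewrite Series_scal_l. apply Rmult_le_compat_l; [apply Cmod_ge_0|].
      apply Series_le; [|apply euler_summable].
      intros j. split; [apply Cmod_ge_0|].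
      rewrite !Cmod_mult, !Cmod_pow, Cmod_mult, Cmod_Ppow.
      apply Rmult_le_compat_l; [apply Cmod_ge_0|]. apply pow_incr.
      generalize (Cmod_ge_0 y) (ppow_le_1 (S i)). nra.
    + apply (ex_series_scal_r E (fun i => Cmod (h i))). change (summable h).
      apply (summable_ext (fun i => f (b - Z.of_nat i)%Z * (y ^ i * P ^ (i * i) / poch P i))).
      { intros i. unfold h. ring. }
      apply (summable_le _ (fun i => c * Cmod (y ^ i * P ^ (i * i) / poch P i))%R).
      { intros i. rewrite Cmod_mult. apply Rmult_le_compat_r; [apply Cmod_ge_0|apply Hc]. }
      apply (ex_series_scal c (fun i => Cmod (y ^ i * P ^ (i * i) / poch P i))).
      destruct (geom_small p (Cmod y / (1 - p)) (/ 2) hp) as [N HN]; [lra|].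
      apply (summable_ratio _ (/ 2) N); [lra|]. intros n Hn. specialize (HN n Hn).
      replace (y ^ S n * P ^ (S n * S n) / poch P (S n))
        with ((y * (P ^ n * P ^ S n) / (1 - P ^ S n)) * (y ^ n * P ^ (n * n) / poch P n)).
      2: { replace (S n * S n)%nat with (n + S n + n * n)%nat by lia.
           rewrite !Cpow_add_r, poch_S, (Cpow_S y). field.
           split; [apply one_sub_Ppow|apply poch_P_neq0]. }
      rewrite Cmod_mult. apply Rmult_le_compat_r; [apply Cmod_ge_0|].
      rewrite Cmod_div by apply one_sub_Ppow.
      rewrite !Cmod_mult, !Cmod_Ppow.
      destruct (Cmod_one_sub_Ppow n) as [L _].
      destruct (ppow_le_1 n) as [A1 A2]. destruct (ppow_le_1 (S n)) as [B1 B2].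
      apply (Rle_trans _ (Cmod y * (p ^ n * 1) / (1 - p))%R); [|unfold Rdiv in *; lra].
      generalize (Cmod_ge_0 y). intros Hy.
      apply Rmult_le_compat.
      * apply Rmult_le_pos; nra.
      * apply Rlt_le, Rinv_0_lt_compat. lra.
      * apply Rmult_le_compat_l; [exact Hy|]. nra.
      * apply Rinv_le_contravar; lra.
Qed.

(** The exponent [i (i + n)] is at least [i], so the kernel is summable uniformly
    in the distance [n] of the two arguments. *)
Lemma kap_le (i n : nat) :
  (Cmod (kap i (i + n)) <= / Cmod (poch_inf P) * p ^ i)%R.
Proof.
  unfold kap.
  assert (Hpi : (0 < Cmod (poch_inf P))%R) by (apply Cmod_gt_0, poch_inf_P_neq0).
  assert (A := Cmod_poch_P_ge i). assert (B := Cmod_poch_P_ge (i + n)).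
  rewrite Cmod_div by (apply Cmult_neq_0; apply poch_P_neq0).
  rewrite !Cmod_mult, Cmod_Ppow.
  assert (D : (p ^ (i * (i + n)) <= p ^ i)%R).
  { destruct i as [|i]; [simpl; lra|].
    replace (S i * (S i + n))%nat with (S i + S i * (i + n))%nat by lia.
    rewrite pow_add. generalize (ppow_le_1 (S i)) (ppow_le_1 (S i * (i + n))). nra. }
  unfold Rdiv.
  assert (G : (0 <= p ^ (i * (i + n)))%R) by (apply pow_le; lra).
  set (X := Cmod (poch_inf P)) in *.
  set (Y1 := Cmod (poch P i)) in *. set (Y2 := Cmod (poch P (i + n))) in *.
  set (G1 := (p ^ (i * (i + n)))%R) in *.
  assert (HY : (0 < Y1 * Y2)%R) by (apply Rmult_lt_0_compat; lra).
  apply (Rmult_le_reg_r (Y1 * Y2)); [exact HY|].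
  replace (G1 * X * / (Y1 * Y2) * (Y1 * Y2))%R with (G1 * X)%R by (field; split; lra).
  replace (/ X * p ^ i * (Y1 * Y2))%R with (p ^ i * ((/ X * Y1) * Y2))%R by ring.
  assert (1 <= / X * Y1)%R.
  { apply (Rmult_le_reg_l X); [exact Hpi|]. rewrite <- Rmult_assoc, Rinv_r by lra. lra. }
  apply Rmult_le_compat; [exact G|lra|exact D|].
  apply (Rle_trans _ (1 * Y2)%R); [lra|]. apply Rmult_le_compat_r; lra.
Qed.

Lemma qshift_above (f : Z -> C) (b : Z) (n : nat) :
  bounded f ->
  qshift f (b + Z.of_nat n) b = Cseries (fun i => kap i (i + n) * f (b - Z.of_nat i)%Z).
Proof.
  intros Hf. rewrite qshift_kernel by exact Hf. apply Cseries_ext. intros i.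
  rewrite <- kapz_nat. f_equal. f_equal. lia.
Qed.

Lemma kap_summable (f : Z -> C) (b : Z) (n : nat) :
  bounded f -> summable (fun i => kap i (i + n) * f (b - Z.of_nat i)%Z).
Proof.
  intros [c Hc]. apply (summable_le _ (fun i => (/ Cmod (poch_inf P) * c) * p ^ i)%R).
  - intros i. rewrite Cmod_mult.
    replace (/ Cmod (poch_inf P) * c * p ^ i)%R with (/ Cmod (poch_inf P) * p ^ i * c)%R by ring.
    apply Rmult_le_compat; try apply Cmod_ge_0; [apply kap_le|apply Hc].
  - apply ex_series_scal_geom. lra.
Qed.

Lemma qshift_below (f : Z -> C) (b : Z) (n : nat) :
  bounded f ->
  qshift f b (b + Z.of_nat n) = Cseries (fun i => kap i (i + n) * f (b - Z.of_nat i)%Z).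
Proof.
  intros Hf. rewrite qshift_kernel by exact Hf.
  assert (E : forall i, kapz (n + i) (Z.of_nat (n + i) + (b - (b + Z.of_nat n)))
                * f (b + Z.of_nat n - Z.of_nat (n + i))%Z
              = kap i (i + n) * f (b - Z.of_nat i)%Z).
  { intros i.
    replace (Z.of_nat (n + i) + (b - (b + Z.of_nat n)))%Z with (Z.of_nat i) by lia.
    rewrite kapz_nat, kap_sym. f_equal; f_equal; lia. }
  rewrite (Cseries_split _ n).
  - rewrite csum_zero by (intros i Hi; rewrite kapz_neg by lia; ring).
    rewrite Cplus_0_l. apply Cseries_ext, E.
  - apply (summable_shift _ n).
    apply (summable_ext _ _ (fun i => eq_sym (E i))). now apply kap_summable.
Qed.

(** [qshift_above] and [qshift_below] are the same series, as [kap] is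
    symmetric and the terms with [kapz = 0] have been dropped from the second. *)
Lemma qshift_sym (f : Z -> C) (a b : Z) : bounded f -> qshift f a b = qshift f b a.
Proof.
  intros Hf. destruct (Z.le_ge_cases b a) as [H|H].
  - replace a with (b + Z.of_nat (Z.to_nat (a - b)))%Z by lia.
    now rewrite qshift_above, qshift_below.
  - replace b with (a + Z.of_nat (Z.to_nat (b - a)))%Z by lia.
    now rewrite qshift_above, qshift_below.
Qed.

(** The kernel at [(a, b)] only sees [f] at points [p ^ c] with
    [c <= min a b]. There [p ^ a] and [p ^ b] are at most [p ^ c], and the
    decrease of [f] absorbs both. *)
Lemma qshift_decreasing (f : Z -> C) (k k' : nat) :
  decreasing f -> exists c, forall a b,
  (Cmod (zpow P a ^ k' * (zpow P b ^ k * qshift f a b)) <= c)%R.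
Proof.
  intros Hf. assert (HP := P_neq0).
  assert (Hb := decreasing_bounded f Hf).
  assert (Hpi : (0 < Cmod (poch_inf P))%R) by (apply Cmod_gt_0, poch_inf_P_neq0).
  assert (W : forall k k', exists c, forall b (n : nat),
    (Cmod (zpow P (b + Z.of_nat n) ^ k' * (zpow P b ^ k *
        Cseries (fun i => kap i (i + n)%nat * f (b - Z.of_nat i)%Z)%C)) <= c)%R).
  { clear k k'. intros k k'. destruct (Hf (k + k')%nat) as [c Hc].
    exists (/ Cmod (poch_inf P) * c / (1 - p))%R. intros b n.
    rewrite Cmult_assoc. rewrite <- Cseries_scal by now apply kap_summable.
    rewrite <- Series_scal_geom by lra.
    apply Cmod_Cseries_le; [|apply ex_series_scal_geom; lra].
    intros i. specialize (Hc (b - Z.of_nat i)%Z).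
    set (g := f (b - Z.of_nat i)%Z) in *.
    replace (zpow P (b + Z.of_nat n)) with (P ^ (n + i) * zpow P (b - Z.of_nat i)).
    2: { rewrite <- zpow_nat, <- (zpow_add P _ _ HP). f_equal. lia. }
    replace (zpow P b) with (P ^ i * zpow P (b - Z.of_nat i)).
    2: { rewrite <- zpow_nat, <- (zpow_add P _ _ HP). f_equal. lia. }
    set (w := zpow P (b - Z.of_nat i)) in *.
    replace ((P ^ (n + i) * w) ^ k' * (P ^ i * w) ^ k * (kap i (i + n) * g))
      with (P ^ ((n + i) * k' + i * k) * (kap i (i + n) * (w ^ (k + k') * g))).
    2: { rewrite !Cpow_mult_l, <- !Cpow_mult_r, !Cpow_add_r. ring. }
    rewrite Cmod_mult, Cmod_Ppow, (Cmod_mult (kap _ _)).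
    destruct (ppow_le_1 ((n + i) * k' + i * k)) as [A1 A2].
    assert (K := kap_le i n).
    assert (KK : (Cmod (kap i (i + n)) * Cmod (w ^ (k + k') * g)
                  <= / Cmod (poch_inf P) * p ^ i * c)%R)
      by (apply Rmult_le_compat; try apply Cmod_ge_0; assumption).
    assert (0 <= Cmod (kap i (i + n)) * Cmod (w ^ (k + k') * g))%R
      by (apply Rmult_le_pos; apply Cmod_ge_0).
    replace (/ Cmod (poch_inf P) * c * p ^ i)%R with (/ Cmod (poch_inf P) * p ^ i * c)%R by ring.
    nra. }
  destruct (W k k') as [c1 H1]. destruct (W k' k) as [c2 H2].
  exists (Rmax c1 c2). intros a b. destruct (Z.le_ge_cases b a) as [H|H].
  - eapply Rle_trans; [|apply Rmax_l].
    replace a with (b + Z.of_nat (Z.to_nat (a - b)))%Z by lia.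
    rewrite qshift_above by exact Hb. apply H1.
  - eapply Rle_trans; [|apply Rmax_r].
    replace b with (a + Z.of_nat (Z.to_nat (b - a)))%Z by lia.
    rewrite qshift_below by exact Hb.
    replace (zpow P a ^ k' * (zpow P (a + Z.of_nat (Z.to_nat (b - a))) ^ k * _))
      with (zpow P (a + Z.of_nat (Z.to_nat (b - a))) ^ k * (zpow P a ^ k' *
        Cseries (fun i => kap i (i + Z.to_nat (b - a)) * f (a - Z.of_nat i)%Z))) by ring.
    apply H2.
Qed.

Lemma schwartz_bounded (l : nat) (f : Z -> C) : schwartz f -> bounded (dqn l f).
Proof. intros H. apply decreasing_bounded, H. Qed.

Lemma dqn_qshift (f : Z -> C) (l : nat) (a b : Z) :
  schwartz f -> dqn l (qshift f a) b = qshift (dqn l f) (a - Z.of_nat l) b.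
Proof.
  revert f a b. induction l as [|l IH]; intros f a b Hf.
  - simpl. f_equal. lia.
  - rewrite !dqn_S. rewrite (dqn_ext l _ (qshift (dq f) (a - 1))).
    + rewrite IH by now apply schwartz_dq. f_equal. lia.
    + intros m. apply dq_qshift; [exact (schwartz_bounded 0 f Hf)|exact (schwartz_bounded 1 f Hf)].
Qed.

(** The derivative in [xi] is obtained from the one in [s] by symmetry. *)
Lemma dqn_qshift_l (f : Z -> C) (l : nat) (a b : Z) :
  schwartz f ->
  dqn l (fun a => qshift f a b) a = qshift (dqn l f) a (b - Z.of_nat l).
Proof.
  intros Hf. rewrite (dqn_ext l _ (qshift f b)).
  - rewrite dqn_qshift by exact Hf. apply qshift_sym, schwartz_bounded, Hf.
  - intros m. apply qshift_sym, (schwartz_bounded 0 f Hf).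
Qed.

Lemma qshift_decreasing_l (f : Z -> C) (b : Z) :
  decreasing f -> decreasing (fun a => qshift f a b).
Proof.
  intros Hf k. destruct (qshift_decreasing f 0 k Hf) as [c Hc]. exists c.
  intros a. specialize (Hc a b). simpl in Hc. now rewrite Cmult_1_l in Hc.
Qed.

Lemma qshift_schwartz_l (f : Z -> C) (b : Z) :
  schwartz f -> schwartz (fun a => qshift f a b).
Proof.
  intros Hf l k.
  destruct (qshift_decreasing_l (dqn l f) (b - Z.of_nat l) (Hf l) k) as [c Hc].
  exists c. intros m. rewrite dqn_qshift_l by exact Hf. apply Hc.
Qed.

(** * The moment of the q-shift *)

(** A function of [b]; the variable [a] of the q-shift has been integrated out. *)
Definition partial_moment (x : C) (f : Z -> C) (b : Z) : C := moment x (fun a => qshift f a b).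

Lemma partial_moment_decreasing (x : C) (f : Z -> C) :
  (0 < Cmod x < 1)%R -> decreasing f -> decreasing (partial_moment x f).
Proof.
  intros Hx Hf j. destruct (moment_le x Hx) as [k [K [HK HM]]].
  destruct (qshift_decreasing f j 0 Hf) as [c0 H0].
  destruct (qshift_decreasing f j k Hf) as [c1 H1].
  exists (K * Rmax c0 c1)%R. intros b. unfold partial_moment.
  rewrite <- (moment_scal x _ _ Hx (qshift_decreasing_l f b Hf)).
  apply HM; intros a.
  - eapply Rle_trans; [|apply Rmax_l]. specialize (H0 a b). simpl in H0.
    now rewrite Cmult_1_l in H0.
  - eapply Rle_trans; [apply H1|apply Rmax_r].
Qed.

(** The derivative shifts [a] by one, and the moment sees that shift as the
    factor [x]. *)
Lemma dq_partial_moment (x : C) (f : Z -> C) (b : Z) :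
  (0 < Cmod x < 1)%R -> schwartz f ->
  dq (partial_moment x f) b = x * partial_moment x (dq f) b.
Proof.
  intros Hx Hf. assert (HP := P_neq0).
  assert (D := schwartz_decreasing f Hf).
  unfold dq at 1, partial_moment.
  transitivity (moment x (fun a => / zpow P b * qshift f a b + - / zpow P b * qshift f a (b + 1)%Z)).
  - rewrite moment_lincomb by (try apply qshift_decreasing_l; assumption).
    field. now apply zpow_neq0.
  - rewrite (moment_ext x _ (fun a => qshift (dq f) (a + -1)%Z b)).
    + rewrite (moment_dilation x (fun a => qshift (dq f) a b)).
      * change (- -1)%Z with 1%Z. now rewrite zpow_1.
      * exact Hx.
      * apply qshift_decreasing_l, (Hf 1%nat).
    + intros a. symmetry. transitivity (dq (qshift f a) b).
      * symmetry. apply dq_qshift; [exact (schwartz_bounded 0 f Hf)|exact (schwartz_bounded 1 f Hf)].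
      * unfold dq. field. now apply zpow_neq0.
Qed.

Lemma dqn_partial_moment (x : C) (f : Z -> C) (l : nat) (b : Z) :
  (0 < Cmod x < 1)%R -> schwartz f ->
  dqn l (partial_moment x f) b = x ^ l * partial_moment x (dqn l f) b.
Proof.
  intros Hx. revert f b. induction l as [|l IH]; intros f b Hf.
  - simpl. ring.
  - rewrite !dqn_S.
    rewrite (dqn_ext l _ (fun b => x * partial_moment x (dq f) b))
      by (intros; now apply dq_partial_moment).
    rewrite dqn_scal, IH by now apply schwartz_dq. simpl. ring.
Qed.

Lemma partial_moment_schwartz (x : C) (f : Z -> C) :
  (0 < Cmod x < 1)%R -> schwartz f -> schwartz (partial_moment x f).
Proof.
  intros Hx Hf l k.
  destruct (partial_moment_decreasing x (dqn l f) Hx (Hf l) k) as [c Hc].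
  exists (Cmod (x ^ l) * c)%R. intros m. rewrite dqn_partial_moment by assumption.
  replace (zpow P m ^ k * (x ^ l * partial_moment x (dqn l f) m))
    with (x ^ l * (zpow P m ^ k * partial_moment x (dqn l f) m)) by ring.
  rewrite Cmod_mult. apply Rmult_le_compat_l; [apply Cmod_ge_0|apply Hc].
Qed.

(** For fixed [i], summing the kernel over [a] is Euler's identity
    [sum_j y ^ j / (p; p)_j = 1 / (y; p)_oo]. *)
Lemma partial_moment_explicit (x : C) (f : Z -> C) (b : Z) :
  (0 < Cmod x < 1)%R -> decreasing f ->
  poch_inf x * partial_moment x f b
  = poch_inf P * Cseries (fun i => qbinom_coef x i
                    * (zpow x (b - Z.of_nat i) * f (b - Z.of_nat i)%Z)).
Proof.
  intros Hx Hf. assert (Hx0 : x <> 0) by (apply Cmod_gt_0; lra).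
  assert (Hb := decreasing_bounded f Hf).
  assert (Hpi : (0 < Cmod (poch_inf P))%R) by (apply Cmod_gt_0, poch_inf_P_neq0).
  assert (S0 := zsummable_down _ b (moment_summable x f Hx Hf)).
  assert (Px : forall i, (Cmod (x * P ^ i) < 1)%R).
  { intros i. rewrite Cmod_mult, Cmod_Ppow. generalize (ppow_le_1 i). nra. }
  set (g := fun i : nat => zpow x (b - Z.of_nat i) * f (b - Z.of_nat i)%Z) in *.
  set (v := fun i j => zpow x j * kapz i j).
  assert (Vn : forall i n, v i (Z.of_nat n) = poch_inf P / poch P i
                 * (qbinom_coef 0 n * (x * P ^ i) ^ n)).
  { intros i n. unfold v, qbinom_coef. rewrite kapz_nat, zpow_nat. unfold kap.
    replace (poch 0 n) with (RtoC 1)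
      by (induction n as [|n IH]; simpl; [|rewrite <- IH]; ring).
    rewrite Cpow_mult_l, <- Cpow_mult_r. field. split; apply poch_P_neq0. }
  assert (Vm : forall i n, v i (- Z.of_nat (S n))%Z = 0).
  { intros i n. unfold v. rewrite kapz_neg by lia. ring. }
  assert (Sv : forall i, zsummable (v i)).
  { intros i. split.
    - apply (summable_ext (fun n => poch_inf P / poch P i * (qbinom_coef 0 n * (x * P ^ i) ^ n))).
      + intros n. now rewrite Vn.
      + apply summable_scal, qbinom_summable, Px.
    - apply (summable_ext (fun n => 0 * euler_coef n * x ^ n)).
      + intros n. rewrite Vm. ring.
      + apply (summable_ext (fun n => 0 * (euler_coef n * x ^ n))); [intros; ring|].
        apply summable_scal, euler_summable. }
  assert (Ev : forall i, poch_inf x * zsum (v i) = poch_inf P * qbinom_coef x i).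
  { intros i. unfold zsum.
    rewrite (Cseries_0 (fun n => v i (- Z.of_nat (S n))%Z)) by (intros; apply Vm).
    rewrite (Cseries_ext _ _ (Vn i)), Cseries_scal by apply qbinom_summable, Px.
    rewrite (poch_inf_split x i). unfold qbinom_coef at 2.
    transitivity (poch x i * poch_inf P / poch P i * (poch_inf (x * P ^ i)
        * Cseries (fun j => qbinom_coef 0 j * (x * P ^ i) ^ j))).
    - field. apply poch_P_neq0.
    - rewrite (qbinomial 0 _ (Px i)).
      replace (0 * (x * P ^ i)) with (RtoC 0) by ring.
      rewrite poch_inf_0. field. apply poch_P_neq0. }
  set (K := Series (fun n => Cmod (qbinom_coef 0 n * x ^ n))).
  assert (Av : forall i, (zabs (v i) <= K)%R).
  { intros i. unfold zabs.
    rewrite (Series_ext (fun n => Cmod (v i (- Z.of_nat (S n))%Z)) (fun n => 0 * 0 ^ n)%R)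
      by (intros; rewrite Vm, Cmod_0; ring).
    rewrite Series_scal_geom by lra. unfold Rdiv. rewrite Rmult_0_l, Rplus_0_r.
    apply Series_le; [|apply qbinom_summable; lra].
    intros n. split; [apply Cmod_ge_0|].
    rewrite Vn, !Cmod_mult, !Cmod_pow, Cmod_mult, Cmod_Ppow.
    rewrite Cmod_div by apply poch_P_neq0.
    assert (A := Cmod_poch_P_ge i).
    assert (B : (Cmod (poch_inf P) / Cmod (poch P i) <= 1)%R).
    { apply (Rmult_le_reg_r (Cmod (poch P i))); [lra|].
      unfold Rdiv. rewrite Rmult_assoc, Rinv_l by lra. lra. }
    assert (B0 : (0 <= Cmod (poch_inf P) / Cmod (poch P i))%R)
      by (apply Rmult_le_pos; [|apply Rlt_le, Rinv_0_lt_compat]; lra).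
    assert (D : ((Cmod x * p ^ i) ^ n <= Cmod x ^ n)%R).
    { apply pow_incr. generalize (ppow_le_1 i) (Cmod_ge_0 x). nra. }
    assert (D0 : (0 <= (Cmod x * p ^ i) ^ n)%R).
    { apply pow_le, Rmult_le_pos; [apply Cmod_ge_0|apply pow_le; lra]. }
    assert (Q := Cmod_ge_0 (qbinom_coef 0 n)).
    apply (Rle_trans _ (1 * (Cmod (qbinom_coef 0 n) * (Cmod x * p ^ i) ^ n))%R).
    - apply Rmult_le_compat_r; [now apply Rmult_le_pos|exact B].
    - rewrite Rmult_1_l. now apply Rmult_le_compat_l. }
  set (u := fun (i : nat) (a : Z) => zpow x a * (kapz i (Z.of_nat i + (a - b)) * f (b - Z.of_nat i)%Z)).
  assert (Eu : forall i a, u i a = g i * v i (a + (Z.of_nat i - b))%Z).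
  { intros i a. unfold u, g, v.
    replace (zpow x a) with (zpow x (b - Z.of_nat i) * zpow x (a + (Z.of_nat i - b))).
    - replace (Z.of_nat i + (a - b))%Z with (a + (Z.of_nat i - b))%Z by lia. ring.
    - rewrite <- (zpow_add x _ _ Hx0). f_equal. lia. }
  assert (Su : forall i, zsummable (u i)).
  { intros i. apply (zsummable_ext _ _ (fun a => eq_sym (Eu i a))).
    apply zsummable_scal, zsum_shift, Sv. }
  transitivity (poch_inf x * zsum (fun a => Cseries (fun i => u i a))).
  { f_equal. unfold partial_moment, moment. apply zsum_ext. intros a.
    rewrite qshift_kernel by exact Hb. rewrite <- Cseries_scal; [reflexivity|].
    (* the terms [u i a] are dominated by [K * Cmod (g i)], uniformly in [a] *)
    apply (summable_ext (fun i => / zpow x a * u i a)).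
    { intros i. unfold u. field. now apply zpow_neq0. }
    apply summable_scal.
    apply (summable_le _ (fun i => Cmod (g i) * K)%R); [|apply (ex_series_scal_r K), S0].
    intros i. rewrite Eu, Cmod_mult. apply Rmult_le_compat_l; [apply Cmod_ge_0|].
    eapply Rle_trans; [|apply (Av i)]. now apply zabs_term_le. }
  rewrite (zfubini u (fun i => Cmod (g i) * K)%R Su).
  - rewrite <- !Cseries_scal.
    + apply Cseries_ext. intros i.
      rewrite (zsum_ext _ _ (Eu i)), zsum_scal by apply zsum_shift, Sv.
      rewrite (proj2 (zsum_shift _ _ (Sv i))).
      transitivity (g i * (poch_inf x * zsum (v i))); [ring|]. rewrite Ev. unfold g. ring.
    +
      (* up to a constant the coefficients are the sums over [j], bounded by [K] *)
      apply (summable_ext (fun i => / poch_inf P * poch_inf x * (zsum (v i) * g i))).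
      { intros i. transitivity (/ poch_inf P * (poch_inf x * zsum (v i)) * g i); [ring|].
        rewrite Ev. unfold g. field. apply poch_inf_P_neq0. }
      apply summable_scal.
      apply (summable_le _ (fun i => K * Cmod (g i))%R); [|apply (ex_series_scal K (fun i => Cmod (g i))), S0].
      intros i. rewrite Cmod_mult. apply Rmult_le_compat_r; [apply Cmod_ge_0|].
      eapply Rle_trans; [|apply (Av i)]. apply Cmod_zsum_le, Sv.
    + apply (summable_le _ (fun i => Cmod (g i) * K)%R); [|apply (ex_series_scal_r K), S0].
      intros i. rewrite (zsum_ext _ _ (Eu i)), zsum_scal by apply zsum_shift, Sv.
      rewrite (proj2 (zsum_shift _ _ (Sv i))), Cmod_mult.
      apply Rmult_le_compat_l; [apply Cmod_ge_0|].
      eapply Rle_trans; [|apply (Av i)]. apply Cmod_zsum_le, Sv.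
  - intros i. rewrite (zabs_ext _ _ (Eu i)), zabs_scal, zabs_shift by apply Sv.
    apply Rmult_le_compat_l; [apply Cmod_ge_0|apply Av].
  - apply (ex_series_scal_r K), S0.
Qed.

(** * The semigroup law *)

(** After [partial_moment_explicit] the double sum separates: the sum over [b]
    gives the moment for [x y], and the remaining sum over [i] is the q-binomial
    series. *)
Lemma moment_partial_moment (x y : C) (f : Z -> C) :
  (0 < Cmod x < 1)%R -> (0 < Cmod y < 1)%R -> decreasing f ->
  poch_inf x * poch_inf y * moment y (partial_moment x f)
  = poch_inf P * poch_inf (x * y) * moment (x * y) f.
Proof.
  intros Hx Hy Hf.
  assert (Hx0 : x <> 0) by (apply Cmod_gt_0; lra).
  assert (Hy0 : y <> 0) by (apply Cmod_gt_0; lra).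
  assert (Hxy : (0 < Cmod (x * y) < 1)%R).
  { rewrite Cmod_mult. split; [apply Rmult_lt_0_compat|]; nra. }
  assert (HPi := poch_inf_P_neq0).
  set (w := fun i => qbinom_coef x i * y ^ i).
  set (h := fun m => zpow (x * y) m * f m).
  assert (Sw : summable w) by (apply qbinom_summable; lra).
  assert (Sh : zsummable h) by (apply moment_summable; assumption).
  set (s := fun b : Z => Cseries (fun i => qbinom_coef x i
                    * (zpow x (b - Z.of_nat i) * f (b - Z.of_nat i)%Z))).
  assert (Es : forall b, s b = poch_inf x / poch_inf P * partial_moment x f b).
  { intros b. unfold s.
    transitivity (/ poch_inf P * (poch_inf x * partial_moment x f b)).
    - rewrite partial_moment_explicit by assumption. now field.
    - unfold Cdiv. ring. }
  set (u := fun (i : nat) (b : Z) => w i * h (b + - Z.of_nat i)%Z).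
  assert (Eu : forall i b, zpow y b * (qbinom_coef x i
                    * (zpow x (b - Z.of_nat i) * f (b - Z.of_nat i)%Z)) = u i b).
  { intros i b. unfold u, w, h. fold (b - Z.of_nat i)%Z.
    rewrite zpow_mult_base by assumption.
    rewrite (zpow_sub y b _ Hy0), zpow_nat. field. now apply Cpow_nz. }
  assert (Eb : ex_series (fun i => Cmod (w i) * zabs h)%R)
    by (apply (ex_series_scal_r (zabs h)), Sw).
  assert (E : moment y s = poch_inf (x * y) / poch_inf y * moment (x * y) f).
  { transitivity (zsum (fun b => Cseries (fun i => u i b))).
    - apply zsum_ext. intros b. unfold s. rewrite <- Cseries_scal.
      + apply Cseries_ext. intros i. apply Eu.
      + apply (summable_ext (fun i => / zpow y b * u i b)).
        { intros i. rewrite <- Eu. field. now apply zpow_neq0. }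
        apply summable_scal, (summable_le _ (fun i => Cmod (w i) * zabs h)%R); [|exact Eb].
        intros i. unfold u. rewrite Cmod_mult.
        apply Rmult_le_compat_l; [apply Cmod_ge_0|]. now apply zabs_term_le.
    - rewrite (zfubini u (fun i => Cmod (w i) * zabs h)%R).
      + transitivity (Cseries (fun i => moment (x * y) f * w i)).
        * apply Cseries_ext. intros i. unfold u.
          rewrite zsum_scal by now apply zsum_shift.
          rewrite (proj2 (zsum_shift _ h Sh)). apply Cmult_comm.
        * rewrite Cseries_scal by exact Sw.
          rewrite <- (qbinomial x y) by lra. fold w.
          field. apply poch_inf_neq0. lra.
      + intros i. now apply zsummable_scal, zsum_shift.
      + intros i. unfold u. rewrite zabs_scal, (zabs_shift _ h Sh). apply Rle_refl.
      + exact Eb. }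
  rewrite (moment_ext y s _ Es) in E.
  rewrite moment_scal in E
    by (try apply partial_moment_decreasing; assumption).
  transitivity (poch_inf P * poch_inf y
    * (poch_inf x / poch_inf P * moment y (partial_moment x f))); [now field|].
  rewrite E. field. apply poch_inf_neq0. lra.
Qed.

Lemma frac_ext (N : nat) (x : C) (f g : Z -> C) :
  (forall m, f m = g m) -> frac N x f = frac N x g.
Proof.
  intros H. unfold frac. f_equal. apply moment_ext. now apply dqn_ext.
Qed.

Lemma frac_scal (N : nat) (x c : C) (f : Z -> C) :
  x <> 0 -> (Cmod (x * P ^ N) < 1)%R -> schwartz f ->
  frac N x (fun m => c * f m) = c * frac N x f.
Proof.
  intros Hx HN Hf. unfold frac.
  rewrite (moment_ext _ _ (fun m => c * dqn N f m)) by (intros; apply dqn_scal).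
  rewrite moment_scal; [unfold Cdiv; ring| |apply Hf].
  split; [now apply Cmod_xP|exact HN].
Qed.

(** The image of a test function under the convolution operator. *)
Definition partial_frac (N : nat) (x : C) (f : Z -> C) (b : Z) : C :=
  frac N x (fun a => qshift f a b).

Lemma partial_frac_eq (N : nat) (x : C) (f : Z -> C) (b : Z) :
  schwartz f ->
  partial_frac N x f b
  = (- x) ^ N * gauss N * (poch_inf (x * P ^ N) / poch_inf P)
    * partial_moment (x * P ^ N) (dqn N f) (b + - Z.of_nat N).
Proof.
  intros Hf. unfold partial_frac, frac. f_equal. apply moment_ext. intros a.
  now apply dqn_qshift_l.
Qed.

Lemma partial_frac_schwartz (N : nat) (x : C) (f : Z -> C) :
  x <> 0 -> (Cmod (x * P ^ N) < 1)%R -> schwartz f -> schwartz (partial_frac N x f).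
Proof.
  intros Hx HN Hf.
  apply (schwartz_ext _ _ (fun b => eq_sym (partial_frac_eq N x f b Hf))).
  apply schwartz_scal. 
  apply (schwartz_dilation (partial_moment (x * P ^ N) (dqn N f))).
  apply partial_moment_schwartz; [|now apply schwartz_dqn].
  split; [now apply Cmod_xP|exact HN].
Qed.

Lemma gauss_add (n m : nat) : gauss (n + m) = gauss n * gauss m * P ^ (n * m).
Proof.
  induction m as [|m IH].
  - rewrite Nat.add_0_r, Nat.mul_0_r. simpl. ring.
  - rewrite Nat.add_succ_r. simpl. rewrite IH.
    replace (n * S m)%nat with (n * m + n)%nat by lia.
    rewrite !Cpow_add_r. ring.
Qed.

(** Both sides reduce, by [N] summations by parts in each variable, to the
    case [|x|, |y| < 1]. *)
Lemma frac_partial_frac (N : nat) (x y : C) (f : Z -> C) :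
  x <> 0 -> y <> 0 -> (Cmod (x * P ^ N) < 1)%R -> (Cmod (y * P ^ N) < 1)%R ->
  schwartz f ->
  frac N y (partial_frac N x f) = frac (N + N) (x * y) f.
Proof.
  intros Hx Hy HNx HNy Hf. assert (HP := P_neq0).
  assert (HPi := poch_inf_P_neq0).
  assert (Hx' : (0 < Cmod (x * P ^ N) < 1)%R) by (split; [now apply Cmod_xP|exact HNx]).
  assert (Hy' : (0 < Cmod (y * P ^ N) < 1)%R) by (split; [now apply Cmod_xP|exact HNy]).
  assert (Hy0 : y * P ^ N <> 0) by (apply Cmod_gt_0; lra).
  assert (Dm : schwartz (partial_moment (x * P ^ N) (dqn N f))).
  { apply partial_moment_schwartz; [exact Hx'|now apply schwartz_dqn]. }
  rewrite (frac_ext N y _ _ (fun b => partial_frac_eq N x f b Hf)).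
  rewrite frac_scal; [|exact Hy|exact HNy|].
  2: { now apply (schwartz_dilation (partial_moment (x * P ^ N) (dqn N f))). }
  unfold frac.
  rewrite (moment_ext _ _ (fun b => zpow P (- Z.of_nat N) ^ N * (x * P ^ N) ^ N
     * partial_moment (x * P ^ N) (dqn (N + N) f) (b + - Z.of_nat N))).
  2: { intros b. rewrite (dqn_dilation (partial_moment (x * P ^ N) (dqn N f))).
       rewrite dqn_partial_moment by (try apply schwartz_dqn; assumption).
       rewrite dqn_add. ring. }
  assert (Dd : decreasing (partial_moment (x * P ^ N) (dqn (N + N) f)))
    by (apply partial_moment_decreasing; [exact Hx'|apply Hf]).
  rewrite moment_scal.
  2: exact Hy'.
  2: { apply (schwartz_dilation (partial_moment (x * P ^ N) (dqn (N + N) f)) (- Z.of_nat N)) with (l := O).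
       apply partial_moment_schwartz; [exact Hx'|now apply schwartz_dqn]. }
  rewrite (moment_dilation (y * P ^ N) (partial_moment (x * P ^ N) (dqn (N + N) f))) by assumption.
  assert (E := moment_partial_moment (x * P ^ N) (y * P ^ N) (dqn (N + N) f) Hx' Hy' (Hf _)).
  replace (x * y * P ^ (N + N)) with (x * P ^ N * (y * P ^ N)) by (rewrite Cpow_add_r; ring).
  set (I := moment (y * P ^ N) (partial_moment (x * P ^ N) (dqn (N + N) f))) in *.
  set (J := moment (x * P ^ N * (y * P ^ N)) (dqn (N + N) f)) in *.
  rewrite zpow_opp_nat, Z.opp_involutive, zpow_nat, gauss_add.
  transitivity ((- x) ^ N * gauss N * / poch_inf P * ((- y) ^ N * gauss N * / poch_inf P)
    * (((/ P) ^ N) ^ N * (x * P ^ N) ^ N * (y * P ^ N) ^ N)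
    * (poch_inf (x * P ^ N) * poch_inf (y * P ^ N) * I)); [unfold Cdiv; ring|].
  rewrite E. rewrite !(Cpow_mult_l _ (P ^ N)), <- !Cpow_mult_r.
  replace ((- (x * y)) ^ (N + N)) with ((- x) ^ N * (- y) ^ N * (x ^ N * y ^ N)).
  2: { rewrite Cpow_add_r, <- !Cpow_mult_l. f_equal. ring. }
  assert (Q := Cpow_inv_cancel P (N * N) HP).
  transitivity ((- x) ^ N * gauss N * ((- y) ^ N * gauss N * / poch_inf P)
    * (x ^ N * y ^ N * P ^ (N * N)) * (P ^ (N * N) * (/ P) ^ (N * N))
    * (poch_inf (x * P ^ N * (y * P ^ N)) * J) * (/ poch_inf P * poch_inf P)); [ring|].
  rewrite Q, Cinv_l by exact HPi. unfold Cdiv. ring.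
Qed.

(** * Taylor expansion at zero and the regularized integral *)

Definition at_inf (f : Z -> C) : C := Clim_seq (fun m => f (Z.of_nat m)).

(** The coefficient of [s ^ k]; for [s = p ^ m] the origin is [m = +oo]. *)
Definition taylor (f : Z -> C) (k : nat) : C := at_inf (dqn k f) / poch P k.

Definition remainder (N : nat) (f : Z -> C) (m : nat) : C :=
  f (Z.of_nat m) - csum (fun k => taylor f k * (P ^ m) ^ k) N.

Lemma schwartz_diff (f : Z -> C) :
  schwartz f -> exists c, forall m : nat,
  (Cmod (f (Z.of_nat m) - f (Z.of_nat (S m))) <= c * p ^ m)%R.
Proof.
  intros Hf. destruct (Hf 1%nat O) as [c Hc]. exists c. intros m.
  specialize (Hc (Z.of_nat m)). simpl in Hc. rewrite Cmult_1_l in Hc.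
  unfold dq in Hc. rewrite zpow_nat in Hc.
  assert (HPm : P ^ m <> 0) by apply Cpow_nz, P_neq0.
  replace (f (Z.of_nat m) - f (Z.of_nat (S m)))
    with ((f (Z.of_nat m) - f (Z.of_nat m + 1)%Z) / P ^ m * P ^ m).
  - rewrite Cmod_mult, Cmod_Ppow.
    apply Rmult_le_compat_r; [apply pow_le; lra|exact Hc].
  - replace (Z.of_nat (S m)) with (Z.of_nat m + 1)%Z by lia. now field.
Qed.

Lemma at_inf_tends (f : Z -> C) :
  schwartz f -> tends eventually (fun m => f (Z.of_nat m)) (at_inf f).
Proof.
  intros Hf. destruct (schwartz_diff f Hf) as [c Hc].
  set (u := fun m => f (Z.of_nat m) - f (Z.of_nat (S m))).
  assert (S1 : summable u).
  { apply (summable_le _ (fun m => c * p ^ m)%R); [exact Hc|].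
    apply ex_series_scal_geom. lra. }
  assert (E : tends eventually (fun m => f (Z.of_nat m)) (f 0%Z - Cseries u)).
  { apply (tends_ext eventually (fun m => f 0%Z - csum u m)).
    - intros m. induction m as [|m IH]; [simpl; ring|].
      change (csum u (S m)) with (csum u m + u m).
      replace (f 0%Z - (csum u m + u m)) with ((f 0%Z - csum u m) - u m) by ring.
      rewrite IH. unfold u. ring.
    - apply tends_minus; [apply eventually_filter|apply tends_const, eventually_filter|].
      now apply summable_tends. }
  replace (at_inf f) with (f 0%Z - Cseries u); [exact E|].
  symmetry. now apply Clim_seq_tends.
Qed.

(** A null sequence is bounded by the tail of the series of its differences. *)
Lemma le_geom_of_diff (u : nat -> C) (c r : R) :
  (0 <= r < 1)%R -> tends eventually u 0 ->
  (forall m, Cmod (u m - u (S m)) <= c * r ^ m)%R ->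
  forall m, (Cmod (u m) <= c / (1 - r) * r ^ m)%R.
Proof.
  intros Hr Hu Hd m.
  assert (Hc : (0 <= c)%R).
  { specialize (Hd O). simpl in Hd. generalize (Cmod_ge_0 (u O - u 1%nat)). lra. }
  assert (A : forall n, (Cmod (u m - u (m + n)%nat) <= c / (1 - r) * r ^ m * (1 - r ^ n))%R).
  { induction n as [|n IH].
    - rewrite Nat.add_0_r. replace (u m - u m) with (RtoC 0) by ring.
      rewrite Cmod_0. simpl. lra.
    - replace (u m - u (m + S n)%nat)
        with ((u m - u (m + n)%nat) + (u (m + n)%nat - u (S (m + n))))
        by (rewrite Nat.add_succ_r; ring).
      eapply Rle_trans; [apply Cmod_triangle|].
      specialize (Hd (m + n)%nat). rewrite pow_add in Hd.
      replace (c / (1 - r) * r ^ m * (1 - r ^ S n))%R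
        with (c / (1 - r) * r ^ m * (1 - r ^ n) + c * (r ^ m * r ^ n))%R
        by (simpl; field; lra).
      lra. }
  assert (Hrm : (0 <= c / (1 - r) * r ^ m)%R).
  { apply Rmult_le_pos; [|apply pow_le; lra].
    apply Rmult_le_pos; [exact Hc|apply Rlt_le, Rinv_0_lt_compat; lra]. }
  refine (tends_le eventually (fun n => u m - u (m + n)%nat) _ _ _ _).
  - replace (u m) with (u m - 0) at 1 by ring.
    apply tends_minus; [apply eventually_filter|apply tends_const, eventually_filter|].
    intros eps He. destruct (Hu eps He) as [N HN]. exists N. intros n Hn.
    apply HN. lia.
  - intros n. eapply Rle_trans; [apply A|].
    assert (0 <= r ^ n)%R by (apply pow_le; lra). nra.
Qed.

Lemma taylor_dq (f : Z -> C) (k : nat) :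
  taylor (dq f) k = (1 - P ^ S k) * taylor f (S k).
Proof.
  unfold taylor. rewrite dqn_S, poch_S. field.
  split; [apply one_sub_Ppow|apply poch_P_neq0].
Qed.

Lemma remainder_diff (N : nat) (f : Z -> C) (m : nat) :
  remainder (S N) f m - remainder (S N) f (S m) = P ^ m * remainder N (dq f) m.
Proof.
  unfold remainder.
  transitivity ((f (Z.of_nat m) - f (Z.of_nat (S m)))
    - csum (fun k => taylor f k * (P ^ m) ^ k - taylor f k * (P ^ S m) ^ k) (S N)).
  { rewrite csum_minus. ring. }
  replace (P ^ m * (dq f (Z.of_nat m) - csum (fun k => taylor (dq f) k * (P ^ m) ^ k) N))
    with (P ^ m * dq f (Z.of_nat m)
          - P ^ m * csum (fun k => taylor (dq f) k * (P ^ m) ^ k) N) by ring.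
  rewrite csum_first, <- csum_scal.
  f_equal.
  - unfold dq. rewrite zpow_nat.
    replace (Z.of_nat (S m)) with (Z.of_nat m + 1)%Z by lia.
    field. apply Cpow_nz, P_neq0.
  - transitivity (csum (fun i => taylor f (S i) * (P ^ m) ^ S i - taylor f (S i) * (P ^ S m) ^ S i) N).
    + simpl. ring.
    + apply csum_ext. intros i _. rewrite taylor_dq, (Cpow_S P m), Cpow_mult_l.
      rewrite (Cpow_S (P ^ m)). ring.
Qed.

(** Taylor's formula: the remainder of order [N] tends to zero and its
    difference is [p ^ m] times the remainder of order [N - 1] of the
    derivative. *)
Lemma remainder_le (N : nat) (f : Z -> C) :
  schwartz f -> exists c, forall m, (Cmod (remainder N f m) <= c * (p ^ N) ^ m)%R.
Proof.
  revert f. induction N as [|N IH]; intros f Hf.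
  - destruct (Hf O O) as [c Hc]. exists c. intros m.
    specialize (Hc (Z.of_nat m)). simpl in Hc. rewrite Cmult_1_l in Hc.
    unfold remainder. simpl. rewrite pow1, Rmult_1_r.
    now replace (f (Z.of_nat m) - 0) with (f (Z.of_nat m)) by ring.
  - destruct (IH (dq f) (schwartz_dq f Hf)) as [c Hc].
    assert (Hr : (0 <= p ^ S N < 1)%R).
    { split; [apply pow_le; lra|]. simpl. generalize (ppow_le_1 N). nra. }
    exists (c / (1 - p ^ S N))%R. apply le_geom_of_diff; [exact Hr| |].
    + unfold remainder.
      set (l := fun k : nat => match k with O => at_inf f | S _ => 0 end).
      replace (RtoC 0) with (at_inf f - csum l (S N)).
      2: { rewrite csum_first, csum_zero by reflexivity. simpl. ring. }
      apply tends_minus; [apply eventually_filter|now apply at_inf_tends|].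
      apply tends_csum; [apply eventually_filter|]. intros [|k].
      * apply (tends_ext eventually (fun _ => at_inf f)); [|apply tends_const, eventually_filter].
        intros m. unfold taylor. simpl. field.
      * simpl l. replace (RtoC 0) with (taylor f (S k) * 0 ^ S k) by (simpl; ring).
        apply tends_mult; [apply eventually_filter|apply tends_const, eventually_filter|].
        apply tends_pow; [apply eventually_filter|apply tends_Ppow].
    + intros m. rewrite remainder_diff, Cmod_mult, Cmod_Ppow.
      replace (c * (p ^ S N) ^ m)%R with (p ^ m * (c * (p ^ N) ^ m))%R
        by (simpl; rewrite Rpow_mult_distr; ring).
      apply Rmult_le_compat_l; [apply pow_le; lra|apply Hc].
Qed.

(** Up to the factor [1 - p], the continuation of [s_+ ^ (nu - 1)] by subtraction
    of a Taylor polynomial with [N] terms, where [x = p ^ nu]. *)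
Definition reg (N : nat) (x : C) (f : Z -> C) : C :=
  Cseries (fun m => x ^ m * remainder N f m)
  + Cseries (fun n => zpow x (- Z.of_nat (S n)) * f (- Z.of_nat (S n))%Z)
  + csum (fun k => taylor f k / (1 - x * P ^ k)) N.

Lemma remainder_summable (N : nat) (x : C) (f : Z -> C) :
  schwartz f -> (Cmod (x * P ^ N) < 1)%R -> summable (fun m => x ^ m * remainder N f m).
Proof.
  intros Hf HN. destruct (remainder_le N f Hf) as [c Hc].
  apply (summable_le _ (fun m => c * (Cmod (x * P ^ N)) ^ m)%R).
  - intros m. rewrite Cmod_mult, Cmod_pow, Cmod_mult, Cmod_Ppow, Rpow_mult_distr.
    replace (c * (Cmod x ^ m * (p ^ N) ^ m))%R with (Cmod x ^ m * (c * (p ^ N) ^ m))%R by ring.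
    apply Rmult_le_compat_l; [apply pow_le, Cmod_ge_0|apply Hc].
  - apply ex_series_scal_geom. split; [apply Cmod_ge_0|exact HN].
Qed.

Lemma negative_part_summable (x : C) (f : Z -> C) :
  x <> 0 -> decreasing f ->
  summable (fun n => zpow x (- Z.of_nat (S n)) * f (- Z.of_nat (S n))%Z).
Proof.
  intros Hx Hf. apply Cmod_gt_0 in Hx.
  destruct (moment_majorant (Cmod x) (Cmod x) Hx) as [k Hk].
  destruct (decreasing_two_bounds f k Hf) as [c [H0 H1]].
  specialize (Hk x f c ltac:(lra) H0 H1).
  apply (summable_le _ (fun n => c * p ^ n)%R); [apply Hk|].
  apply ex_series_scal_geom. lra.
Qed.

Lemma Cseries_parts (x : C) (u : nat -> C) :
  x <> 0 -> summable (fun m => x ^ m * u m) ->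
  Cseries (fun m => x ^ m * (u m - u (S m)))
  = (1 - / x) * Cseries (fun m => x ^ m * u m) + u O / x.
Proof.
  intros Hx Hs.
  assert (Hs1 := proj1 (summable_shift _ 1) Hs). simpl in Hs1.
  rewrite (Cseries_ext _ (fun m => x ^ m * u m - / x * (x ^ S m * u (S m)))).
  2: { intros m. rewrite Cpow_S. now field. }
  rewrite Cseries_minus; [|exact Hs|now apply summable_scal].
  rewrite Cseries_scal by exact Hs1.
  rewrite (Cseries_first _ Hs). simpl. field. exact Hx.
Qed.

Lemma Cseries_parts_neg (x : C) (f : Z -> C) :
  x <> 0 -> summable (fun n => zpow x (- Z.of_nat (S n)) * f (- Z.of_nat (S n))%Z) ->
  Cseries (fun n => zpow x (- Z.of_nat (S n))
             * (f (- Z.of_nat (S n))%Z - f (- Z.of_nat (S n) + 1)%Z))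
  = (1 - / x) * Cseries (fun n => zpow x (- Z.of_nat (S n)) * f (- Z.of_nat (S n))%Z)
    - f 0%Z / x.
Proof.
  intros Hx Hs.
  set (v := fun n => zpow x (- Z.of_nat n) * f (- Z.of_nat n)%Z).
  assert (Sv : summable v) by (apply (summable_shift _ 1); exact Hs).
  rewrite (Cseries_ext _ (fun n => v (S n) - / x * v n)).
  2: { intros n. unfold v. rewrite !zpow_opp_nat, Cpow_S.
       replace (- Z.of_nat (S n) + 1)%Z with (- Z.of_nat n)%Z by lia. ring. }
  rewrite Cseries_minus; [|exact Hs|now apply summable_scal].
  rewrite Cseries_scal, (Cseries_first v) by exact Sv.
  change (fun n => v (S n)) with (fun n => zpow x (- Z.of_nat (S n)) * f (- Z.of_nat (S n))%Z).
  replace (v O) with (f 0%Z) by (unfold v; rewrite zpow_opp_nat; simpl; ring).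
  field. exact Hx.
Qed.

(** Summation by parts for the regularized integral: the boundary terms at
    [s = 1] of the two series are absorbed by the finite sum. *)
Lemma reg_dq (N : nat) (x : C) (f : Z -> C) :
  x <> 0 -> (Cmod (x * P ^ S N) < 1)%R -> (forall k, x * P ^ k <> 1) -> schwartz f ->
  reg N (x * P) (dq f) = (1 - / x) * reg (S N) x f.
Proof.
  intros Hx HN Hk Hf. unfold reg. assert (HP := P_neq0).
  rewrite (Cseries_ext (fun m => (x * P) ^ m * remainder N (dq f) m)
             (fun m => x ^ m * (remainder (S N) f m - remainder (S N) f (S m)))).
  2: { intros m. rewrite remainder_diff, Cpow_mult_l. ring. }
  rewrite Cseries_parts by (try apply remainder_summable; assumption).
  rewrite (Cseries_ext (fun n => zpow (x * P) (- Z.of_nat (S n)) * dq f (- Z.of_nat (S n))%Z)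
             (fun n => zpow x (- Z.of_nat (S n))
               * (f (- Z.of_nat (S n))%Z - f (- Z.of_nat (S n) + 1)%Z))).
  2: { intros n. rewrite zpow_mult_base by assumption. unfold dq. field.
       now apply zpow_neq0. }
  rewrite Cseries_parts_neg; [|exact Hx|apply negative_part_summable; [exact Hx|exact (Hf O)]].
  assert (E : remainder (S N) f 0 / x - f 0%Z / x
     + csum (fun k => taylor (dq f) k / (1 - x * P * P ^ k)) N
     = (1 - / x) * csum (fun k => taylor f k / (1 - x * P ^ k)) (S N)).
  { transitivity (csum (fun k => (1 - P ^ k) * taylor f k / (1 - x * P ^ k)
                           - / x * taylor f k) (S N)).
    - rewrite csum_minus, csum_scal, csum_first. unfold remainder.
      rewrite (csum_ext (fun k => taylor f k * (P ^ 0) ^ k) (taylor f))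
        by (intros k _; simpl; rewrite Cpow_1_l; ring).
      rewrite (csum_ext (fun k => taylor (dq f) k / (1 - x * P * P ^ k))
        (fun i => (1 - P ^ S i) * taylor f (S i) / (1 - x * P ^ S i))).
      2: { intros k _. rewrite taylor_dq, Cpow_S, Cmult_assoc. reflexivity. }
      change (Z.of_nat 0) with 0%Z. simpl (P ^ 0). unfold Cdiv. ring.
    - rewrite <- csum_scal. apply csum_ext. intros k _. field.
      split; [apply C1_sub_neq0, Hk|exact Hx]. }
  set (A := Cseries (fun m => x ^ m * remainder (S N) f m)) in *.
  set (B := Cseries (fun n => zpow x (- Z.of_nat (S n)) * f (- Z.of_nat (S n))%Z)) in *.
  transitivity ((1 - / x) * A + (1 - / x) * B + (remainder (S N) f 0 / x - f 0%Z / x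
     + csum (fun k => taylor (dq f) k / (1 - x * P * P ^ k)) N)); [ring|].
  rewrite E. ring.
Qed.

(** The two continuations satisfy the same relation between orders [N] and
    [N + 1], and agree for [N = 0]. *)
Lemma reg_frac (N : nat) (x : C) (f : Z -> C) :
  x <> 0 -> (Cmod (x * P ^ N) < 1)%R -> (forall k, x * P ^ k <> 1) -> schwartz f ->
  poch_inf x * reg N x f = poch_inf P * frac N x f.
Proof.
  assert (HPi := poch_inf_P_neq0). assert (HP := P_neq0).
  revert x f. induction N as [|N IH]; intros x f Hx HN Hk Hf.
  - unfold reg, frac, moment, zsum. simpl.
    rewrite (Cseries_ext (fun m => x ^ m * remainder 0 f m)
               (fun n => zpow (x * 1) (Z.of_nat n) * f (Z.of_nat n))).
    2: { intros m. rewrite zpow_nat, Cmult_1_r. unfold remainder. simpl. ring. }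
    rewrite Cmult_1_r. field. exact HPi.
  - assert (IH' := IH (x * P) (dq f)).
    rewrite reg_dq in IH' by assumption.
    rewrite (poch_inf_split x 1).
    transitivity (- x * (poch_inf (x * P) * ((1 - / x) * reg (S N) x f))).
    + simpl. rewrite !Cmult_1_r. field. exact Hx.
    + rewrite IH'.
      * unfold frac. rewrite dqn_S. simpl gauss.
        replace (x * P * P ^ N) with (x * P ^ S N) by (simpl; ring).
        replace ((- (x * P)) ^ N) with ((- x) ^ N * P ^ N)
          by (rewrite <- Cpow_mult_l; f_equal; ring).
        rewrite (Cpow_S (- x)). ring.
      * now apply Cmult_neq_0.
      * replace (x * P * P ^ N) with (x * P ^ S N) by (simpl; ring). exact HN.
      * intros k. rewrite <- Cmult_assoc, <- Cpow_S. apply Hk.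
      * now apply schwartz_dq.
Qed.

(** The values at the poles are obtained from this. *)
Lemma tends_frac {T : Type} (F : (T -> Prop) -> Prop) {FF : Filter F}
  (u : T -> C) (N : nat) (x : C) (f : Z -> C) :
  x <> 0 -> (Cmod (x * P ^ N) < 1)%R -> schwartz f -> tends F u x ->
  tends F (fun t => frac N (u t) f) (frac N x f).
Proof.
  intros Hx HN Hf Hu. unfold frac, Cdiv.
  assert (Hu' : tends F (fun t => u t * P ^ N) (x * P ^ N))
    by (apply tends_mult; [exact FF|exact Hu|now apply tends_const]).
  apply tends_mult; [exact FF| |].
  - apply tends_mult; [exact FF| |].
    + apply tends_mult; [exact FF| |now apply tends_const].
      now apply tends_pow, tends_opp.
    + apply tends_mult; [exact FF| |now apply tends_const].
      now apply tends_poch_inf.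
  - apply tends_moment; [exact FF| |apply Hf|exact Hu'].
    split; [now apply Cmod_xP|exact HN].
Qed.

End Base.

(** * Complex powers of a positive base *)

Lemma Rcpower_plus (a : R) (z w : C) : Rcpower a (z + w) = Rcpower a z * Rcpower a w.
Proof.
  unfold Rcpower. destruct z as [z1 z2], w as [w1 w2]. simpl.
  rewrite !Rmult_plus_distr_r, exp_plus, cos_plus, sin_plus.
  unfold Cmult. simpl. f_equal; ring.
Qed.

Lemma Rcpower_0 (a : R) : Rcpower a 0 = 1.
Proof.
  unfold Rcpower. simpl. rewrite Rmult_0_l, exp_0, cos_0, sin_0. unfold RtoC. f_equal; ring.
Qed.

Lemma Rcpower_1 (a : R) : (0 < a)%R -> Rcpower a 1 = a.
Proof.
  intros Ha. unfold Rcpower. simpl. rewrite Rmult_1_l, Rmult_0_l, exp_ln, cos_0, sin_0 by exact Ha.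
  unfold RtoC. f_equal; ring.
Qed.

Lemma Cmod_Rcpower (a : R) (z : C) : Cmod (Rcpower a z) = exp (Re z * ln a).
Proof.
  unfold Rcpower, Cmod. cbn [fst snd].
  set (e := exp (Re z * ln a)). set (t := (Im z * ln a)%R).
  replace ((e * cos t) ^ 2 + (e * sin t) ^ 2)%R with (e ^ 2 * (Rsqr (sin t) + Rsqr (cos t)))%R
    by (unfold Rsqr; ring).
  rewrite sin2_cos2, Rmult_1_r. apply sqrt_pow2. apply Rlt_le, exp_pos.
Qed.

Lemma Rcpower_neq0 (a : R) (z : C) : Rcpower a z <> 0.
Proof. apply Cmod_gt_0. rewrite Cmod_Rcpower. apply exp_pos. Qed.

Lemma Rcpower_opp (a : R) (z : C) : Rcpower a (- z) = / Rcpower a z.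
Proof.
  assert (H := Rcpower_plus a z (- z)). rewrite Cplus_opp_r, Rcpower_0 in H.
  transitivity (Rcpower a z * Rcpower a (- z) / Rcpower a z).
  - field. apply Rcpower_neq0.
  - rewrite <- H. field. apply Rcpower_neq0.
Qed.

Lemma Rcpower_nat (a : R) (z : C) (n : nat) : Rcpower a (INR n * z) = Rcpower a z ^ n.
Proof.
  induction n as [|n IH].
  - simpl. rewrite Cmult_0_l. apply Rcpower_0.
  - rewrite S_INR, RtoC_plus, Cmult_plus_distr_r, Rcpower_plus, IH, Cmult_1_l. simpl. ring.
Qed.

Lemma Rcpower_Z (a : R) (z : C) (m : Z) : Rcpower a (IZR m * z) = zpow (Rcpower a z) m.
Proof.
  destruct (Z.le_ge_cases 0 m) as [H|H].
  - replace m with (Z.of_nat (Z.to_nat m)) by lia.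
    now rewrite zpow_nat, <- INR_IZR_INZ, Rcpower_nat.
  - replace m with (- Z.of_nat (Z.to_nat (- m)))%Z by lia.
    rewrite opp_IZR, <- INR_IZR_INZ, RtoC_opp.
    replace (- RtoC (INR (Z.to_nat (- m))) * z) with (- (RtoC (INR (Z.to_nat (- m))) * z)) by ring.
    rewrite Rcpower_opp, Rcpower_nat.
    rewrite zpow_opp_nat, Cpow_inv; [reflexivity|apply Rcpower_neq0].
Qed.

Lemma tends_Rcpower (a : R) (z0 : C) :
  tends (locally (T := C_UniformSpace) z0) (Rcpower a) (Rcpower a z0).
Proof.
  apply tends_iff; [apply locally_filter|].
  assert (C1 : continuous (fun z : C_UniformSpace => (Re z * ln a)%R) z0).
  { destruct z0 as [x y].
    apply (continuous_mult (K := R_AbsRing)); [apply continuous_fst|apply continuous_const]. }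
  assert (C2 : continuous (fun z : C_UniformSpace => (Im z * ln a)%R) z0).
  { destruct z0 as [x y].
    apply (continuous_mult (K := R_AbsRing)); [apply continuous_snd|apply continuous_const]. }
  assert (E := continuous_comp _ exp z0 C1 (continuous_exp _)).
  assert (H1 := continuous_mult (K := R_AbsRing) _ _ z0 E (continuous_comp _ cos z0 C2 (continuous_cos _))).
  assert (H2 := continuous_mult (K := R_AbsRing) _ _ z0 E (continuous_comp _ sin z0 C2 (continuous_sin _))).
  apply filterlim_locally. intros eps.
  generalize (filter_and _ _ (proj1 (filterlim_locally _ _) H1 eps)
                             (proj1 (filterlim_locally _ _) H2 eps)).
  apply filter_imp. intros z [A B]. split; [exact A|exact B].
Qed.

Lemma Re_2_mult (z : C) : Re (2 * z) = (2 * Re z)%R.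
Proof. destruct z as [a b]. simpl. ring. Qed.

Lemma Im_2_mult (z : C) : Im (2 * z) = (2 * Im z)%R.
Proof. destruct z as [a b]. simpl. ring. Qed.

Lemma Rabs_Re_le (z : C) : (Rabs (Re z) <= Cmod z)%R.
Proof. eapply Rle_trans; [apply Rmax_l|apply Rmax_Cmod]. Qed.

Lemma Rabs_Im_le (z : C) : (Rabs (Im z) <= Cmod z)%R.
Proof. eapply Rle_trans; [apply Rmax_r|apply Rmax_Cmod]. Qed.

Lemma tends_locally' {T : UniformSpace} (u : T -> C) (z : T) (l : C) :
  tends (locally z) u l -> tends (locally' z) u l.
Proof.
  intros H eps He. generalize (H eps He). unfold locally', within.
  apply filter_imp. auto.
Qed.

#[local] Instance locally'_C_proper (z : C) :
  ProperFilter' (locally' (T := C_UniformSpace) z).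
Proof.
  split; [|apply within_filter, locally_filter].
  intros [eps H]. destruct z as [a b].
  apply (H (a + eps / 2, b)%R).
  - split; simpl; [|apply ball_center].
    change (Rabs (a + eps / 2 - a) < eps)%R.
    replace (a + eps / 2 - a)%R with (eps / 2)%R by ring.
    rewrite Rabs_pos_eq; generalize (cond_pos eps); lra.
  - intros E. injection E. generalize (cond_pos eps). lra.
Qed.

Section Distributions.
Context (q : R) (hq : (0 < q < 1)%R).
Local Notation p := (Rpow_def.pow q 2).
Local Notation P := (RtoC (Rpow_def.pow q 2)).

Lemma q2_bounds : (0 < p < 1)%R.
Proof. simpl. nra. Qed.

Local Notation hp := q2_bounds.

Definition qpow (z : C) : C := Rcpower q (2 * z).

Lemma qpow_plus (z w : C) : qpow (z + w) = qpow z * qpow w.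
Proof. unfold qpow. rewrite Cmult_plus_distr_l. apply Rcpower_plus. Qed.

Lemma qpow_neq0 (z : C) : qpow z <> 0.
Proof. apply Rcpower_neq0. Qed.

Lemma qpow_1 : qpow 1 = P.
Proof.
  unfold qpow. replace (2 * 1) with (1 + 1) by ring.
  rewrite Rcpower_plus, Rcpower_1, <- RtoC_mult by lra. f_equal. ring.
Qed.

Lemma qpow_nat (n : nat) : qpow (INR n) = P ^ n.
Proof.
  unfold qpow. replace (2 * INR n) with (INR n * (2 * 1)) by ring.
  rewrite Rcpower_nat. f_equal. apply qpow_1.
Qed.

Lemma Cmod_qpow_lt1 (z : C) : (0 < Re z)%R -> (Cmod (qpow z) < 1)%R.
Proof.
  intros H. unfold qpow. rewrite Cmod_Rcpower, <- exp_0, Re_2_mult.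
  apply exp_increasing.
  assert (ln q < 0)%R by (rewrite <- ln_1; apply ln_increasing; lra). nra.
Qed.

Lemma tends_qpow (z : C) : tends (locally (T := C_UniformSpace) z) qpow (qpow z).
Proof.
  assert (H : tends (locally (T := C_UniformSpace) z)
     (fun w => Rcpower q w * Rcpower q w) (Rcpower q z * Rcpower q z)).
  { apply tends_mult; [apply locally_filter| |]; apply tends_Rcpower. }
  revert H. unfold qpow.
  replace (Rcpower q (2 * z)) with (Rcpower q z * Rcpower q z)
    by (rewrite <- Rcpower_plus; f_equal; ring).
  apply tends_ext; [apply locally_filter|]. intros w.
  rewrite <- Rcpower_plus. f_equal. ring.
Qed.

(** ** Functions on the two half-lattices *)

Lemma lval_true (m : Z) : RtoC (lval q (true, m)) = zpow P m.
Proof.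
  unfold lval. cbn [fst snd]. rewrite Rmult_1_l.
  destruct (Z.le_ge_cases 0 m) as [H|H].
  - replace m with (Z.of_nat (Z.to_nat m)) by lia. set (n := Z.to_nat m).
    replace (2 * Z.of_nat n)%Z with (Z.of_nat (2 * n)) by lia.
    now rewrite zpow_nat, <- pow_powerRZ, pow_mult, RtoC_pow.
  - replace m with (- Z.of_nat (Z.to_nat (- m)))%Z by lia. set (n := Z.to_nat (- m)).
    replace (2 * - Z.of_nat n)%Z with (- Z.of_nat (2 * n))%Z by lia.
    rewrite powerRZ_neg', zpow_opp_nat, <- pow_powerRZ, pow_mult.
    assert (p ^ n <> 0)%R by (apply pow_nonzero; generalize hp; lra).
    rewrite RtoC_inv, RtoC_pow, Cpow_inv by (try apply (P_neq0 p hp); assumption).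
    reflexivity.
Qed.

Definition sgn (b : bool) : C := if b then 1 else - (1).

Lemma sgn_sq (b : bool) : sgn b * sgn b = 1.
Proof. destruct b; simpl; ring. Qed.

Lemma sgn_neq0 (b : bool) : sgn b <> 0.
Proof. intros E. apply C1_nz. rewrite <- (sgn_sq b), E. ring. Qed.

Lemma sgn_inv (b : bool) : / sgn b = sgn b.
Proof.
  transitivity (/ sgn b * (sgn b * sgn b)); [rewrite sgn_sq; ring|]. field. apply sgn_neq0.
Qed.

Lemma Cmod_sgn_pow (b : bool) (l : nat) : Cmod (sgn b ^ l) = 1%R.
Proof.
  rewrite Cmod_pow. replace (Cmod (sgn b)) with 1%R; [apply pow1|].
  destruct b; simpl; [|rewrite Cmod_opp]; now rewrite Cmod_1.
Qed.

Lemma lval_sgn (b : bool) (m : Z) : RtoC (lval q (b, m)) = sgn b * zpow P m.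
Proof.
  destruct b; [rewrite lval_true; simpl; ring|].
  change (sgn false) with (- RtoC 1). rewrite <- lval_true, <- RtoC_opp, <- RtoC_mult.
  f_equal. unfold lval. cbn [fst snd]. ring.
Qed.

Definition half (b : bool) (psi : lattice -> C) : Z -> C := fun m => psi (b, m).

Lemma one_sub_P_neq0 : 1 - P <> 0.
Proof. generalize (one_sub_Ppow p hp 0). now rewrite Cpow_1_r. Qed.

Lemma qder_n_half (l : nat) (psi : lattice -> C) (b : bool) (m : Z) :
  qder_n q l psi (b, m) = (sgn b / (1 - P)) ^ l * dqn p l (half b psi) m.
Proof.
  revert m. induction l as [|l IH]; intros m.
  - unfold qder_n, half. simpl. ring.
  - change (qder_n q (S l) psi (b, m))
      with ((qder_n q l psi (b, m) - qder_n q l psi (b, m + 1)%Z)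
            / RtoC ((1 - p) * lval q (b, m))).
    rewrite !IH, RtoC_mult, RtoC_minus, lval_sgn.
    change (dqn p (S l) (half b psi) m)
      with ((dqn p l (half b psi) m - dqn p l (half b psi) (m + 1)%Z) / zpow P m).
    rewrite Cpow_S.
    replace (sgn b / (1 - P)) with (/ (sgn b * (1 - P))) at 3.
    + field. repeat split; [apply zpow_neq0, (P_neq0 p hp)|apply one_sub_P_neq0|apply sgn_neq0].
    + rewrite Cinv_mult, sgn_inv by (try apply sgn_neq0; apply one_sub_P_neq0). reflexivity.
Qed.

Lemma Cmod_one_sub_P : Cmod (1 - P) = (1 - p)%R.
Proof. rewrite <- RtoC_minus. apply Cmod_RtoC_pos. generalize hp. lra. Qed.

Lemma dqn_half (l : nat) (psi : lattice -> C) (b : bool) (m : Z) :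
  dqn p l (half b psi) m = (sgn b * (1 - P)) ^ l * qder_n q l psi (b, m).
Proof.
  rewrite qder_n_half, Cmult_assoc, <- Cpow_mult_l.
  replace (sgn b * (1 - P) * (sgn b / (1 - P))) with (RtoC 1).
  - rewrite Cpow_1_l. ring.
  - transitivity (sgn b * sgn b); [now rewrite sgn_sq|]. field. apply one_sub_P_neq0.
Qed.

Lemma half_seminorm (k l : nat) (psi : lattice -> C) (c : R) (b : bool) (m : Z) :
  seminorm_le q k l psi c -> (Cmod (zpow P m ^ k * dqn p l (half b psi) m) <= c)%R.
Proof.
  intros H. specialize (H (b, m)). rewrite dqn_half.
  rewrite RtoC_pow, lval_sgn in H.
  rewrite Cpow_mult_l, <- Cmult_assoc, Cmod_mult, Cmod_sgn_pow, Rmult_1_l in H.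
  replace (zpow P m ^ k * ((sgn b * (1 - P)) ^ l * qder_n q l psi (b, m)))
    with (sgn b ^ l * ((1 - P) ^ l * (zpow P m ^ k * qder_n q l psi (b, m))))
    by (rewrite Cpow_mult_l; ring).
  rewrite Cmod_mult, Cmod_sgn_pow, Rmult_1_l, Cmod_mult, Cmod_pow, Cmod_one_sub_P.
  assert (0 <= (1 - p) ^ l <= 1)%R.
  { generalize hp. intros Hp. split; [apply pow_le; lra|].
    apply (Rle_trans _ (1 ^ l)%R); [apply pow_incr; lra|rewrite pow1; lra]. }
  eapply Rle_trans; [|exact H]. rewrite <- (Rmult_1_l (Cmod _)) at 2.
  apply Rmult_le_compat_r; [apply Cmod_ge_0|lra].
Qed.

Lemma schwartz_half (b : bool) (psi : lattice -> C) :
  qschwartz q psi -> schwartz p (half b psi).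
Proof.
  intros H l k. destruct (H k l) as [c Hc]. exists c. intros m. now apply half_seminorm.
Qed.

(** The seminorms never compare values on the two half-lattices, so extension
    by zero preserves test functions. *)
Definition extend (f : Z -> C) : lattice -> C := fun s => if fst s then f (snd s) else 0.

Lemma qschwartz_extend (f : Z -> C) : schwartz p f -> qschwartz q (extend f).
Proof.
  intros H k l. destruct (H l k) as [c Hc].
  assert (Hc0 : (0 <= c)%R) by (eapply Rle_trans; [apply Cmod_ge_0|apply (Hc 0%Z)]).
  exists (/ (1 - p) ^ l * c)%R.
  assert (Hp := hp). assert (Hp1 : (0 < (1 - p) ^ l)%R) by (apply pow_lt; lra).
  intros [b m]. rewrite qder_n_half, RtoC_pow, lval_sgn.
  replace ((sgn b * zpow P m) ^ k * ((sgn b / (1 - P)) ^ l * dqn p l (half b (extend f)) m))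
    with ((sgn b ^ k * sgn b ^ l) * ((/ (1 - P)) ^ l * (zpow P m ^ k * dqn p l (half b (extend f)) m)))
    by (unfold Cdiv; rewrite !Cpow_mult_l; ring).
  rewrite Cmod_mult, (Cmod_mult (sgn b ^ k)), !Cmod_sgn_pow, !Rmult_1_l, Cmod_mult.
  rewrite Cpow_inv, Cmod_inv, Cmod_pow, Cmod_one_sub_P
    by (try apply Cpow_nz; apply one_sub_P_neq0).
  apply Rmult_le_compat_l; [now apply Rlt_le, Rinv_0_lt_compat|].
  destruct b; [apply Hc|].
  rewrite (dqn_ext p l (half false (extend f)) (fun m => 0 * f m))
    by (intros; unfold half, extend; simpl; ring).
  rewrite (dqn_scal p hp). replace (zpow P m ^ k * (0 * dqn p l f m)) with (RtoC 0) by ring.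
  now rewrite Cmod_0.
Qed.

(** ** The distribution [s_+ ^ (nu - 1) / Gamma nu] *)

Lemma qpoch_poch (a : C) (n : nat) : qpoch q a n = poch p a n.
Proof.
  induction n as [|n IH]; [reflexivity|].
  change (qpoch q a (S n)) with (qpoch q a n * (1 - a * RtoC (q ^ (2 * n)))).
  rewrite IH, pow_mult, RtoC_pow. reflexivity.
Qed.

Lemma qpoch_inf_poch (a : C) : qpoch_inf q a = poch_inf p a.
Proof.
  unfold qpoch_inf, poch_inf. f_equal. apply functional_extensionality, qpoch_poch.
Qed.

(** The weight of the q-integral supplies the missing power of [s]. *)
Lemma Rcpower_lval (nu : C) (m : Z) :
  RtoC (lval q (true, m)) * Rcpower (lval q (true, m)) (nu - 1) = zpow (qpow nu) m.
Proof.
  assert (Hpos : (0 < powerRZ q (2 * m))%R) by (apply powerRZ_lt; lra).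
  assert (El : lval q (true, m) = powerRZ q (2 * m)) by (unfold lval; simpl; ring).
  rewrite El. rewrite <- (Rcpower_1 (powerRZ q (2 * m)) Hpos) at 1.
  rewrite <- Rcpower_plus. replace (1 + (nu - 1)) with nu by ring.
  unfold qpow. rewrite <- Rcpower_Z.
  assert (L : ln (powerRZ q (2 * m)) = (2 * IZR m * ln q)%R).
  { rewrite powerRZ_Rpower by lra. unfold Rpower. now rewrite ln_exp, mult_IZR. }
  unfold Rcpower. rewrite L. destruct nu as [a b]. simpl.
  f_equal; f_equal; f_equal; ring.
Qed.

(** [qder] carries a factor [1 / (1 - p)] that [dq] does not. *)
Lemma at_zero_qder_n (psi : lattice -> C) (k : nat) :
  qschwartz q psi ->
  at_zero (qder_n q k psi) = (/ (1 - P)) ^ k * at_inf (dqn p k (half true psi)).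
Proof.
  intros H. apply Clim_seq_tends.
  apply (tends_ext eventually (fun m => (/ (1 - P)) ^ k * dqn p k (half true psi) (Z.of_nat m))).
  - intros m. rewrite qder_n_half. f_equal. f_equal. simpl. unfold Cdiv. ring.
  - apply tends_mult; [apply eventually_filter|apply tends_const, eventually_filter|].
    apply (at_inf_tends p hp), schwartz_dqn, schwartz_half, H.
Qed.

Lemma taylor_coef_taylor (psi : lattice -> C) (k : nat) :
  qschwartz q psi -> taylor_coef q psi k = taylor p (half true psi) k.
Proof.
  intros H. unfold taylor_coef, taylor, q2poch.
  rewrite at_zero_qder_n by exact H. rewrite qpoch_poch, RtoC_pow, RtoC_minus.
  rewrite Cpow_inv by apply one_sub_P_neq0. field.
  split; [apply (poch_P_neq0 p hp)|apply Cpow_nz, one_sub_P_neq0].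
Qed.

Lemma s_plus_reg_reg (n : nat) (nu : C) (psi : lattice -> C) :
  qschwartz q psi ->
  s_plus_reg q n nu psi = (1 - P) * reg p (S n) (qpow nu) (half true psi).
Proof.
  intros H. unfold s_plus_reg, reg, int_0_1, int_1_oo. cbv zeta.
  rewrite csum_sum_n, RtoC_minus.
  rewrite (Cseries_ext (fun m => RtoC (lval q (true, Z.of_nat m)) * (Rcpower (lval q (true, Z.of_nat m)) (nu - 1) * _))
             (fun m => qpow nu ^ m * remainder p (S n) (half true psi) m)).
  2: { intros m. rewrite Cmult_assoc, Rcpower_lval, zpow_nat. f_equal.
       unfold remainder. rewrite csum_sum_n. f_equal. apply csum_ext. intros i _.
       rewrite taylor_coef_taylor by exact H.
       now rewrite RtoC_pow, lval_true, zpow_nat. }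
  rewrite (Cseries_ext (fun m => RtoC (lval q (true, (- Z.of_nat (S m))%Z)) * _)
             (fun m => zpow (qpow nu) (- Z.of_nat (S m)) * half true psi (- Z.of_nat (S m))%Z)).
  2: { intros m. now rewrite Cmult_assoc, Rcpower_lval. }
  rewrite (csum_ext _ (fun k => (1 - P) * (taylor p (half true psi) k / (1 - qpow nu * P ^ k)))).
  2: { intros k _. rewrite taylor_coef_taylor by exact H.
       fold (qpow (nu + INR k)). rewrite qpow_plus, qpow_nat. unfold Cdiv. ring. }
  rewrite csum_scal. ring.
Qed.

Lemma s_plus_reg_eq (nu : C) (psi : lattice -> C) :
  qschwartz q psi ->
  exists N : nat, (Cmod (qpow nu * P ^ N) < 1)%R /\
    s_plus q nu psi = (1 - P) * reg p N (qpow nu) (half true psi).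
Proof.
  intros H. unfold s_plus. destruct (Rlt_dec 0 (Re nu)) as [Hnu|Hnu].
  - exists O. split.
    + simpl. rewrite Cmult_1_r. now apply Cmod_qpow_lt1.
    + unfold int_0_oo, int_0_1, int_1_oo, reg. cbv zeta. rewrite RtoC_minus.
      rewrite (Cseries_ext (fun m => RtoC (lval q (true, Z.of_nat m)) * _)
             (fun m => qpow nu ^ m * remainder p 0 (half true psi) m)).
      2: { intros m. rewrite Cmult_assoc, Rcpower_lval, zpow_nat. unfold remainder, half.
           simpl. ring. }
      rewrite (Cseries_ext (fun m => RtoC (lval q (true, (- Z.of_nat (S m))%Z)) * _)
             (fun m => zpow (qpow nu) (- Z.of_nat (S m)) * half true psi (- Z.of_nat (S m))%Z)).
      2: { intros m. now rewrite Cmult_assoc, Rcpower_lval. }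
      simpl csum. ring.
  - set (n := Z.to_nat (Int_part (- Re nu))). exists (S n). split.
    + rewrite <- qpow_nat, <- qpow_plus. apply Cmod_qpow_lt1.
      destruct (base_Int_part (- Re nu)) as [A B].
      assert (I : (0 <= Int_part (- Re nu))%Z).
      { assert (-1 < Int_part (- Re nu))%Z by (apply lt_IZR; lra). lia. }
      assert (E : INR n = IZR (Int_part (- Re nu)))
        by (unfold n; rewrite INR_IZR_INZ, Z2Nat.id by exact I; reflexivity).
      destruct nu as [a b]. rewrite S_INR, E. cbn [Re Im fst snd Cplus RtoC] in *. lra.
    + now apply s_plus_reg_reg.
Qed.

(** The factor [(1 - p) ^ nu] collects the [1 - p] of the q-integral and the power
    of [1 - p] in the q-Gamma function. *)
Definition continued_form (nu : C) (N : nat) : functional := fun psi =>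
  Rcpower (1 - p) nu * frac p N (qpow nu) (half true psi).

Lemma poch_inf_neq0_factor (a : C) (k : nat) : poch_inf p a <> 0 -> a * P ^ k <> 1.
Proof.
  intros H E. apply H. rewrite (poch_inf_split p hp a (S k)).
  change (poch p a (S k)) with (poch p a k * (1 - a * P ^ k)).
  rewrite E. ring.
Qed.

Lemma s_plus_div_Gamma (nu : C) (N : nat) (psi : lattice -> C) :
  poch_inf p (qpow nu) <> 0 -> (Cmod (qpow nu * P ^ N) < 1)%R -> qschwartz q psi ->
  s_plus q nu psi / qGamma q nu = continued_form nu N psi.
Proof.
  intros H0 HN H. destruct (s_plus_reg_eq nu psi H) as [M [HM E]].
  assert (Hf := schwartz_half true psi H).
  unfold continued_form. rewrite (frac_indep p hp N M) by (try apply qpow_neq0; assumption).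
  assert (R := reg_frac p hp M (qpow nu) (half true psi) (qpow_neq0 nu) HM
                 (fun k => poch_inf_neq0_factor _ k H0) Hf).
  assert (HPi := poch_inf_P_neq0 p hp).
  unfold qGamma. rewrite !qpoch_inf_poch. fold (qpow nu). rewrite E.
  assert (Hp := hp).
  assert (W : Rcpower (1 - p) (1 - nu) * Rcpower (1 - p) nu = 1 - P).
  { rewrite <- Rcpower_plus. replace (1 - nu + nu) with (RtoC 1) by ring.
    rewrite Rcpower_1 by lra. apply RtoC_minus. }
  assert (W0 := Rcpower_neq0 (1 - p) (1 - nu)).
  replace (frac p M (qpow nu) (half true psi))
    with (poch_inf p (qpow nu) * reg p M (qpow nu) (half true psi) / poch_inf p P)
    by (rewrite R; now field).
  rewrite <- W. field. repeat split; assumption.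
Qed.

(** Among the points [z] near a pole, only the pole itself satisfies
    [p ^ (z + k) = 1] for some [k]. *)
Lemma poles_isolated (nu : C) :
  poch_inf p (qpow nu) = 0 ->
  locally' (T := C_UniformSpace) nu (fun z => poch_inf p (qpow z) <> 0).
Proof.
  intros H. destruct (poch_inf_eq0 p hp _ H) as [k0 Hk0].
  assert (Hl : (ln q < 0)%R) by (rewrite <- ln_1; apply ln_increasing; lra).
  assert (RE : forall z k, qpow z * P ^ k = 1 -> Re z = (- INR k)%R).
  { intros z k E. rewrite <- qpow_nat, <- qpow_plus in E.
    assert (M : Cmod (qpow (z + INR k)) = 1%R) by (rewrite E; apply Cmod_1).
    unfold qpow in M. rewrite Cmod_Rcpower, Re_2_mult, <- exp_0 in M.
    apply exp_inv in M. destruct z as [a b]. simpl in *. nra. }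
  (* [1 / 2] separates the integers [Re z]; the second radius keeps the angle
     [t] below within [(-1, 1)], where [sin] vanishes only at [0] *)
  set (d := Rmin (1 / 2) (1 / (2 * - ln q))).
  assert (Hd : (0 < d)%R).
  { unfold d. apply Rmin_case; apply Rdiv_lt_0_compat; lra. }
  assert (Id : tends (locally (T := C_UniformSpace) nu) (fun z => z) nu).
  { apply tends_iff; [apply locally_filter|]. apply filterlim_id. }
  generalize (Id d Hd). unfold locally', within. apply filter_imp.
  refine (fun z : C => _). intros Hz Hne E. apply Hne. clear Hne.
  destruct (poch_inf_eq0 p hp _ E) as [k Hk].
  assert (R1 := RE _ _ Hk0). assert (R2 := RE _ _ Hk).
  assert (D1 : (Rabs (Re (z - nu)) < 1 / 2)%R).
  { eapply Rle_lt_trans; [apply Rabs_Re_le|].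
    eapply Rlt_le_trans; [exact Hz|apply Rmin_l]. }
  assert (D2 : (Rabs (Im (z - nu)) < 1 / (2 * - ln q))%R).
  { eapply Rle_lt_trans; [apply Rabs_Im_le|].
    eapply Rlt_le_trans; [exact Hz|apply Rmin_r]. }
  assert (Ek : k = k0).
  { apply Rabs_lt_between in D1.
    assert (Rs : Re (z - nu) = (INR k0 - INR k)%R).
    { destruct z as [a b], nu as [a' b']. simpl in *. lra. }
    rewrite Rs, !INR_IZR_INZ, <- minus_IZR in D1.
    assert (Z.of_nat k0 - Z.of_nat k < 1)%Z by (apply lt_IZR; lra).
    assert (-1 < Z.of_nat k0 - Z.of_nat k)%Z by (apply lt_IZR; lra). lia. }
  subst k.
  assert (Q : qpow (z - nu) = 1).
  { assert (HPk : P ^ k0 <> 0) by apply Cpow_nz, (P_neq0 p hp).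
    assert (Qz : qpow z = qpow (z - nu) * qpow nu)
      by (rewrite <- qpow_plus; f_equal; ring).
    rewrite Qz, <- Cmult_assoc, Hk0 in Hk. now rewrite Cmult_1_r in Hk. }
  set (t := (Im (2 * (z - nu)) * ln q)%R).
  assert (S0 : sin t = 0%R).
  { unfold qpow, Rcpower in Q. apply (f_equal snd) in Q. cbn [snd RtoC] in Q. fold t in Q.
    apply Rmult_integral in Q. destruct Q as [Q|Q]; [|exact Q].
    generalize (exp_pos (Re (2 * (z - nu)) * ln q)). lra. }
  assert (T : (Rabs t < 1)%R).
  { unfold t. rewrite Im_2_mult, !Rabs_mult, (Rabs_left (ln q)), (Rabs_pos_eq 2) by lra.
    apply (Rmult_lt_compat_r (2 * - ln q)) in D2; [|lra].
    replace (1 / (2 * - ln q) * (2 * - ln q))%R with 1%R in D2 by (field; lra). lra. }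
  assert (T0 : t = 0%R).
  { apply Rabs_lt_between in T. assert (PI1 := PI_4). assert (PI2 := PI2_1).
    destruct (Rtotal_order t 0) as [L|[L|L]]; [|exact L|].
    - assert (0 < sin (- t))%R by (apply sin_gt_0; lra). rewrite sin_neg in H0. lra.
    - assert (0 < sin t)%R by (apply sin_gt_0; lra). lra. }
  unfold t in T0. rewrite Im_2_mult in T0.
  destruct z as [a b], nu as [a' b']. simpl in *. f_equal; nra.
Qed.

(** Away from the poles this is [s_plus_div_Gamma]. At a pole, the nearby values
    are given by the same [N], and the right-hand side is continuous. *)
Lemma s_plus_over_Gamma_continued (nu : C) (N : nat) (psi : lattice -> C) :
  (Cmod (qpow nu * P ^ N) < 1)%R -> qschwartz q psi ->
  s_plus_over_Gamma q nu psi = continued_form nu N psi.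
Proof.
  intros HN H. assert (Hp := hp). unfold s_plus_over_Gamma.
  rewrite qpoch_inf_poch. fold (qpow nu).
  destruct (Ceq_dec (poch_inf p (qpow nu)) 0) as [H0|H0].
  2: { now apply s_plus_div_Gamma. }
  set (F := locally' (T := C_UniformSpace) nu).
  assert (FF : Filter F) by (apply within_filter, locally_filter).
  assert (Tq : tends F qpow (qpow nu)) by (apply tends_locally', tends_qpow).
  assert (L : tends F (fun z => s_plus q z psi / qGamma q z) (continued_form nu N psi)).
  { apply (tends_ext_loc F (fun z => continued_form z N psi)).
    - assert (TP : tends F (fun z => qpow z * P ^ N) (qpow nu * P ^ N)).
      { apply tends_mult; [exact FF|exact Tq|now apply tends_const]. }
      assert (He : (0 < 1 - Cmod (qpow nu * P ^ N))%R) by lra.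
      generalize (filter_and _ _ (poles_isolated nu H0) (TP _ He)).
      apply filter_imp. refine (fun z : C => _). intros [Hz Hz']. symmetry. apply s_plus_div_Gamma; [exact Hz| |exact H].
      generalize (Cmod_triangle (qpow nu * P ^ N) (qpow z * P ^ N - qpow nu * P ^ N)).
      replace (qpow nu * P ^ N + (qpow z * P ^ N - qpow nu * P ^ N)) with (qpow z * P ^ N) by ring.
      lra.
    - unfold continued_form. apply tends_mult; [exact FF| |].
      + apply tends_locally', tends_Rcpower.
      + apply (tends_frac p hp); [exact FF|apply qpow_neq0|exact HN| |exact Tq].
        now apply schwartz_half. }
  unfold Clim. apply Cthe_unique.
  - now apply (tends_iff F).
  - intros y Hy. apply (tends_iff F) in Hy.
    exact (tends_unique F _ _ _ (PF := locally'_C_proper nu) Hy L).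
Qed.

Lemma order_exists (nu : C) : exists N, (Cmod (qpow nu * P ^ N) < 1)%R.
Proof.
  destruct (geom_small p (Cmod (qpow nu)) 1 hp Rlt_0_1) as [N HN].
  exists N. rewrite Cmod_mult, (Cmod_Ppow p hp). now apply HN.
Qed.

Lemma qschwartz_lincomb (a b : C) (phi psi : lattice -> C) :
  qschwartz q phi -> qschwartz q psi -> qschwartz q (fun s => a * phi s + b * psi s).
Proof.
  intros H1 H2 k l. destruct (H1 k l) as [c Hc]. destruct (H2 k l) as [d Hd].
  exists (Cmod a * c + Cmod b * d)%R. intros [e m].
  specialize (Hc (e, m)). specialize (Hd (e, m)).
  rewrite qder_n_half.
  change (half e (fun s => a * phi s + b * psi s))
    with (fun m => a * half e phi m + b * half e psi m).
  rewrite (dqn_lincomb p hp).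
  rewrite qder_n_half in Hc, Hd.
  set (X := RtoC (lval q (e, m) ^ k)) in *. set (Y := (sgn e / (1 - P)) ^ l) in *.
  replace (X * (Y * (a * dqn p l (half e phi) m + b * dqn p l (half e psi) m)))
    with (a * (X * (Y * dqn p l (half e phi) m)) + b * (X * (Y * dqn p l (half e psi) m)))
    by ring.
  eapply Rle_trans; [apply Cmod_triangle|]. rewrite (Cmod_mult a), (Cmod_mult b).
  apply Rplus_le_compat; apply Rmult_le_compat_l; try apply Cmod_ge_0; assumption.
Qed.

Lemma frac_lincomb (N : nat) (x a b : C) (f g : Z -> C) :
  x <> 0 -> (Cmod (x * P ^ N) < 1)%R -> schwartz p f -> schwartz p g ->
  frac p N x (fun m => a * f m + b * g m) = a * frac p N x f + b * frac p N x g.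
Proof.
  intros Hx HN Hf Hg. unfold frac.
  rewrite (moment_ext _ _ _ (dqn_lincomb p hp a b f g N)).
  rewrite (moment_lincomb p hp); [ring| |apply Hf|apply Hg].
  split; [now apply (Cmod_xP p hp)|exact HN].
Qed.

Lemma s_plus_over_Gamma_linear (nu : C) : qlinear q (s_plus_over_Gamma q nu).
Proof.
  intros a b phi psi H1 H2. destruct (order_exists nu) as [N HN].
  rewrite !(s_plus_over_Gamma_continued nu N) by (try apply qschwartz_lincomb; assumption).
  unfold continued_form.
  change (half true (fun s => a * phi s + b * psi s))
    with (fun m => a * half true phi m + b * half true psi m).
  rewrite frac_lincomb; [ring|apply qpow_neq0|exact HN| |]; now apply schwartz_half.
Qed.

Lemma s_plus_over_Gamma_continuous (nu : C) : qcontinuous q (s_plus_over_Gamma q nu).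
Proof.
  intros psi0 H0 eps Heps. destruct (order_exists nu) as [N HN].
  assert (Hx : (0 < Cmod (qpow nu * P ^ N) < 1)%R)
    by (split; [apply (Cmod_xP p hp), qpow_neq0|exact HN]).
  destruct (moment_le p hp _ Hx) as [k [K [HK HM]]].
  set (c := Rcpower (1 - p) nu
    * ((- qpow nu) ^ N * gauss p N * (poch_inf p (qpow nu * P ^ N) / poch_inf p P))).
  assert (Hc := Cmod_ge_0 c).
  exists (Nat.max N k), (eps / (Cmod c * K + 1))%R.
  assert (HcK : (0 < Cmod c * K + 1)%R) by (generalize (Rmult_le_pos _ _ Hc HK); lra).
  set (d := (eps / (Cmod c * K + 1))%R).
  assert (Hd : (0 < d)%R) by (now apply Rdiv_lt_0_compat).
  split; [exact Hd|]. intros psi H HS.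
  set (g := fun s => psi s - psi0 s) in HS.
  assert (Hg : forall j, (j <= Nat.max N k)%nat -> forall m,
            (Cmod (zpow P m ^ j * dqn p N (half true g) m) <= d)%R).
  { intros j Hj m. apply half_seminorm, HS; [exact Hj|apply Nat.le_max_l]. }
  replace (s_plus_over_Gamma q nu psi - s_plus_over_Gamma q nu psi0)
    with (c * moment (qpow nu * P ^ N) (dqn p N (half true g))).
  - rewrite Cmod_mult.
    assert (M : (Cmod (moment (qpow nu * P ^ N) (dqn p N (half true g))) <= K * d)%R).
    { apply HM; intros m.
      - specialize (Hg O ltac:(lia) m). simpl in Hg. now rewrite Cmult_1_l in Hg.
      - apply Hg, Nat.le_max_r. }
    apply (Rle_lt_trans _ (Cmod c * (K * d))%R); [now apply Rmult_le_compat_l|].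
    assert (E : ((Cmod c * K + 1) * d)%R = eps) by (unfold d; field; lra).
    replace (Cmod c * (K * d))%R with ((Cmod c * K + 1) * d - d)%R by ring. lra.
  - rewrite !(s_plus_over_Gamma_continued nu N) by assumption.
    transitivity (Rcpower (1 - p) nu * frac p N (qpow nu) (half true g)).
    + unfold c, frac. ring.
    + unfold continued_form.
      rewrite (frac_ext p N _ (half true g) (fun m => 1 * half true psi m + - (1) * half true psi0 m))
        by (intros; unfold half, g; ring).
      rewrite frac_lincomb; [ring|apply qpow_neq0|exact HN| |]; now apply schwartz_half.
Qed.

Lemma s_plus_over_Gamma_distribution (nu : C) : qdistribution q (s_plus_over_Gamma q nu).
Proof. split; [apply s_plus_over_Gamma_linear|apply s_plus_over_Gamma_continuous]. Qed.

Lemma charges_positive (nu : C) (b : bool) : charges q (s_plus_over_Gamma q nu) b -> b = true.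
Proof.
  intros [psi [H [Hs Hne]]]. destruct b; [reflexivity|]. exfalso. apply Hne.
  destruct (order_exists nu) as [N HN].
  rewrite (s_plus_over_Gamma_continued nu N) by assumption. unfold continued_form.
  rewrite (frac_ext p N _ _ (fun m => 0 * half true psi m)).
  - rewrite (frac_scal p hp); [ring|apply qpow_neq0|exact HN|now apply schwartz_half].
  - intros m. unfold half. rewrite Hs by (simpl; discriminate). ring.
Qed.

(** ** The convolution *)

Lemma qshift_term_shift_term (psi : lattice -> C) (bx bs : bool) (a b : Z) (k : nat) :
  qshift_term q psi (bx, a) (bs, b) k
  = shift_term p (sgn bx * sgn bs * zpow P a) (half bs psi) b k.
Proof.
  unfold qshift_term, shift_term, qLambda, lscale. cbn [fst snd].
  rewrite qder_n_half, (RtoC_pow (1 - p)), (RtoC_pow (lval q (bx, a))), RtoC_minus, lval_sgn.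
  unfold q2poch.
  rewrite qpoch_poch. fold (b - Z.of_nat k)%Z.
  unfold Cdiv. rewrite !Cpow_mult_l.
  transitivity ((1 - P) ^ k * (/ (1 - P)) ^ k
    * (sgn bx ^ k * sgn bs ^ k * zpow P a ^ k * / poch p P k
       * dqn p k (half bs psi) (b - Z.of_nat k)%Z)); [ring|].
  rewrite Cpow_inv_cancel by apply one_sub_P_neq0. ring.
Qed.

Definition shifted (psi : lattice -> C) (xi s : lattice) : C := Cseries (qshift_term q psi xi s).

Lemma shifted_is_series (psi : lattice -> C) (xi s : lattice) :
  qschwartz q psi -> is_series (qshift_term q psi xi s) (shifted psi xi s).
Proof.
  intros H. apply summable_is_series. destruct xi as [bx a], s as [bs b].
  apply (summable_ext _ _ (fun k => eq_sym (qshift_term_shift_term psi bx bs a b k))).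
  apply (shift_term_summable p hp), (decreasing_bounded p), (schwartz_half bs psi H O).
Qed.

Lemma shifted_positive (psi : lattice -> C) (a b : Z) :
  shifted psi (true, a) (true, b) = qshift p (half true psi) a b.
Proof.
  unfold shifted, qshift. apply Cseries_ext. intros k.
  rewrite qshift_term_shift_term. simpl sgn. now rewrite !Cmult_1_l.
Qed.

(** Only the positive half-lattice is charged, so the extension by zero of [f]
    represents [phi]. *)
Lemma pairing_extend (nu : C) (N : nat) (phi : lattice -> C) (f : Z -> C) :
  (Cmod (qpow nu * P ^ N) < 1)%R -> schwartz p f -> (forall m, phi (true, m) = f m) ->
  is_qpairing q (s_plus_over_Gamma q nu) phi
    (Rcpower (1 - p) nu * frac p N (qpow nu) f).
Proof.
  intros HN Hf E. exists (extend f). assert (He := qschwartz_extend f Hf).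
  split; [exact He|]. split.
  - intros [b m] Hb. apply charges_positive in Hb. cbn [fst] in Hb. subst b.
    simpl. symmetry. apply E.
  - now apply (s_plus_over_Gamma_continued nu N).
Qed.

(** Applied to [(nu, mu)] and, by symmetry of the q-shift, to [(mu, nu)], this
    gives the two orders of the direct product. *)
Lemma iterated_pairing (nu mu : C) (psi : lattice -> C) (F : lattice -> lattice -> C) :
  qschwartz q psi ->
  (forall a b, F (true, a) (true, b) = qshift p (half true psi) a b) ->
  exists Phi : lattice -> C,
    (forall s, charges q (s_plus_over_Gamma q mu) (fst s) ->
       is_qpairing q (s_plus_over_Gamma q nu) (fun xi => F xi s) (Phi s)) /\
    is_qpairing q (s_plus_over_Gamma q mu) Phi (s_plus_over_Gamma q (nu + mu) psi).
Proof.
  intros H HF. assert (Hf := schwartz_half true psi H). assert (Hp := hp).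
  (* a common order [N] for [nu] and [mu] *)
  destruct (geom_small p (Cmod (qpow nu) + Cmod (qpow mu)) 1 hp Rlt_0_1) as [N HN].
  specialize (HN N (Nat.le_refl N)).
  assert (Hppos := pow_lt p N ltac:(lra)).
  assert (HNn : (Cmod (qpow nu * P ^ N) < 1)%R).
  { rewrite Cmod_mult, (Cmod_Ppow p hp). generalize (Cmod_ge_0 (qpow mu)). nra. }
  assert (HNm : (Cmod (qpow mu * P ^ N) < 1)%R).
  { rewrite Cmod_mult, (Cmod_Ppow p hp). generalize (Cmod_ge_0 (qpow nu)). nra. }
  assert (Hnm : (Cmod (qpow (nu + mu) * P ^ (N + N)) < 1)%R).
  { rewrite qpow_plus, Cpow_add_r.
    replace (qpow nu * qpow mu * (P ^ N * P ^ N)) with (qpow nu * P ^ N * (qpow mu * P ^ N)) by ring.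
    rewrite Cmod_mult. generalize (Cmod_ge_0 (qpow nu * P ^ N)) (Cmod_ge_0 (qpow mu * P ^ N)). nra. }
  set (c := Rcpower (1 - p) nu).
  set (g := partial_frac p N (qpow nu) (half true psi)).
  assert (Hg : schwartz p g) by (apply (partial_frac_schwartz p hp); [apply qpow_neq0| |]; assumption).
  exists (extend (fun b => c * g b)). split.
  - intros [b m] Hb. apply charges_positive in Hb. cbn [fst] in Hb. subst b.
    apply (pairing_extend nu N); [exact HNn| |].
    + now apply (qshift_schwartz_l p hp).
    + intros a. apply HF.
  - rewrite (s_plus_over_Gamma_continued (nu + mu) (N + N)) by assumption.
    unfold continued_form. rewrite Rcpower_plus, qpow_plus.
    rewrite <- (frac_partial_frac p hp N (qpow nu) (qpow mu)) by (try apply qpow_neq0; assumption).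
    fold c g.
    replace (c * Rcpower (1 - p) mu * frac p N (qpow mu) g)
      with (Rcpower (1 - p) mu * frac p N (qpow mu) (fun b => c * g b)).
    + apply pairing_extend; [exact HNm|now apply (schwartz_scal p hp)|reflexivity].
    + rewrite (frac_scal p hp); [ring|apply qpow_neq0|exact HNm|exact Hg].
Qed.

End Distributions.

Theorem proposition6p2 (q : R) (hq : (0 < q < 1)%R) (nu mu : C) :
  is_qconvolution q (s_plus_over_Gamma q nu) (s_plus_over_Gamma q mu)
    (s_plus_over_Gamma q (nu + mu)%C).
Proof.
  do 3 (split; [apply (s_plus_over_Gamma_distribution q hq)|]).
  intros psi H. exists (shifted q psi). split; [|split].
  - intros xi s. now apply (shifted_is_series q hq).
  - apply (iterated_pairing q hq nu mu psi); [exact H|].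
    intros a b. apply (shifted_positive q hq).
  - rewrite Cplus_comm.
    apply (iterated_pairing q hq mu nu psi (fun s xi => shifted q psi xi s)); [exact H|].
    intros a b. rewrite (shifted_positive q hq).
    apply (qshift_sym _ (q2_bounds q hq)), (decreasing_bounded (q ^ 2)).
    exact (schwartz_half q hq true psi H O).
Qed.
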